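(* Let $(M,g_M)$ and $(N,g_N)$ be oriented, $n$-dimensional Riemannian manifolds, and let $\varphi\colon M\to N$ be an orientation-preserving diffeomorphism with singular values $\alpha_1(x)\ge\cdots\ge\alpha_n(x)>0$ at each $x\in M$. Given $p,q\in[1,\infty]$ such that $1/p+1/q=1$, and some $k=0,\ldots,n$, suppose that the product $(\alpha_1\cdots\alpha_{n-k})^{1/p}(\alpha_{n-k+1}\cdots\alpha_n)^{-1/q}$ is bounded uniformly on $M$. Then, for any $\omega\in L^p\Omega^k(M)$, $$\bigl\lVert (\alpha_1\cdots\alpha_k)^{1/q}(\alpha_{k+1}\cdots\alpha_n)^{-1/p}\bigr\rVert_\infty^{-1}\lVert\omega\rVert_p\;\le\;\lVert\varphi_*\omega\rVert_p\;\le\;\bigl\lVert (\alpha_1\cdots\alpha_{n-k})^{1/p}(\alpha_{n-k+1}\cdots\alpha_n)^{-1/q}\bigr\rVert_\infty\lVert\omega\rVert_p.$$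
   Context: Singular values of a diffeomorphism: given $x\in M$, choose a positively oriented $g_M$-orthonormal basis of $T_xM$ and a positively oriented $g_N$-orthonormal basis of $T_{\varphi(x)}N$; let $\Phi$ be the $n\times n$ matrix of $T_x\varphi\colon T_xM\to T_{\varphi(x)}N$ in these bases. The singular values of $\varphi$ at $x$ are the singular values $\alpha_1(x)\ge\cdots\ge\alpha_n(x)>0$ of $\Phi$ (independent of the chosen bases). The spectral norm of a $k$-form $\omega$ at $x\in M$ is $|\omega|=\max_{0\ne X_1,\ldots,X_k\in T_xM}\frac{|\omega(X_1,\ldots,X_k)|}{|X_1|\cdots|X_k|}$, where $|X_i|=g_M(X_i,X_i)^{1/2}$ (for $k=0$ it is the absolute value), and similarly on $N$ using $g_N$. With $\mu_M,\mu_N$ the Riemannian volume forms, $\lVert\omega\rVert_p=\bigl(\int_M|\omega|^p\mu_M\bigr)^{1/p}$ for $p<\infty$ and $\lVert\omega\rVert_\infty$ is the essential supremum of $|\omega|$; similarly on $N$ using $\mu_N$. $L^p\Omega^k(M)$ is the space of (a.e. classes of) measurable $k$-forms $\omega$ on $M$ with $\lVert\omega\rVert_p<\infty$. For functions, $\lVert\cdot\rVert_\infty$ is the essential supremum norm. The pushforward is $\varphi_*=(\varphi^{-1})^*$ (defined pointwise almost everywhere for $L^p$ forms). Conventions: empty products equal $1$, $1/\infty=0$ in exponents, and $\lVert f\rVert_\infty^{-1}=0$ if $\lVert f\rVert_\infty=\infty$. *)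

(* Defs.v *)
From HB Require Import structures.
From mathcomp Require Import all_boot all_order all_algebra.
From mathcomp Require Import all_classical all_reals all_analysis.

Set Implicit Arguments.
Unset Strict Implicit.
Unset Printing Implicit Defensive.

Import Order.TTheory GRing.Theory Num.Theory.
Import numFieldNormedType.Exports.

Local Open Scope classical_set_scope.
Local Open Scope ring_scope.

(* Conventions.  Vectors are row vectors and linear maps act on the right, as
   in the library's Jacobian: 'D_v f a = v *m 'J f a.  Every point x of a
   manifold M carries a preferred chart [chart_at x] of the (maximal) atlas;
   T_x M is 'rV[R]_n, a tangent vector being represented by its components in
   the coordinate frame of [chart_at x].  The preferred charts at different
   points are unrelated, so smoothness and measurability of tensor fields are
   always tested in the frames of the charts of the atlas. *)

(* * Lebesgue measure on R^n, as an iterated product measure *)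

Definition cons_pair (T : Type) (n : nat) (x : T * n.-tuple T) : n.+1.-tuple T :=
  [tuple of x.1 :: x.2].

Section lebesgue_cons.
Context (R : realType) (n : nat).
Local Notation Rm := (measurableTypeR R).
Variable m : {sigma_finite_measure set (n.-tuple Rm) -> \bar R}.

Lemma measurable_cons_pair : measurable_fun [set: (Rm * n.-tuple Rm)%type]
  (@cons_pair Rm n).
Proof. exact: (@measurable_cons _ _ _ _ fst n snd). Qed.

Definition lebesgue_cons : set (n.+1.-tuple Rm) -> \bar R :=
  pushforward (lebesgue_measure \x m)%E (@cons_pair Rm n).

Let pf := measure_function_pushforward__canonical__measure_function_Measure
  (lebesgue_measure \x m)%E measurable_cons_pair.

HB.instance Definition _ := isMeasure.Build _ _ _ lebesgue_cons
  (measure0 pf) (@measure_ge0 _ _ _ pf) (@measure_semi_sigma_additive _ _ _ pf).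

Lemma lebesgue_cons_sigma_finite : sigma_finite setT lebesgue_cons.
Proof.
have /sigma_finiteP[F [TF ndF Foo]] := sigma_finiteT (@lebesgue_measure R).
have /sigma_finiteP[G [TG ndG Goo]] := sigma_finiteT m.
pose un (t : n.+1.-tuple Rm) : (Rm * n.-tuple Rm)%type :=
  (thead t, [tuple of behead t]).
have unK : cancel (@cons_pair Rm n) un.
  by move=> [a b]; rewrite /un theadE; congr pair; exact: val_inj.
have mun : measurable_fun setT un.
  apply/measurable_fun_pair; first exact: measurable_tnth.
  exact: measurable_behead.
exists (fun k => un @^-1` (F k `*` G k)).
  apply/esym; rewrite -subTset => t _.
  have [i _ Fi] : (\bigcup_i F i) (un t).1 by rewrite -TF.
  have [j _ Gj] : (\bigcup_i G i) (un t).2 by rewrite -TG.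
  exists (maxn i j) => //; split => /=.
    by move: (Fi); exact/subsetPset/ndF/leq_maxl.
  by move: (Gj); exact/subsetPset/ndG/leq_maxr.
move=> k; have [mF Fk] := Foo k; have [mG Gk] := Goo k.
have mFG : measurable (F k `*` G k) by exact: measurableX.
split; first by rewrite -[X in measurable X]setTI; exact: mun.
rewrite /lebesgue_cons /pushforward.
rewrite [X in product_measure1 _ _ X](_ : _ = F k `*` G k).
  by rewrite product_measure1E// lte_mul_pinfty// ge0_fin_numE.
by apply/funext => x; exact: (congr1 (F k `*` G k) (unK x)).
Qed.

HB.instance Definition _ := Measure_isSigmaFinite.Build _ _ _ lebesgue_cons
  lebesgue_cons_sigma_finite.

End lebesgue_cons.

Fixpoint lebesgue_n (R : realType) (n : nat) :
    {sigma_finite_measure set (n.-tuple (measurableTypeR R)) -> \bar R} :=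
  match n with
  | 0 => \d_([tuple] : 0.-tuple (measurableTypeR R))
  | n'.+1 => lebesgue_cons (lebesgue_n R n')
  end.

Definition row_of_tuple (R : realType) (n : nat)
  (t : n.-tuple (measurableTypeR R)) : 'rV[R]_n := \row_i tnth t i.

(* * Smooth manifolds *)

Fixpoint Cr_on (R : realType) (n : nat) (W : normedModType R) (r : nat)
    (U : set 'rV[R]_n) (f : 'rV[R]_n -> W) : Prop :=
  match r with
  | 0 => forall a, U a -> {for a, continuous f}
  | r'.+1 => (forall a, U a -> differentiable f a) /\
             (forall v, Cr_on r' U (fun a => 'D_v f a))
  end.

Definition smooth_on (R : realType) (n : nat) (W : normedModType R)
    (U : set 'rV[R]_n) (f : 'rV[R]_n -> W) : Prop :=
  forall r, Cr_on r U f.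

(* Only the values of [cmap] on [cdom] and of [cinv] on the image of [cdom]
   are meaningful. *)
Record chart (R : realType) (n : nat) (T : topologicalType) := Chart {
  cdom : set T;
  cmap : T -> 'rV[R]_n;
  cinv : 'rV[R]_n -> T }.

Record is_chart (R : realType) (n : nat) (T : topologicalType)
    (c : chart R n T) : Prop := IsChart {
  open_cdom : open (cdom c);
  open_cimage : open (cmap c @` cdom c);
  cmapK : forall x, cdom c x -> cinv c (cmap c x) = x;
  cmap_continuous : forall x, cdom c x -> {for x, continuous (cmap c)};
  cinv_continuous :
    forall x, cdom c x -> {for cmap c x, continuous (cinv c)} }.

Definition smooth_transition (R : realType) (n : nat) (T : topologicalType)
    (c c' : chart R n T) : Prop :=
  smooth_on (cmap c @` (cdom c `&` cdom c')) (cmap c' \o cinv c).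

(* The carrier is pointed, hence nonempty, because the library's measurable
   spaces are. *)
Record manifold (R : realType) (n : nat) := Manifold {
  carrier :> ptopologicalType;
  manifold_hausdorff : hausdorff_space carrier;
  manifold_second_countable : @second_countable carrier;
  atlas : set (chart R n carrier);
  atlas_chart : forall c, atlas c -> is_chart c;
  atlas_smooth : forall c c', atlas c -> atlas c' -> smooth_transition c c';
  atlas_maximal : forall c, is_chart c ->
    (forall c', atlas c' -> smooth_transition c c' /\ smooth_transition c' c) ->
    atlas c;
  chart_at : carrier -> chart R n carrier;
  chart_at_atlas : forall x, atlas (chart_at x);
  chart_at_dom : forall x, cdom (chart_at x) x }.

Definition borel (R : realType) (n : nat) (M : manifold R n) :=
  g_sigma_algebraType (@open M).

(* The rows are the coordinate vectors of the chart c, as elements of T_x M. *)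
Definition frame (R : realType) (n : nat) (M : manifold R n)
    (c : chart R n M) (x : M) : 'M[R]_n :=
  'J (cmap (chart_at x) \o cinv c) (cmap c x).

(* * Riemannian metrics, orientations and volume *)

(* [gram x] is the matrix of the inner product of T_x M. *)
Record riemannian_metric (R : realType) (n : nat) (M : manifold R n) :=
  RiemannianMetric {
  gram : M -> 'M[R]_n;
  gram_sym : forall x, (gram x)^T = gram x;
  gram_pos : forall x (v : 'rV[R]_n), v != 0 -> 0 < (v *m gram x *m v^T) 0 0;
  gram_smooth : forall c, atlas c ->
    smooth_on (cmap c @` cdom c) (fun a =>
      frame c (cinv c a) *m gram (cinv c a) *m (frame c (cinv c a))^T) }.

Definition gram_in (R : realType) (n : nat) (M : manifold R n)
    (g : riemannian_metric M) (c : chart R n M) (x : M) : 'M[R]_n :=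
  frame c x *m gram g x *m (frame c x)^T.

Definition tnorm (R : realType) (n : nat) (M : manifold R n)
    (g : riemannian_metric M) (x : M) (v : 'rV[R]_n) : R :=
  Num.sqrt ((v *m gram g x *m v^T) 0 0).

Definition positive_for (R : realType) (n : nat) (M : manifold R n)
    (neg : M -> bool) (x : M) (B : 'M[R]_n) : bool :=
  0 < (-1) ^+ neg x * \det B.

(* [oneg x] tells whether the coordinate frame of [chart_at x] at x is
   negatively oriented.  In dimension 0 this is an arbitrary sign at each
   point. *)
Record orientation (R : realType) (n : nat) (M : manifold R n) :=
  Orientation {
  oneg : M -> bool;
  oneg_continuous : forall c x, atlas c -> cdom c x ->
    \forall y \near x,
      positive_for oneg y (frame c y) = positive_for oneg x (frame c x) }.

(* [B] is a basis of T_x M given by its rows. *)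
Definition positive_basis (R : realType) (n : nat) (M : manifold R n)
    (o : orientation M) (x : M) (B : 'M[R]_n) : bool :=
  positive_for (oneg o) x B.

Definition orthonormal_basis (R : realType) (n : nat) (M : manifold R n)
    (g : riemannian_metric M) (x : M) (B : 'M[R]_n) : Prop :=
  B *m gram g x *m B^T = 1%:M.

(* The measure A |-> \int_A mu_g defined by the Riemannian volume form, which
   is sqrt (det (g_ij)) dx_1 ... dx_n in positively oriented coordinates.
   This determines mu on the Borel sets since M is second countable. *)
Definition riemannian_volume (R : realType) (n : nat) (M : manifold R n)
    (g : riemannian_metric M) (mu : {measure set (borel M) -> \bar R}) : Prop :=
  forall c, atlas c ->
  forall A : set (borel M), measurable A -> A `<=` cdom c ->
  mu A = (\int[lebesgue_n R n]_(t in [set t | (cmap c @` A) (row_of_tuple t)])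
            (Num.sqrt (\det (gram_in g c (cinv c (row_of_tuple t)))))%:E)%E.

(* * Diffeomorphisms and singular values *)

Definition smooth_map (R : realType) (n : nat) (M N : manifold R n)
    (f : M -> N) : Prop :=
  continuous f /\
  forall c c', atlas c -> atlas c' ->
    smooth_on (cmap c @` (cdom c `&` f @^-1` cdom c')) (cmap c' \o f \o cinv c).

Record diffeo (R : realType) (n : nat) (M N : manifold R n) := Diffeo {
  dfun :> M -> N;
  dinv : N -> M;
  dfunK : cancel dfun dinv;
  dinvK : cancel dinv dfun;
  dfun_smooth : smooth_map dfun;
  dinv_smooth : smooth_map dinv }.

(* The matrix of T_x f : T_x M -> T_(f x) N, acting on row vectors. *)
Definition tangent_map (R : realType) (n : nat) (M N : manifold R n)
    (f : M -> N) (x : M) : 'M[R]_n :=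
  'J (cmap (chart_at (f x)) \o f \o cinv (chart_at x)) (cmap (chart_at x) x).

Definition orientation_preserving (R : realType) (n : nat) (M N : manifold R n)
    (oM : orientation M) (oN : orientation N) (f : diffeo M N) : Prop :=
  forall x (B : 'M[R]_n), B \in unitmx ->
    positive_basis oN (f x) (B *m tangent_map f x) = positive_basis oM x B.

(* The decreasing sequence of the square roots of the eigenvalues of A^T A,
   counted with multiplicity. *)
Definition matrix_singular_values (R : realType) (n : nat) (A : 'M[R]_n)
    (s : 'I_n -> R) : Prop :=
  [/\ forall i, 0 <= s i,
      forall i j : 'I_n, (i <= j)%N -> s j <= s i &
      char_poly (A^T *m A) = \prod_(i < n) ('X - (s i ^+ 2)%:P)].

(* The columns of Phi are the coordinates in C of the images of the vectors
   of B. *)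
Definition singular_values (R : realType) (n : nat) (M N : manifold R n)
    (gM : riemannian_metric M) (gN : riemannian_metric N)
    (oM : orientation M) (oN : orientation N)
    (f : diffeo M N) (alpha : M -> 'I_n -> R) : Prop :=
  forall x (B C Phi : 'M[R]_n),
    positive_basis oM x B -> orthonormal_basis gM x B ->
    positive_basis oN (f x) C -> orthonormal_basis gN (f x) C ->
    B *m tangent_map f x = Phi^T *m C ->
    matrix_singular_values Phi (alpha x).

(* * Differential forms *)

(* [w x X] is the value of w at x on the k rows of X.  Multilinearity and
   alternation are phrased as in [determinant_multilinear] and
   [determinant_alternate]. *)
Definition kform (R : realType) (n : nat) (M : manifold R n) (k : nat)
    (w : M -> 'M[R]_(k, n) -> R) : Prop :=
  forall x,
    (forall (X Y Z : 'M[R]_(k, n)) (i : 'I_k) (a b : R),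
       row i X = a *: row i Y + b *: row i Z ->
       row' i Y = row' i X -> row' i Z = row' i X ->
       w x X = a * w x Y + b * w x Z) /\
    (forall (X : 'M[R]_(k, n)) (i j : 'I_k),
       i != j -> row i X = row j X -> w x X = 0).

(* The components of w in every chart are Borel functions. *)
Definition borel_form (R : realType) (n : nat) (M : manifold R n) (k : nat)
    (w : M -> 'M[R]_(k, n) -> R) : Prop :=
  kform w /\
  forall c, atlas c -> forall h : 'I_k -> 'I_n,
    measurable_fun (cdom c : set (borel M))
      (fun x : borel M => w x (rowsub h (frame c x)) : measurableTypeR R).

(* Lebesgue measurable: measurable for the completion of mu. *)
Definition measurable_form (R : realType) (n : nat) (M : manifold R n)
    (k : nat) (mu : {measure set (borel M) -> \bar R})
    (w : M -> 'M[R]_(k, n) -> R) : Prop :=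
  kform w /\
  exists2 w', borel_form w' & {ae mu, forall x : borel M, w x = w' x}.

Definition spectral_norm (R : realType) (n : nat) (M : manifold R n)
    (k : nat) (g : riemannian_metric M) (w : M -> 'M[R]_(k, n) -> R)
    (x : M) : R :=
  sup [set `|w x X| / \prod_(i < k) tnorm g x (row i X) |
       X in [set X : 'M[R]_(k, n) | forall i, row i X != 0]].

Definition form_Lnorm (R : realType) (n : nat) (M : manifold R n) (k : nat)
    (g : riemannian_metric M) (mu : {measure set (borel M) -> \bar R})
    (p : \bar R) (w : M -> 'M[R]_(k, n) -> R) : \bar R :=
  Lnorm mu p (fun x : borel M => (spectral_norm g w x)%:E).

(* Representatives of the classes in L^p Omega^k(M). *)
Definition Lp_form (R : realType) (n : nat) (M : manifold R n) (k : nat)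
    (g : riemannian_metric M) (mu : {measure set (borel M) -> \bar R})
    (p : \bar R) (w : M -> 'M[R]_(k, n) -> R) : Prop :=
  measurable_form mu w /\ (form_Lnorm g mu p w < +oo)%E.

Definition pullback (R : realType) (n : nat) (M N : manifold R n) (k : nat)
    (f : M -> N) (w : N -> 'M[R]_(k, n) -> R) : M -> 'M[R]_(k, n) -> R :=
  fun x X => w (f x) (X *m tangent_map f x).

Definition pushforward_form (R : realType) (n : nat) (M N : manifold R n)
    (k : nat) (f : diffeo M N) (w : M -> 'M[R]_(k, n) -> R) :
    N -> 'M[R]_(k, n) -> R :=
  pullback (dinv f) w.

Definition fun_Linfty (R : realType) (n : nat) (M : manifold R n)
    (mu : {measure set (borel M) -> \bar R}) (f : M -> R) : \bar R :=
  Lnorm mu +oo%E (fun x : borel M => (f x)%:E).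

(* 1/p as a real number, with 1/oo = 0. *)
Definition inv_exp (R : realType) (p : \bar R) : R := fine (p^-1)%E.

(* (alpha_1 ... alpha_m)^a (alpha_(m+1) ... alpha_n)^(- b) *)
Definition sv_weight (R : realType) (n : nat) (m : nat) (a b : R)
    (s : 'I_n -> R) : R :=
  (\prod_(i < n | (i < m)%N) s i) `^ a * (\prod_(i < n | (m <= i)%N) s i) `^ (- b).

(* Main.v *)
Require Import Defs.
From HB Require Import structures.
From mathcomp Require Import all_boot all_order all_algebra all_fingroup.
From mathcomp Require Import complex.
From mathcomp Require Import all_classical all_reals all_analysis.
From mathcomp Require Import measurable_realfun ess_sup_inf.
From mathcomp Require Import zify ring lra.

(** Both inequalities come from one principle, applied to [phi] and to its
    inverse.  Write [J] for the Jacobian of [phi], the product of its singular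
    values, and fix [x].

    Pointwise, the norm of [phi_* w] at [phi x] is at most the norm of [w] at [x]
    divided by the product of the [k] smallest singular values, and the norm of
    [w] at [x] is at most the product of the [k] largest ones times the norm of
    [phi_* w] at [phi x] ([pushforward_singular_bounds]).  Indeed the spectral
    norm of an alternating form may be computed with the volume of the
    parallelepiped spanned by the arguments instead of the product of their
    lengths ([form_norm_volume], and Hadamard's inequality for the converse,
    [form_norm_le]); a linear map multiplies [k]-dimensional volumes by at most
    the product of its [k] largest singular values, by the Cauchy-Binet formula
    in a basis of eigenvectors ([det_compression_le],
    [singular_value_gram_bounds]).  Multiplied by [J `^ p^-1], the first bound has
    on the right exactly the weight of the upper estimate, because
    [p^-1 - 1 = - q^-1]; multiplied by [J^-1 `^ p^-1], the second has the weight of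
    the lower estimate ([pushforward_weighted_bounds]).

    Globally, if [J `^ p^-1 * u (phi x) <= C * v x] for almost every [x] then the
    [L^p] norm of [u] is at most [C] times that of [v] ([diffeo_Lnorm_le]).  This
    is half of the change of variables formula, and rests on the bound of the
    volume of [phi @` A] by the integral of [J] over [A], up to a factor [1 + e]
    ([distortion_density]).  The bound is local: in charts [phi] is close to its
    derivative, so it maps a small cube into a slightly enlarged parallelepiped
    ([local_volume_distortion]); an inequality between measures
    that holds on dyadic cubes holds on Borel sets by regularity
    ([measure_le_dyadic]), and a linear map scales volumes by its determinant
    ([lebesgue_rV_mulmx]).  The local estimates are glued along a countable
    partition.  Integrals of nonnegative functions are treated as suprema over
    simple functions, so that spectral norms, which are suprema over uncountable
    families, can be integrated as they are.

    Finally the constant [C] decreases to the essential supremum of the weight,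
    and exchanging the roles of [phi] and its inverse gives the lower estimate. *)

Set Implicit Arguments.
Unset Strict Implicit.
Unset Printing Implicit Defensive.

Import Order.TTheory GRing.Theory Num.Theory.
Import numFieldNormedType.Exports.

Local Open Scope classical_set_scope.
Local Open Scope ring_scope.

(** * Alternating forms and the Cauchy-Binet formula *)

Section alternating_forms.
Variables (R : comNzRingType).
Implicit Types (k m n : nat).

Definition multilinear_form k n (u : 'M[R]_(k, n) -> R) :=
  forall (X Y Z : 'M[R]_(k, n)) (i : 'I_k) (a b : R),
    (forall j, X i j = a * Y i j + b * Z i j) ->
    (forall i' j, i' != i -> Y i' j = X i' j) ->
    (forall i' j, i' != i -> Z i' j = X i' j) ->
    u X = a * u Y + b * u Z.

Definition alternating_form k n (u : 'M[R]_(k, n) -> R) :=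
  multilinear_form u /\
  forall (X : 'M[R]_(k, n)) (i j : 'I_k), i != j ->
    (forall l, X i l = X j l) -> u X = 0.

Lemma det_alternating n : alternating_form (fun A : 'M[R]_n => \det A).
Proof.
split=> [X Y Z i a b XYZ YX ZX|X i j ij Xij]; last first.
  exact: determinant_alternate ij Xij.
apply: (@determinant_multilinear _ _ X Y Z i).
- by apply/rowP => j; rewrite !mxE.
- by apply/matrixP => i' j; rewrite !mxE YX // eq_sym neq_lift.
- by apply/matrixP => i' j; rewrite !mxE ZX // eq_sym neq_lift.
Qed.

Lemma multilinear_form0 k n (u : 'M[R]_(k, n) -> R) (X : 'M[R]_(k, n)) i :
  multilinear_form u -> (forall j, X i j = 0) -> u X = 0.
Proof.
move=> uL X0; rewrite (uL X X X i 0 0) ?mul0r ?addr0 // => j.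
by rewrite X0 mul0r addr0.
Qed.

Lemma multilinear_form_sum k n (u : 'M[R]_(k, n) -> R) (I : finType)
    (X : 'M[R]_(k, n)) (Y : I -> 'M[R]_(k, n)) (a : I -> R) i :
  multilinear_form u ->
  (forall j, X i j = \sum_l a l * Y l i j) ->
  (forall l i' j, i' != i -> Y l i' j = X i' j) ->
  u X = \sum_l a l * u (Y l).
Proof.
move=> uL XE YE.
pose Z (s : seq I) := \matrix_(i', j)
  (if i' == i then \sum_(l <- s) a l * Y l i j else X i' j).
suff H s : u (Z s) = \sum_(l <- s) a l * u (Y l).
  rewrite -H; congr u; apply/matrixP => i' j; rewrite mxE.
  by case: eqP => // ->; rewrite XE.
elim: s => [|l s IHs].
  rewrite big_nil (@multilinear_form0 _ _ _ _ i)// => j.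
  by rewrite mxE eqxx big_nil.
rewrite big_cons -IHs -[u (Z s)]mul1r; apply: (uL _ _ _ i).
- by move=> j; rewrite !mxE eqxx big_cons mul1r.
- by move=> i' j ii'; rewrite !mxE (negbTE ii') YE.
- by move=> i' j ii'; rewrite !mxE (negbTE ii').
Qed.

Definition cons_row k n (r : 'rV[R]_n) (Y : 'M[R]_(k, n)) : 'M[R]_(k.+1, n) :=
  \matrix_(i, j) (if unlift ord0 i is Some i' then Y i' j else r 0 j).

Lemma multilinear_form_cons_row k n (u : 'M[R]_(k.+1, n) -> R) r :
  multilinear_form u -> multilinear_form (fun Y => u (cons_row r Y)).
Proof.
move=> uL X Y Z i a b XYZ YX ZX; apply: (uL _ _ _ (lift ord0 i)).
- by move=> j; rewrite !mxE liftK.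
- move=> i' j; rewrite !mxE; case: unliftP => // i1 ->.
  by rewrite (inj_eq lift_inj) => /YX.
- move=> i' j; rewrite !mxE; case: unliftP => // i1 ->.
  by rewrite (inj_eq lift_inj) => /ZX.
Qed.

(** Expanding every row of [A *m X] over the rows of [X].  One expansion serves
    three purposes: the transformation law by the determinant, the Cauchy-Binet
    formula, and the bound of a form by its finitely many components. *)
Lemma multilinear_form_mulmx k m n (u : 'M[R]_(k, n) -> R) (A : 'M[R]_(k, m))
    (X : 'M[R]_(m, n)) : multilinear_form u ->
  u (A *m X) =
  \sum_(f : {ffun 'I_k -> 'I_m}) (\prod_i A i (f i)) * u (rowsub f X).
Proof.
elim: k u A => [|k IHk] u A uL.
  rewrite (big_pred1 [ffun i : 'I_0 => match notF (valP i) with end]).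
    rewrite big_ord0 mul1r; congr u; apply/matrixP; by case.
  by move=> f; apply/esym/eqP/ffunP; case.
rewrite (@multilinear_form_sum _ _ _ 'I_m _
    (fun l => cons_row (row l X) (rowsub (lift ord0) A *m X)) (A ord0) ord0) //.
- transitivity (\sum_l \sum_(g : {ffun 'I_k -> 'I_m})
     (A ord0 l * \prod_i A (lift ord0 i) (g i)) *
        u (cons_row (row l X) (rowsub g X))).
    apply: eq_bigr => l _; rewrite (IHk (fun Y => u (cons_row (row l X) Y))).
      rewrite big_distrr /=; apply: eq_bigr => g _; rewrite mulrA.
      congr (_ * _ * _); apply: eq_bigr => i _; by rewrite mxE.
    exact: multilinear_form_cons_row.
  rewrite pair_bigA /=.
  pose F (p : 'I_m * {ffun 'I_k -> 'I_m}) : {ffun 'I_k.+1 -> 'I_m} :=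
    [ffun i => if unlift ord0 i is Some i' then p.2 i' else p.1].
  pose G (f : {ffun 'I_k.+1 -> 'I_m}) : 'I_m * {ffun 'I_k -> 'I_m} :=
    (f ord0, [ffun i => f (lift ord0 i)]).
  rewrite (reindex F) /=; last first.
    exists G => [[l g]|f] _.
      rewrite /G /F; congr pair; first by rewrite ffunE unlift_none.
      by apply/ffunP => i; rewrite !ffunE liftK.
    by apply/ffunP => i; rewrite ffunE; case: unliftP => [j|] ->; rewrite ?ffunE.
  apply: eq_bigr => -[l g] _ /=; rewrite big_ord_recl /F ffunE unlift_none.
  congr (_ * _ * _).
    by apply: eq_bigr => i _; rewrite ffunE liftK.
  congr u; apply/matrixP => i j; rewrite !mxE ffunE.
  by case: unliftP => [i'|] _; rewrite ?mxE.
- move=> j; rewrite mxE; apply: eq_bigr => l _.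
  by rewrite mxE unlift_none mxE.
- move=> l i' j; rewrite !mxE; case: unliftP => [i1 ->|->]; last by rewrite eqxx.
  by move=> _; rewrite mxE; apply: eq_bigr => i _; rewrite mxE.
Qed.

(** Polarization: the form vanishes when rows [i] and [j] are both replaced by
    their sum, and of the four terms of the expansion two vanish as well. *)
Lemma alternating_form_tperm k n (u : 'M[R]_(k, n) -> R) (X : 'M[R]_(k, n)) i j :
  alternating_form u -> i != j -> u (row_perm (tperm i j) X) = - u X.
Proof.
move=> [uL uA] ij.
pose Z (p q : 'I_k -> R) := \matrix_(i', l)
  (if i' == i then p i * X i l + p j * X j l
   else if i' == j then q i * X i l + q j * X j l else X i' l).
pose e (a : 'I_k) b : R := (a == b)%:R.
pose s b : R := e i b + e j b.
have ji : j != i by rewrite eq_sym.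
have Zl q : u (Z s q) = u (Z (e i) q) + u (Z (e j) q).
  rewrite -[u (Z (e i) q)]mul1r -[u (Z (e j) q)]mul1r; apply: (uL _ _ _ i).
  - by move=> l; rewrite !mxE !eqxx /s; ring.
  - by move=> i' l ii; rewrite !mxE (negbTE ii).
  - by move=> i' l ii; rewrite !mxE (negbTE ii).
have Zr q : u (Z q s) = u (Z q (e i)) + u (Z q (e j)).
  rewrite -[u (Z q (e i))]mul1r -[u (Z q (e j))]mul1r; apply: (uL _ _ _ j).
  - by move=> l; rewrite !mxE !eqxx (negbTE ji) /s; ring.
  - by move=> i' l ii; rewrite !mxE (negbTE ii).
  - by move=> i' l ii; rewrite !mxE (negbTE ii).
have Z0 q : u (Z q q) = 0.
  by apply: (uA _ i j ij) => l; rewrite !mxE !eqxx (negbTE ji).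
have := Z0 s; rewrite Zl !Zr !Z0 add0r addr0 => /eqP.
rewrite addrC addr_eq0 => /eqP.
rewrite (_ : Z (e i) (e j) = X); last first.
  apply/matrixP => i' l; rewrite mxE /e !eqxx (negbTE ij) (negbTE ji).
  by case: eqP => [->|_]; [|case: eqP => [->|//]]; rewrite /=; ring.
rewrite (_ : Z (e j) (e i) = row_perm (tperm i j) X) //.
apply/matrixP => i' l; rewrite !mxE /e !eqxx (negbTE ij) (negbTE ji).
case: tpermP => [->|->|/eqP/negbTE-> /eqP/negbTE->//].
  by rewrite eqxx /=; ring.
by rewrite (negbTE ji) eqxx /=; ring.
Qed.

Lemma alternating_form_perm k n (u : 'M[R]_(k, n) -> R) (X : 'M[R]_(k, n))
    (s : 'S_k) :
  alternating_form u -> u (row_perm s X) = (-1) ^+ s * u X.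
Proof.
move=> uA; have [ts -> /=] := prod_tpermP s.
elim: ts X => [|[i j] ts IHts] X /=.
  by move=> _; rewrite big_nil row_perm1 odd_perm1 mul1r.
case/andP => /= ij dts; rewrite big_cons row_permM alternating_form_tperm //.
by rewrite IHts // odd_permM odd_tperm ij addTb signrN mulNr.
Qed.

Lemma alternating_form_det k n (u : 'M[R]_(k, n) -> R) (L : 'M[R]_k)
    (X : 'M[R]_(k, n)) :
  alternating_form u -> u (L *m X) = \det L * u X.
Proof.
move=> uA; rewrite multilinear_form_mulmx; last by case: uA.
rewrite (bigID (fun f : {ffun 'I_k -> 'I_k} => injectiveb f)) /=.
rewrite addrC big1 ?add0r => [|f Uf].
  rewrite (reindex (@pval _)) /=; last first.
    pose in_Sn := insubd (1%g : 'S_k).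
    by exists in_Sn => /= f Uf; first apply: val_inj; apply: insubdK.
  rewrite /determinant big_distrl; apply: eq_big => /= [s | s _].
    by rewrite ?(valP s).
  rewrite -mulrA mulrCA; congr (_ * _).
    by apply: eq_bigr => i _; rewrite pvalE.
  rewrite -alternating_form_perm //; congr u.
  by apply/matrixP => i j; rewrite !mxE pvalE.
case/injectivePn: Uf => i1 [i2 Di12 Ef12].
case: uA => _ /(_ _ i1 i2 Di12) ->; first by rewrite mulr0.
by move=> l; rewrite !mxE Ef12.
Qed.

(** The sum runs over all maps [f], not only the increasing ones; those that
    are not injective contribute nothing, and the product of the two minors on
    a given set of [k] indices occurs once for each ordering of the set. *)
Lemma cauchy_binet k n (A : 'M[R]_(k, n)) (B : 'M[R]_(n, k)) :
  (k`!)%:R * \det (A *m B) =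
  \sum_(f : {ffun 'I_k -> 'I_n}) \det (colsub f A) * \det (rowsub f B).
Proof.
have detA := det_alternating k.
transitivity (\sum_(s : 'S_k) \det (A *m B)).
  by rewrite -(card_Sn k) mulr_natl -sumr_const; apply: eq_bigl.
transitivity (\sum_(s : 'S_k) \sum_(f : {ffun 'I_k -> 'I_n})
  (-1) ^+ s * (\prod_i A i (f (s i))) * \det (rowsub f B)).
  apply: eq_bigr => s _.
  rewrite (multilinear_form_mulmx _ _ detA.1).
  rewrite (reindex (fun f : {ffun 'I_k -> 'I_n} => [ffun i => f (s i)])) /=.
    apply: eq_bigr => f _; rewrite [X in _ * \det X](_ : _ =
        row_perm s (rowsub f B)).
      rewrite (alternating_form_perm _ _ detA) mulrA [X in X * _]mulrC.
      by congr (_ * _ * _); apply: eq_bigr => i _; rewrite ffunE.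
    by apply/matrixP => i j; rewrite !mxE ffunE.
  exists (fun f : {ffun 'I_k -> 'I_n} => [ffun i => f ((s^-1)%g i)]) => f _.
    by apply/ffunP => i; rewrite !ffunE permKV.
  by apply/ffunP => i; rewrite !ffunE permK.
rewrite exchange_big; apply: eq_bigr => f _.
rewrite -big_distrl; congr (_ * _); rewrite /determinant.
by apply: eq_bigr => s _; congr (_ * _); apply: eq_bigr => i _; rewrite mxE.
Qed.

End alternating_forms.

(** * Positive definite matrices and Hadamard's inequality *)

Section positive_definite.
Variable R : rcfType.

Definition posdef n (G : 'M[R]_n) :=
  G^T = G /\ forall v : 'rV[R]_n, v != 0 -> 0 < (v *m G *m v^T) 0 0.

Lemma posdef_congr k n (G : 'M[R]_n) (L : 'M[R]_(k, n)) : posdef G ->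
  (forall v : 'rV_k, v *m L = 0 -> v = 0) -> posdef (L *m G *m L^T).
Proof.
move=> [Gs Gp] Linj; split; first by rewrite !trmx_mul trmxK Gs mulmxA.
move=> v v0; have := Gp (v *m L).
rewrite trmx_mul !mulmxA; apply; apply: contra v0 => /eqP/Linj->//.
Qed.

Lemma posdef_det_neq0 n (G : 'M[R]_n) : posdef G -> \det G != 0.
Proof.
move=> [_ Gp]; apply/negP => /det0P[v /Gp + v0].
by rewrite v0 mul0mx mxE ltxx.
Qed.

(** One step of Gaussian elimination, on rows and columns at once.  The last
    clause, that the Schur complement has the smaller diagonal, is what makes
    Hadamard's inequality an induction. *)
Lemma posdef_schur n (G : 'M[R]_(1 + n)) : posdef G ->
  exists (L : 'M[R]_(1 + n)) (S : 'M[R]_n),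
  [/\ \det L = 1, L *m G *m L^T = block_mx (G 0 0)%:M 0 0 S, posdef S &
      forall i, S i i <= G (rshift 1 i) (rshift 1 i)].
Proof.
move=> pG; have [Gs Gp] := pG.
set a := G 0 0.
have a0 : 0 < a.
  have := Gp (delta_mx 0 0); rewrite -rowE trmx_delta -colE !mxE; apply.
  by apply/eqP => /matrixP/(_ 0 0); rewrite !mxE !eqxx => /eqP; rewrite oner_eq0.
have a0' : a != 0 by rewrite gt_eqF.
pose b : 'rV[R]_n := ursubmx G.
have GE : G = block_mx a%:M b b^T (drsubmx G).
  rewrite -[LHS]submxK; congr block_mx; last by rewrite trmx_ursub Gs.
  by rewrite [LHS]mx11_scalar; congr _%:M; rewrite !mxE !lshift0.
pose L : 'M[R]_(1 + n) := block_mx 1%:M 0 (- a^-1 *: b^T) 1%:M.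
pose S := drsubmx G - a^-1 *: (b^T *m b).
have dL : \det L = 1 by rewrite det_lblock !det1 mulr1.
have LG : L *m G *m L^T = block_mx a%:M 0 0 S.
  rewrite {1}GE /L tr_block_mx !mulmx_block !trmx1 !trmx0 !mul1mx !mul0mx.
  rewrite !mulmx0 !mulmx1 !addr0 linearZ /= trmxK mul_scalar_mx scalerA.
  rewrite -!scalemxAl mul_mx_scalar scalerA mulrN mulNr mulVf // mulfV //.
  by rewrite !scaleN1r !addNr mul0mx add0r addrC scaleNr.
have pLG : posdef (L *m G *m L^T).
  apply: posdef_congr => // v vL; apply/eqP/negPn/negP => v0.
  by have : \det L = 0; [apply/eqP/det0P; exists v|rewrite dL => /eqP; rewrite oner_eq0].
exists L, S; split => //.
  have := @posdef_congr n _ _ (row_mx (0 : 'M[R]_(n, 1)) 1%:M) pLG.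
  rewrite LG tr_row_mx mul_row_block mul_row_col !mul0mx !mulmx0 trmx1 !mulmx1.
  rewrite !mul1mx !add0r trmx0 mulmx0 add0r; apply => v.
  by rewrite mul_mx_row mulmx0 mulmx1 => /eqP; rewrite row_mx_eq0 => /andP[_ /eqP].
move=> i; rewrite !mxE big_ord1 !mxE lerBlDr lerDl.
by apply: mulr_ge0; [rewrite invr_ge0 ltW|rewrite -expr2 sqr_ge0].
Qed.

Lemma posdef_orthonormal n (G : 'M[R]_n) : posdef G ->
  exists B : 'M[R]_n, B *m G *m B^T = 1%:M.
Proof.
elim: n G => [|n IHn] G pG; first by exists 1%:M; apply/matrixP; case.
have [L [S [dL LG /IHn[B BS] _]]] := @posdef_schur n G pG.
have a0 : 0 < G 0 0.
  case: pG => _ /(_ (delta_mx 0 0)); rewrite -rowE trmx_delta -colE !mxE; apply.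
  by apply/eqP => /matrixP/(_ 0 0); rewrite !mxE !eqxx => /eqP; rewrite oner_eq0.
pose D : 'M[R]_(1 + n) := block_mx (Num.sqrt (G 0 0))^-1%:M 0 0 B.
exists (D *m L).
have DE : D *m block_mx (G 0 0)%:M 0 0 S *m D^T = 1%:M.
  rewrite /D tr_block_mx !mulmx_block !trmx0 tr_scalar_mx !mul0mx !mulmx0.
  rewrite ?mulmx0 ?addr0 ?add0r BS -!scalar_mxM ?mul0mx ?mulmx0 scalar_mx_block.
  congr (block_mx _%:M _ _ _); rewrite -[X in _ * X * _]sqr_sqrtr ?ltW// expr2.
  by rewrite mulrA mulVf ?gt_eqF ?sqrtr_gt0// mul1r mulfV// gt_eqF ?sqrtr_gt0.
by rewrite trmx_mul !mulmxA -(mulmxA D L G) -(mulmxA D (L *m G) L^T) LG.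
Qed.

Lemma posdef_det_gt0 n (G : 'M[R]_n) : posdef G -> 0 < \det G.
Proof.
move=> pG; have [B BG] := posdef_orthonormal pG.
have : (\det B) ^+ 2 * \det G = 1.
  by have := congr1 determinant BG; rewrite !det_mulmx det_tr det1 => <-; ring.
move=> dBG; rewrite lt_def posdef_det_neq0 //=.
have B2 : 0 < (\det B) ^+ 2.
  rewrite lt_def sqr_ge0 andbT; apply/eqP => B0; move: dBG.
  by rewrite B0 mul0r => /esym/eqP; rewrite oner_eq0.
by rewrite -(pmulr_rge0 _ B2) dBG ler01.
Qed.

Lemma hadamard n (G : 'M[R]_n) : posdef G -> \det G <= \prod_i G i i.
Proof.
elim: n G => [|n IHn] G pG; first by rewrite det_mx00 big_ord0.
have [L [S [dL LG pS SG]]] := @posdef_schur n G pG.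
have dG : \det G = G 0 0 * \det S.
  transitivity (\det (L *m G *m L^T)); first by rewrite !det_mulmx det_tr dL mul1r mulr1.
  by rewrite LG det_ublock det_scalar1.
have dia m (H : 'M[R]_m) i : posdef H -> 0 < H i i.
  case=> _ /(_ (delta_mx 0 i)); rewrite -rowE trmx_delta -colE !mxE; apply.
  by apply/eqP => /matrixP/(_ 0 i); rewrite !mxE !eqxx => /eqP; rewrite oner_eq0.
rewrite dG big_ord_recl; apply: ler_wpM2l; first exact/ltW/dia.
apply: le_trans (IHn _ pS) _; apply: ler_prod => i _.
rewrite (ltW (dia _ _ _ pS)) /=; apply: le_trans (SG i) _.
by rewrite (_ : rshift 1 i = lift ord0 i) //; apply: val_inj.
Qed.

End positive_definite.

(** * The spectral norm of an alternating form *)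

Section spectral_norm_of_forms.
Variable R : realType.
Implicit Types (k n : nat).

Definition gram_norm n (G : 'M[R]_n) (v : 'rV[R]_n) : R :=
  Num.sqrt ((v *m G *m v^T) 0 0).

(** The spectral norm of a form on a single tangent space. *)
Definition form_norm k n (G : 'M[R]_n) (u : 'M[R]_(k, n) -> R) : R :=
  sup [set `|u X| / \prod_(i < k) gram_norm G (row i X) |
       X in [set X : 'M[R]_(k, n) | forall i, row i X != 0]].

Lemma row_gramE k n (G : 'M[R]_n) (X : 'M[R]_(k, n)) i :
  (row i X *m G *m (row i X)^T) 0 0 = (X *m G *m X^T) i i.
Proof.
rewrite -row_mul mxE [RHS]mxE; apply: eq_bigr => j _.
by congr (_ * _); rewrite !mxE.
Qed.

Lemma gram_norm_ge0 n (G : 'M[R]_n) v : 0 <= gram_norm G v.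
Proof. exact: sqrtr_ge0. Qed.

Lemma gram_norm_gt0 n (G : 'M[R]_n) v : posdef G -> v != 0 -> 0 < gram_norm G v.
Proof. by move=> [_ Gp] v0; rewrite sqrtr_gt0 Gp. Qed.

Lemma alternating_form_dependent k n (u : 'M[R]_(k, n) -> R) X (v : 'rV[R]_k) :
  alternating_form u -> v != 0 -> v *m X = 0 -> u X = 0.
Proof.
move=> [uL uA] v0 vX.
have [i0 vi0] : exists i, v 0 i != 0 by apply/rV0Pn.
pose Y l : 'M[R]_(k, n) := \matrix_(i, j) (if i == i0 then X l j else X i j).
pose Z : 'M[R]_(k, n) := \matrix_(i, j) (if i == i0 then 0 else X i j).
have Z0 : u Z = 0.
  by apply: (@multilinear_form0 _ _ _ _ _ i0) => // j; rewrite mxE eqxx.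
have : u Z = \sum_l v 0 l * u (Y l).
  apply: (@multilinear_form_sum _ _ _ _ _ _ _ _ i0) => //.
    move=> j; transitivity ((v *m X) 0 j); first by rewrite vX !mxE eqxx.
    by rewrite mxE; apply: eq_bigr => l _; rewrite mxE eqxx.
  by move=> l i' j ii; rewrite !mxE (negbTE ii).
rewrite Z0 (bigD1 i0) //= big1 => [|l li0].
  rewrite addr0 => /esym/eqP; rewrite mulf_eq0 (negbTE vi0) /= => /eqP <-.
  by congr u; apply/matrixP => i j; rewrite !mxE; case: eqP => [->|].
rewrite (uA _ l i0 li0) ?mulr0 // => j; rewrite !mxE eqxx.
by rewrite (negbTE li0).
Qed.

(** In an orthonormal basis the coordinates of a vector are at most its length,
    so the sum of the absolute values of the components of [u] is a bound. *)
Lemma form_norm_has_ubound k n (G : 'M[R]_n) (u : 'M[R]_(k, n) -> R) :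
  posdef G -> alternating_form u ->
  has_ubound [set `|u X| / \prod_(i < k) gram_norm G (row i X) |
       X in [set X : 'M[R]_(k, n) | forall i, row i X != 0]].
Proof.
move=> pG [uL _]; have [B BG] := posdef_orthonormal pG.
have Bu : B \in unitmx by have /mulmx1_unit[] : B *m (G *m B^T) = 1%:M by rewrite mulmxA.
exists (\sum_(f : {ffun 'I_k -> 'I_n}) `|u (rowsub f B)|) => _ [X X0 <-].
rewrite ler_pdivrMr; last by apply: prodr_gt0 => i _; exact: gram_norm_gt0.
rewrite -{1}(mulmxKV Bu X) (multilinear_form_mulmx _ _ uL).
apply: le_trans (ler_norm_sum _ _ _) _; rewrite mulr_suml.
apply: ler_sum => f _; rewrite normrM mulrC ler_wpM2l // normr_prod.
apply: ler_prod => i _; rewrite normr_ge0 /=.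
have : X = X *m invmx B *m B by rewrite mulmxKV.
move: (X *m invmx B) => Y XY.
rewrite /gram_norm row_gramE {1 2}XY.
have -> : Y *m B *m G *m (Y *m B)^T = Y *m Y^T.
  by rewrite trmx_mul mulmxA -2!(mulmxA Y) BG mulmx1.
rewrite -sqrtr_sqr ler_wsqrtr // mxE (bigD1 (f i)) //= mxE expr2 lerDl.
by apply: sumr_ge0 => j _; rewrite mxE -expr2 sqr_ge0.
Qed.

Lemma form_norm_ge0 k n (G : 'M[R]_n) (u : 'M[R]_(k, n) -> R) :
  posdef G -> alternating_form u -> 0 <= form_norm G u.
Proof.
move=> pG uA; rewrite /form_norm; set A := [set _ | _ in _].
have [[x [X X0 xE]]|A0] := pselect (A !=set0); last first.
  by rewrite (_ : A = set0) ?sup0 //; apply/eqP/negPn/negP => /set0P.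
have Ax : A x by exists X.
apply: le_trans (ub_le_sup (form_norm_has_ubound pG uA) Ax).
rewrite -xE; apply: divr_ge0 => //; apply: prodr_ge0 => i _; exact: gram_norm_ge0.
Qed.

(** The volume of the parallelepiped spanned by the rows may replace the product of
    their lengths in the definition of the norm: both sides scale by
    the same determinant under a change of rows, so the rows may be taken
    orthonormal. *)
Lemma form_norm_volume k n (G : 'M[R]_n) (u : 'M[R]_(k, n) -> R) X :
  posdef G -> alternating_form u ->
  `|u X| <= form_norm G u * Num.sqrt (\det (X *m G *m X^T)).
Proof.
move=> pG uA.
have [Xf|/existsNP[v /not_implyP[vX /eqP v0]]] :=
  pselect (forall v : 'rV[R]_k, v *m X = 0 -> v = 0); last first.
  rewrite (alternating_form_dependent uA v0 vX) normr0.
  by rewrite mulr_ge0 ?sqrtr_ge0 // form_norm_ge0.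
have [L LX] := posdef_orthonormal (posdef_congr pG Xf).
have LXE : (L *m X) *m G *m (L *m X)^T = 1%:M by rewrite -LX trmx_mul !mulmxA.
have dL : (\det L) ^+ 2 * \det (X *m G *m X^T) = 1.
  by have := congr1 determinant LX; rewrite !det_mulmx det_tr det1 => <-; ring.
have dL0 : \det L != 0.
  by apply/eqP => d0; move: dL; rewrite d0 expr0n mul0r => /esym/eqP; rewrite oner_eq0.
have -> : \det (X *m G *m X^T) = (\det L) ^- 2.
  by apply: (mulfI (_ : (\det L)^+2 != 0)); rewrite ?sqrf_eq0 // dL mulfV // sqrf_eq0.
rewrite -exprVn sqrtr_sqr normfV ler_pdivlMr ?normr_gt0 // mulrC -normrM.
rewrite -alternating_form_det //.
have rows i : gram_norm G (row i (L *m X)) = 1.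
  by rewrite /gram_norm row_gramE LXE mxE eqxx sqrtr1.
have -> : `|u (L *m X)| =
    `|u (L *m X)| / \prod_(i < k) gram_norm G (row i (L *m X)).
  by rewrite big1 ?divr1.
apply: ub_le_sup; first exact: form_norm_has_ubound.
exists (L *m X) => //= i; apply/eqP => r0; have := rows i.
by rewrite r0 /gram_norm !mul0mx mxE sqrtr0 => /esym/eqP; rewrite oner_eq0.
Qed.

(** By Hadamard's inequality a bound by the volume of the parallelepiped is stronger
    than a bound by the product of the lengths of its edges. *)
Lemma form_norm_le k n (G : 'M[R]_n) (u : 'M[R]_(k, n) -> R) (c : R) :
  posdef G -> alternating_form u -> 0 <= c ->
  (forall X, `|u X| <= c * Num.sqrt (\det (X *m G *m X^T))) ->
  form_norm G u <= c.
Proof.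
move=> pG uA c0 uc; rewrite /form_norm; set A := [set _ | _ in _].
have [A0|A0] := pselect (A !=set0); last first.
  by rewrite (_ : A = set0) ?sup0 //; apply/eqP/negPn/negP => /set0P.
apply: ge_sup => // _ [X X0 <-].
rewrite ler_pdivrMr; last by apply: prodr_gt0 => i _; exact: gram_norm_gt0.
have [Xf|/existsNP[v /not_implyP[vX /eqP v0]]] :=
  pselect (forall v : 'rV[R]_k, v *m X = 0 -> v = 0); last first.
  rewrite (alternating_form_dependent uA v0 vX) normr0 mulr_ge0 //.
  by apply: prodr_ge0 => i _; exact: gram_norm_ge0.
apply: le_trans (uc X) _; rewrite ler_wpM2l //.
have pX := posdef_congr pG Xf.
have -> : \prod_(i < k) gram_norm G (row i X) =
    Num.sqrt (\prod_(i < k) (X *m G *m X^T) i i).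
  rewrite -[LHS]ger0_norm ?prodr_ge0 // => [|i _]; last exact: gram_norm_ge0.
  rewrite -sqrtr_sqr -prodrXl; congr Num.sqrt; apply: eq_bigr => i _.
  rewrite /gram_norm row_gramE sqr_sqrtr // -row_gramE.
  by case: pG => _ /(_ _ (X0 i))/ltW.
by rewrite ler_wsqrtr // hadamard.
Qed.

(** As the norm only sees Gram determinants, comparing the norms of a form and of
    its pullback by [S] reduces to comparing two inner products on [k]-vectors. *)
Lemma form_norm_comparison k n (G G' : 'M[R]_n) (u u' : 'M[R]_(k, n) -> R)
    (S : 'M[R]_n) (c : R) :
  posdef G -> posdef G' -> alternating_form u -> alternating_form u' ->
  (forall X, u' X = u (X *m S)) -> 0 <= c ->
  (forall X : 'M[R]_(k, n), \det (X *m (S *m G *m S^T) *m X^T) <=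
             c ^+ 2 * \det (X *m G' *m X^T)) ->
  form_norm G' u' <= c * form_norm G u.
Proof.
move=> pG pG' uA uA' u'E c0 det_le.
apply: form_norm_le => //; first by rewrite mulr_ge0 ?form_norm_ge0.
move=> X; rewrite u'E; apply: le_trans (form_norm_volume _ pG uA) _.
rewrite [c * _]mulrC -mulrA ler_wpM2l ?form_norm_ge0 //.
rewrite -[c]ger0_norm // -sqrtr_sqr -sqrtrM ?sqr_ge0 //.
by rewrite ler_wsqrtr // (le_trans _ (det_le X)) // trmx_mul !mulmxA.
Qed.

End spectral_norm_of_forms.

(** * Singular values and Gram determinants *)

Section singular_value_bounds.
Variable R : realType.
Local Notation C := R[i].
Local Notation toC := (real_complex R).

Lemma char_poly_similar (F : fieldType) n (P A B : 'M[F]_n) :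
  P \in unitmx -> P *m A = B *m P -> char_poly A = char_poly B.
Proof.
move=> Pu PAB; rewrite /char_poly.
pose P' := map_mx polyC P.
have P'AB : P' *m char_poly_mx A = char_poly_mx B *m P'.
  rewrite /char_poly_mx mulmxBr mulmxBl -!map_mxM PAB.
  by rewrite scalar_mxC.
have := congr1 determinant P'AB; rewrite !det_mulmx mulrC => /mulIf; apply.
by rewrite det_map_mx polyC_eq0 -unitfE -unitmxE.
Qed.

(** The diagonalization takes place over the complex numbers, where the
    spectral theorem for normal matrices is available; the eigenvalues are
    nevertheless the prescribed real ones because both lists are the roots of
    one characteristic polynomial. *)
Lemma symmetric_diagonalization n (S : 'M[R]_n) (d : 'I_n -> R) :
  S^T = S -> char_poly S = \prod_(i < n) ('X - (d i)%:P) ->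
  exists (P : 'M[C]_n) (s : 'S_n),
    P *m (map_mx Num.conj P^T) = 1%:M /\
    map_mx toC S =
      (map_mx Num.conj P^T) *m diag_mx (\row_i toC (d (s i))) *m P.
Proof.
move=> Ss cS; set A := map_mx toC S.
have Aherm : A \is hermsymmx.
  apply: realsym_hermsym.
    by apply/is_hermitianmxP; rewrite expr0 scale1r map_mx_id // /A map_trmx Ss.
  apply/mxOverP => i j; rewrite mxE.
  by rewrite complex_real.
have /orthomx_spectralP := hermitian_normalmx Aherm.
set P := spectralmx A; set D := spectral_diag A => AE.
have Pu : P \is unitarymx := spectral_unitarymx A.
have cA : char_poly A = \prod_(x <- [seq D 0 i | i <- enum 'I_n]) ('X - x%:P).
  rewrite (@char_poly_similar _ _ P A (diag_mx D)); first last.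
  - by rewrite {1}AE !mulmxA mulmxV ?mul1mx // spectral_unit.
  - exact: spectral_unit.
  rewrite char_poly_trig ?diag_mx_is_trig // big_map big_enum /=.
  by apply: eq_bigr => i _; rewrite mxE eqxx mulr1n.
have cA' : char_poly A =
    \prod_(x <- [seq toC (d i) | i <- enum 'I_n]) ('X - x%:P).
  by rewrite -map_char_poly cS map_prod_XsubC big_map big_enum.
have /prod_XsubC_eq : \prod_(x <- [seq D 0 i | i <- enum 'I_n]) ('X - x%:P) =
   \prod_(x <- [tuple toC (d i) | i < n]) ('X - x%:P) by rewrite -cA cA'.
case/tuple_permP => s sE.
exists P, s; have /unitarymxP PP := Pu; split => //.
rewrite [LHS]AE -[map_mx _ P^T]invmx_unitary //.
congr (_ *m diag_mx _ *m _); apply/rowP => i; rewrite mxE.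
have := congr1 (fun l => nth 0 l i) sE.
rewrite (nth_map i) ?size_enum_ord // nth_ord_enum => ->.
by rewrite (nth_map i) ?size_enum_ord // nth_ord_enum tnth_map tnth_ord_tuple.
Qed.

Lemma colsub_mul_diag (F : comNzRingType) k n (A : 'M[F]_(k, n)) (D : 'rV[F]_n)
    (f : 'I_k -> 'I_n) :
  \det (colsub f (A *m diag_mx D)) = (\prod_i D 0 (f i)) * \det (colsub f A).
Proof.
have -> : colsub f (A *m diag_mx D) =
          colsub f A *m diag_mx (\row_i D 0 (f i)).
  by rewrite !mul_mx_diag; apply/matrixP => i j; rewrite !mxE.
by rewrite det_mulmx det_diag mulrC; congr (_ * _); apply: eq_bigr => i _; rewrite mxE.
Qed.

(** After diagonalization the Cauchy-Binet formula writes both sides as sums over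
    the same squared absolute values of minors; on the left the minor on the columns [f]
    carries the extra factor [\prod_i d (f i)]. *)
Lemma det_compression_le k n (S : 'M[R]_n) (d : 'I_n -> R) (c : R) (P : 'M[C]_n)
    (X : 'M[R]_(k, n)) :
  P *m (map_mx Num.conj P^T) = 1%:M ->
  map_mx toC S = (map_mx Num.conj P^T) *m diag_mx (\row_i toC (d i)) *m P ->
  (forall f : 'I_k -> 'I_n, injective f -> \prod_i d (f i) <= c) ->
  \det (X *m S *m X^T) <= c * \det (X *m X^T).
Proof.
move=> Pu SE dc.
have Pu' : map_mx Num.conj P^T *m P = 1%:M by apply: mulmx1C.
pose Q := map_mx Num.conj P^T.
pose Y := map_mx toC X *m Q.
have YC : map_mx Num.conj Y^T = P *m map_mx toC X^T.
  rewrite /Y trmx_mul map_mxM; congr (_ *m _).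
    by apply/matrixP => i j; rewrite !mxE; exact: conjCK.
  apply/matrixP => i j; rewrite !mxE; apply: conj_Creal.
  by rewrite complex_real.
have E1 : map_mx toC (X *m S *m X^T) =
    Y *m diag_mx (\row_i toC (d i)) *m map_mx Num.conj Y^T.
  by rewrite YC !map_mxM SE /Y !mulmxA.
have E2 : map_mx toC (X *m X^T) = Y *m map_mx Num.conj Y^T.
  by rewrite YC map_mxM /Y mulmxA -[_ *m Q *m P]mulmxA Pu' mulmx1.
rewrite -(ler_pM2l (_ : 0 < (k`!)%:R)) ?ltr0n ?fact_gt0 //.
rewrite -lecR mulrCA !rmorphM /= !rmorph_nat -!det_map_mx E1 E2.
rewrite !cauchy_binet mulr_sumr; apply: ler_sum => f _.
rewrite colsub_mul_diag.
have -> : rowsub f (map_mx Num.conj Y^T) = map_mx Num.conj (colsub f Y)^T.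
  by apply/matrixP => i j; rewrite !mxE.
rewrite -map_trmx det_tr det_map_mx -mulrA -normCK.
have [/injectiveP finj|/injectivePn[i [j ij fij]]] := boolP (injectiveb f).
  apply: ler_wpM2r; first by rewrite exprn_ge0.
  under eq_bigr do rewrite mxE.
  by rewrite -rmorph_prod lecR dc.
rewrite -det_tr (determinant_alternate ij) ?normr0 ?expr0n ?mulr0 // => l.
by rewrite !mxE fij.
Qed.

(** Exchange argument with the threshold [s k.-1]: the indices in the image of
    [f] but beyond the first [k] are as many as those missed among the first
    [k]; the former contribute at most the threshold, the latter at least. *)
Lemma prod_injective_le k n (hk : (k <= n)%N) (s : 'I_n -> R) (f : 'I_k -> 'I_n) :
  (forall i, 0 <= s i) -> (forall i j : 'I_n, (i <= j)%N -> s j <= s i) ->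
  injective f -> \prod_i s (f i) <= \prod_(i < n | (i < k)%N) s i.
Proof.
move=> s0 sd finj.
pose A := [set f i | i in 'I_k]%SET; pose K := [set i : 'I_n | (i < k)%N]%SET.
have cA : #|A| = k by rewrite card_imset // card_ord.
have winj : injective (widen_ord hk) by move=> i j /(congr1 val) /= /val_inj.
have cK : #|K| = k.
  rewrite -[RHS]card_ord -(card_imset _ winj).
  apply: eq_card => i; rewrite inE; apply/idP/imsetP => [ik|[j _ ->]//=].
  by exists (Ordinal ik) => //; apply: val_inj.
have -> : \prod_i s (f i) = \prod_(i in A) s i.
  by rewrite big_imset //= => i j _ _; apply: finj.
have -> : \prod_(i < n | (i < k)%N) s i = \prod_(i in K) s i.
  by apply: eq_bigl => i; rewrite inE.
case: k => [|k] in hk f finj A K cA cK winj *.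
  by rewrite !(cards0_eq cA) !(cards0_eq cK) !big_set0.
pose t := s (Ordinal hk).
rewrite (big_setID K) /= [leRHS](big_setID A) /= finset.setIC.
apply: ler_wpM2l; first by apply: prodr_ge0.
apply: (@le_trans _ _ (t ^+ #|A :\: K|%SET)).
  rewrite -prodr_const; apply: ler_prod => i; rewrite !inE s0 -leqNgt => /andP[ki _] /=.
  by apply: sd; exact: ltnW.
rewrite (_ : #|A :\: K|%SET = #|K :\: A|%SET); last first.
  by rewrite !cardsD cA cK finset.setIC.
rewrite -prodr_const; apply: ler_prod => i; rewrite !inE s0 => /andP[_ ik] /=.
exact: sd.
Qed.

Lemma char_poly_prod_det n (A : 'M[R]_n) (d : 'I_n -> R) :
  char_poly A = \prod_(i < n) ('X - (d i)%:P) -> \det A = \prod_i d i.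
Proof.
move=> cA; have := char_poly_det A.
have -> : char_poly A = \prod_(x <- [seq d i | i <- enum 'I_n]) ('X - x%:P).
  by rewrite cA big_map big_enum.
rewrite coef0_prod_XsubC size_map size_enum_ord big_map big_enum /=.
by move/(mulfI (_ : (-1) ^+ n != 0)) => ->; rewrite // signr_eq0.
Qed.

Lemma symmetric_singular_diagonalization n (S : 'M[R]_n) (d : 'I_n -> R) :
  S^T = S -> char_poly S = \prod_(i < n) ('X - (d i)%:P) ->
  (forall i, d i != 0) ->
  exists (P : 'M[C]_n) (s : 'S_n),
    [/\ P *m (map_mx Num.conj P^T) = 1%:M,
    map_mx toC S =
      (map_mx Num.conj P^T) *m diag_mx (\row_i toC (d (s i))) *m P &
    map_mx toC (invmx S) =
      (map_mx Num.conj P^T) *m diag_mx (\row_i toC (d (s i))^-1) *m P].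
Proof.
move=> Ss cS d0; have [P [s [Pu SE]]] := symmetric_diagonalization Ss cS.
have Pu' : map_mx Num.conj P^T *m P = 1%:M by apply: mulmx1C.
exists P, s; split => //.
set Q := map_mx _ P^T in Pu Pu' SE *.
have Su : map_mx toC S \in unitmx.
  rewrite unitmxE det_map_mx unitfE fmorph_eq0 (char_poly_prod_det cS).
  by apply/prodf_neq0 => i _.
rewrite map_invmx; apply: (row_free_inj (_ : row_free (map_mx toC S))).
  by rewrite row_free_unit.
rewrite mulVmx // SE !mulmxA -[_ *m P *m Q]mulmxA Pu mulmx1.
rewrite -[Q *m _ *m _]mulmxA mulmx_diag.
rewrite [X in diag_mx X](_ : _ = const_mx 1) ?diag_const_mx ?mulmx1 //.
apply/rowP => i; rewrite !mxE -rmorphM /= mulVf ?rmorph1 //.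
Qed.

(** In orthonormal bases the two inner products become the identity and
    [Phi^T *m Phi], whose eigenvalues are the squares of the singular values.
    The bounds on [T G' T^T] and on the inverse map are dual: the inverse has
    the reciprocal singular values in the reverse order. *)
Lemma singular_value_gram_bounds n (G G' T B Cb Phi : 'M[R]_n) (s : 'I_n -> R)
    (k : nat) (hk : (k <= n)%N) :
  B *m G *m B^T = 1%:M -> Cb *m G' *m Cb^T = 1%:M -> B *m T = Phi^T *m Cb ->
  T \in unitmx -> matrix_singular_values Phi s ->
  [/\ forall i, 0 < s i,
      (\prod_i s i) ^+ 2 * \det G = (\det T) ^+ 2 * \det G',
      forall X : 'M[R]_(k, n), \det (X *m (T *m G' *m T^T) *m X^T) <=
        (\prod_(i < n | (i < k)%N) s i) ^+ 2 * \det (X *m G *m X^T) &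
      forall X : 'M[R]_(k, n),
        \det (X *m (invmx T *m G *m (invmx T)^T) *m X^T) <=
        (\prod_(i < n | (n - k <= i)%N) s i) ^- 2 * \det (X *m G' *m X^T)].
Proof.
move=> BG CG BT Tu [s_ge0 sd cPhi].
have Bu : B \in unitmx by have /mulmx1_unit[] : B *m (G *m B^T) = 1%:M by rewrite mulmxA.
have Cu : Cb \in unitmx by have /mulmx1_unit[] : Cb *m (G' *m Cb^T) = 1%:M by rewrite mulmxA.
have Pu : Phi \in unitmx.
  have PhiE : Phi^T = B *m T *m invmx Cb by rewrite BT mulmxK.
  by rewrite -unitmx_tr PhiE !unitmx_mul Bu Tu unitmx_inv.
have dPhi : (\prod_i s i) ^+ 2 = (\det Phi) ^+ 2.
  have := char_poly_prod_det cPhi; rewrite prodrXl => <-.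
  by rewrite det_mulmx det_tr expr2.
have s_neq0 i : s i != 0.
  have : (\prod_i s i) != 0.
    by rewrite -sqrf_eq0 dPhi sqrf_eq0 -unitfE -unitmxE.
  by move/prodf_neq0; apply.
have s_gt0 i : 0 < s i by rewrite lt_def s_neq0 s_ge0.
pose s' i := (s (rev_ord i))^-1.
have s'_ge0 i : 0 <= s' i by rewrite invr_ge0.
have s'd (i j : 'I_n) : (i <= j)%N -> s' j <= s' i.
  by move=> ij; rewrite lef_pV2 ?posrE // sd //= leq_sub2l.
split => //.
- rewrite dPhi.
  have dBG : (\det B) ^+ 2 * \det G = 1.
    by have := congr1 determinant BG; rewrite !det_mulmx det_tr det1 => <-; ring.
  have dCG : (\det Cb) ^+ 2 * \det G' = 1.
    by have := congr1 determinant CG; rewrite !det_mulmx det_tr det1 => <-; ring.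
  have dBT : \det B * \det T = \det Phi * \det Cb.
    by have := congr1 determinant BT; rewrite !det_mulmx det_tr.
  have : (\det Phi * \det Cb) ^+ 2 * \det G' * \det G = (\det B * \det T) ^+ 2 * \det G' * \det G.
    by rewrite dBT.
  rewrite (_ : _ * _ * _ = (\det Phi) ^+ 2 * \det G * ((\det Cb) ^+ 2 * \det G')); last by ring.
  rewrite dCG mulr1 => ->.
  rewrite (_ : _ * _ * _ = (\det T) ^+ 2 * \det G' * ((\det B) ^+ 2 * \det G)); last by ring.
  by rewrite dBG mulr1.
- move=> X.
  have sS : (Phi^T *m Phi)^T = Phi^T *m Phi by rewrite trmx_mul trmxK.
  have s2 i : s i ^+ 2 != 0 by rewrite sqrf_eq0.
  have [P [t [PP SE _]]] := symmetric_singular_diagonalization sS cPhi s2.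
  have := @det_compression_le k n _ _ ((\prod_(i < n | (i < k)%N) s i) ^+ 2) _
    (X *m invmx B) PP SE.
  have -> : X *m (T *m G' *m T^T) *m X^T =
      X *m invmx B *m (Phi^T *m Phi) *m (X *m invmx B)^T.
    rewrite -{1 2}[X](mulmxKV Bu); move: (X *m invmx B) => Y.
    rewrite (_ : Y *m B *m _ *m _ = Y *m ((B *m T) *m G' *m (B *m T)^T) *m Y^T).
      rewrite BT (_ : _ *m _ *m _ = Phi^T *m (Cb *m G' *m Cb^T) *m Phi).
        by rewrite CG mulmx1.
      by rewrite trmx_mul trmxK !mulmxA.
    by rewrite !trmx_mul !mulmxA.
  have -> : X *m G *m X^T = X *m invmx B *m (X *m invmx B)^T.
    rewrite -{1 2}[X](mulmxKV Bu); move: (X *m invmx B) => Y.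
    rewrite trmx_mul (_ : _ *m _ *m _ = Y *m (B *m G *m B^T) *m Y^T).
      by rewrite BG mulmx1.
    by rewrite !mulmxA.
  apply => f finj; rewrite prodrXl ler_sqr ?nnegrE ?prodr_ge0 //.
  apply: (@prod_injective_le k n hk s (fun i => t (f i))) => // i j /perm_inj.
  exact: finj.
- move=> X.
  have sS : (Phi *m Phi^T)^T = Phi *m Phi^T by rewrite trmx_mul trmxK.
  have s2 i : s i ^+ 2 != 0 by rewrite sqrf_eq0.
  have cPhi' : char_poly (Phi *m Phi^T) = \prod_(i < n) ('X - (s i ^+ 2)%:P).
    by rewrite -cPhi; apply/esym/(char_poly_similar Pu); rewrite mulmxA.
  have [P [t [PP _ SE]]] := symmetric_singular_diagonalization sS cPhi' s2.
  have := @det_compression_le k n _ _ ((\prod_(i < n | (n - k <= i)%N) s i) ^- 2) _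
    (X *m invmx Cb) PP SE.
  have CT : Cb *m invmx T = invmx Phi^T *m B.
    apply: (canRL (mulKmx _)); rewrite ?unitmx_tr // mulmxA -BT.
    by rewrite mulmxK.
  have -> : X *m (invmx T *m G *m (invmx T)^T) *m X^T =
      X *m invmx Cb *m invmx (Phi *m Phi^T) *m (X *m invmx Cb)^T.
    rewrite -{1 2}[X](mulmxKV Cu); move: (X *m invmx Cb) => Y.
    rewrite (_ : Y *m Cb *m _ *m _ =
       Y *m ((Cb *m invmx T) *m G *m (Cb *m invmx T)^T) *m Y^T).
      rewrite CT (_ : _ *m _ *m _ =
          invmx Phi^T *m (B *m G *m B^T) *m invmx Phi).
        rewrite BG mulmx1; congr (_ *m _ *m _).
        apply: (row_free_inj (_ : row_free (Phi *m Phi^T))).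
          by rewrite row_free_unit unitmx_mul unitmx_tr Pu.
        rewrite mulVmx ?unitmx_mul ?unitmx_tr ?Pu //.
        by rewrite !mulmxA mulmxKV // mulVmx ?unitmx_tr.
      by rewrite trmx_mul trmx_inv trmxK !mulmxA.
    by rewrite !trmx_mul !mulmxA.
  have -> : X *m G' *m X^T = X *m invmx Cb *m (X *m invmx Cb)^T.
    rewrite -{1 2}[X](mulmxKV Cu); move: (X *m invmx Cb) => Y.
    rewrite trmx_mul (_ : _ *m _ *m _ = Y *m (Cb *m G' *m Cb^T) *m Y^T).
      by rewrite CG mulmx1.
    by rewrite !mulmxA.
  apply => f finj.
  have -> : \prod_i (s (t (f i)) ^+ 2)^-1 = (\prod_i s' (rev_ord (t (f i)))) ^+ 2.
    by rewrite -prodrXl; apply: eq_bigr => i _; rewrite /s' rev_ordK exprVn.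
  have -> : (\prod_(i < n | (n - k <= i)%N) s i) ^- 2 =
      (\prod_(i < n | (i < k)%N) s' i) ^+ 2.
    rewrite -exprVn -prodfV (reindex_inj rev_ord_inj) /=; congr (_ ^+ 2).
    by apply: eq_bigl => i /=; have := ltn_ord i; lia.
  rewrite ler_sqr ?nnegrE ?prodr_ge0 //.
  apply: (@prod_injective_le k n hk s' (fun i => rev_ord (t (f i)))) => // i j.
  by move=> /rev_ord_inj/perm_inj; exact: finj.
Qed.

End singular_value_bounds.

(** * Dyadic cubes *)

Section borel_measures_on_rV.
Variables (R : realType) (n : nat).
Local Notation Rn := 'rV[R]_n.
Local Notation borelR := (g_sigma_algebraType (@open Rn)).

Lemma open_borel (O : set Rn) : open O -> measurable (O : set borelR).
Proof. exact: sub_sigma_algebra. Qed.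

Lemma closed_borel (F : set Rn) : closed F -> measurable (F : set borelR).
Proof.
move=> Fc; have mFc : measurable (~` F : set borelR).
  by apply: open_borel; exact: closed_openC.
by have := measurableC mFc; rewrite setCK.
Qed.

Lemma rV_ball (x y : Rn) (e : R) : 0 < e ->
  ball x e y <-> forall i, `|x 0 i - y 0 i| < e.
Proof.
move=> e0; split; first by move=> [_ +] i => /(_ 0 i).
by move=> h; split=> // i j; rewrite (ord1 i); exact: h.
Qed.

(** With floors it is immediate that the cubes of one level form a partition,
    and cubes of successive levels are compared by comparing integers. *)
Definition dyadic_cube (k : nat) (z : {ffun 'I_n -> int}) : set Rn :=
  [set a | forall i, Num.floor (2 ^+ k * a 0 i) = z i].

Lemma dyadic_cubeP k z a : dyadic_cube k z a <->
  forall i, (z i)%:~R <= 2 ^+ k * a 0 i < (z i + 1)%:~R.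
Proof.
split=> h i; first by rewrite -h floor_itv.
exact: floor_def.
Qed.

Lemma dyadic_cube_self k (a : Rn) :
  dyadic_cube k [ffun i => Num.floor (2 ^+ k * a 0 i)] a.
Proof. by move=> i; rewrite ffunE. Qed.

Lemma dyadic_cube_inj k z z' a : dyadic_cube k z a -> dyadic_cube k z' a -> z = z'.
Proof. by move=> za za'; apply/ffunP => i; rewrite -za -za'. Qed.

Lemma dyadic_cube_diam k z a b i : dyadic_cube k z a -> dyadic_cube k z b ->
  `|a 0 i - b 0 i| < 2 ^- k.
Proof.
move=> /dyadic_cubeP/(_ i)/andP[a1 a2] /dyadic_cubeP/(_ i)/andP[b1 b2].
have k0 : 0 < 2 ^+ k :> R by rewrite exprn_gt0.
rewrite -(ltr_pM2l k0) mulfV ?gt_eqF // -{1}[2 ^+ k]gtr0_norm // -normrM.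
rewrite mulrBr ltr_norml; move: a1 a2 b1 b2; rewrite intrD.
by move: (2 ^+ k * _) (2 ^+ k * _) => x y *; apply/andP; split; lra.
Qed.

Lemma dyadic_cube_refine k z k' z' a : (k <= k')%N ->
  dyadic_cube k z a -> dyadic_cube k' z' a -> dyadic_cube k' z' `<=` dyadic_cube k z.
Proof.
move=> kk' za za' b zb; move=> i.
rewrite -(za i).
have fl (x y : R) (j : nat) : Num.floor (2 ^+ j * x) = Num.floor (2 ^+ j * y) ->
    Num.floor x = Num.floor y.
  have j0 : 0 < 2 ^+ j :> R by rewrite exprn_gt0.
  suff H (u v : R) : Num.floor (2 ^+ j * u) = Num.floor (2 ^+ j * v) ->
      (Num.floor u <= Num.floor v).
    by move=> h; apply/eqP; rewrite eq_le !H.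
  move=> h; rewrite floor_ge_int.
  have : (2 ^+ j * (Num.floor u)%:~R) = (2 ^+ j * Num.floor u : int)%:~R :> R.
    by rewrite intrM rmorphXn.
  have : 2 ^+ j * (Num.floor u)%:~R <= 2 ^+ j * u by rewrite ler_pM2l // floor_le.
  move=> h1 h2.
  have : (2 ^+ j * Num.floor u : int) <= Num.floor (2 ^+ j * v).
    by rewrite -h floor_ge_int -h2.
  by rewrite floor_ge_int -h2 ler_pM2l.
apply: (fl _ _ (k' - k)%N); rewrite !mulrA -exprD subnK //.
by rewrite (zb i) -(za' i).
Qed.

Lemma exp2N_small (e : R) : 0 < e -> exists k, 2 ^- k < e.
Proof.
move=> e0; pose m := (Num.truncn e^-1).+1.
exists m; rewrite invf_plt ?posrE ?exprn_gt0 //.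
apply: (@lt_trans _ _ m%:R); first exact: truncnS_gt.
by rewrite -natrX ltr_nat ltn_expl.
Qed.

Definition dyadic_interior (k : nat) (O : set Rn) : set Rn :=
  [set a | exists2 z, dyadic_cube k z a & dyadic_cube k z `<=` O].

Lemma dyadic_interior_nd O (k k' : nat) : (k <= k')%N ->
  dyadic_interior k O `<=` dyadic_interior k' O.
Proof.
move=> kk' a [z za zO]; have za' := dyadic_cube_self k' a.
exists [ffun i => Num.floor (2 ^+ k' * a 0 i)] => //.
exact: subset_trans (dyadic_cube_refine kk' za za') zO.
Qed.

Lemma open_dyadic (O : set Rn) : open O -> O = \bigcup_k dyadic_interior k O.
Proof.
move=> oO; apply/seteqP; split => [a Oa|a [k _ [z za zO]]]; last exact: zO.
have /nbhs_ballP[e /= e0 eO] : nbhs a O by apply: open_nbhs_nbhs.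
have [k ke] := exp2N_small e0.
exists k => //; exists [ffun i => Num.floor (2 ^+ k * a 0 i)].
  exact: dyadic_cube_self.
move=> b zb; apply: eO; apply/rV_ball => // i.
by apply: lt_trans ke; apply: dyadic_cube_diam zb; exact: dyadic_cube_self.
Qed.

(** Enumerating the cubes of a level by natural numbers makes
    [dyadic_interior k O] a countable disjoint union of measurable sets. *)
Definition dyadic_piece k (O : set Rn) (m : nat) : set Rn :=
  if pickle_inv m is Some z then
    [set a | dyadic_cube k z a /\ dyadic_cube k z `<=` O] else set0.

Lemma dyadic_interiorE k O : dyadic_interior k O = \bigcup_m dyadic_piece k O m.
Proof.
apply/seteqP; split => [a [z za zO]|a [m _]].
  by exists (pickle z) => //; rewrite /dyadic_piece pickleK_inv.
by rewrite /dyadic_piece; case: pickle_inv => // z [za zO]; exists z.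
Qed.

Lemma trivIset_dyadic_piece k O : trivIset setT (dyadic_piece k O).
Proof.
move=> i j _ _ [a []]; rewrite /dyadic_piece.
have := @pickle_invK {ffun 'I_n -> int} i; have := @pickle_invK {ffun 'I_n -> int} j.
case: (pickle_inv i) => [z|//]; case: (pickle_inv j) => [z'|//] /= <- <-.
by move=> [za _] [z'a _]; rewrite (dyadic_cube_inj za z'a).
Qed.

End borel_measures_on_rV.

(** * Lebesgue measure on row vectors *)

Section lebesgue_measure_on_rV.
Variables (R : realType) (n : nat).
Local Notation Rn := 'rV[R]_n.
Local Notation borelR := (g_sigma_algebraType (@open Rn)).
Local Notation Tn := (n.-tuple (measurableTypeR R)).

Definition box (A : 'I_n -> set R) : set Rn := [set a | forall i, A i (a 0 i)].

Lemma measurable_tuple_box (A : 'I_n -> set R) :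
  (forall i, measurable (A i : set (measurableTypeR R))) ->
  measurable ((@row_of_tuple R n) @^-1` box A).
Proof.
move=> mA.
rewrite (_ : _ @^-1` _ =
   \bigcap_(i in [set: 'I_n]) ((fun t : Tn => tnth t i) @^-1` A i)); last first.
  apply/seteqP; split => [t h i _|t h i] /=; first by have := h i; rewrite mxE.
  by rewrite mxE; exact: h.
apply: fin_bigcap_measurable => // i _.
by rewrite -[X in measurable X]setTI; apply: measurable_tnth.
Qed.

Lemma measurable_floor_fiber (c : R) (z : int) : 0 < c ->
  measurable ([set r | Num.floor (c * r) = z] : set (measurableTypeR R)).
Proof.
move=> c0; rewrite (_ : [set r | _] = `[z%:~R / c, (z + 1)%:~R / c[%classic).
  exact: measurable_itv.
apply/seteqP; split => r /=; rewrite in_itv /= ler_pdivrMr // ltr_pdivlMr //.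
  by move=> <-; rewrite [r * c]mulrC floor_itv.
by rewrite [r * c]mulrC; exact: floor_def.
Qed.

Lemma dyadic_cubeE k z :
  dyadic_cube k z = box (fun i => [set r | Num.floor (2 ^+ k * r) = z i]).
Proof. by []. Qed.

(** The Borel sets of [n]-tuples are generated by coordinates, those of row
    vectors by open sets; an open set is a countable union of dyadic cubes, and
    cubes are given by conditions on coordinates. *)
Lemma measurable_row_of_tuple :
  measurable_fun [set: Tn] (@row_of_tuple R n : Tn -> borelR).
Proof.
apply: (@measurability _ _ _ borelR setT _ (@open Rn) erefl) => _ [B oB <-]; rewrite setTI.
rewrite (open_dyadic oB) preimage_bigcup; apply: bigcup_measurable => k _.
rewrite dyadic_interiorE preimage_bigcup; apply: bigcup_measurable => m _.
rewrite /dyadic_piece; case: pickle_inv => [z|]; last by rewrite preimage_set0.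
have [zO|zO] := pselect (dyadic_cube k z `<=` B).
  rewrite (_ : [set a | _] = dyadic_cube k z).
    rewrite dyadic_cubeE; apply: measurable_tuple_box => i.
    by apply: measurable_floor_fiber; rewrite exprn_gt0.
  by apply/seteqP; split => a; [case|split].
rewrite (_ : [set a | _] = set0) ?preimage_set0 //.
by apply/seteqP; split => a; [case|].
Qed.

(** Lebesgue measure moved to row vectors, where the Borel sets are those of the
    topology and linear maps are matrices. *)
Definition lebesgue_rV : set borelR -> \bar R :=
  pushforward (lebesgue_n R n) (@row_of_tuple R n : Tn -> borelR).

Let pf := measure_function_pushforward__canonical__measure_function_Measure
  (lebesgue_n R n) measurable_row_of_tuple.

HB.instance Definition _ := isMeasure.Build _ _ _ lebesgue_rV
  (measure0 pf) (@measure_ge0 _ _ _ pf) (@measure_semi_sigma_additive _ _ _ pf).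

End lebesgue_measure_on_rV.

Section lebesgue_volume.
Variable (R : realType).

Lemma lebesgue_n_box n (A : 'I_n -> set R) :
  (forall i, measurable (A i : set (measurableTypeR R))) ->
  lebesgue_n R n [set t | forall i, A i (tnth t i)] =
  (\prod_(i < n) lebesgue_measure (A i : set (measurableTypeR R)))%E.
Proof.
elim: n A => [|n IHn] A mA.
  rewrite big_ord0 /= diracE mem_set //; by case.
rewrite big_ord_recl -IHn //=.
rewrite /lebesgue_cons /pushforward.
rewrite (_ : _ @^-1` _ = A ord0 `*` [set t | forall i, A (lift ord0 i) (tnth t i)]).
  rewrite product_measure1E //.
  rewrite (_ : [set t | _] = (@row_of_tuple R n) @^-1` box (fun i => A (lift ord0 i))).
    exact: measurable_tuple_box.
  by apply/seteqP; split => t h i /=; have := h i; rewrite mxE.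
apply/seteqP; split => -[r t] /= => [h|[h0 h] i].
  split=> [|i]; first by have := h ord0; rewrite (tnth_nth 0).
  by have := h (lift ord0 i); rewrite !(tnth_nth 0).
have [j ->|->] := unliftP ord0 i; last by rewrite (tnth_nth 0).
by have := h j; rewrite !(tnth_nth 0).
Qed.

Lemma lebesgue_rV_box n (A : 'I_n -> set R) :
  (forall i, measurable (A i : set (measurableTypeR R))) ->
  lebesgue_rV (box A) =
  (\prod_(i < n) lebesgue_measure (A i : set (measurableTypeR R)))%E.
Proof.
move=> mA; rewrite -lebesgue_n_box // /lebesgue_rV /pushforward.
congr (lebesgue_n R n : set _ -> _); apply/seteqP.
by split => t h i /=; have := h i; rewrite mxE.
Qed.

Lemma measurable_box n (A : 'I_n -> set R) :
  (forall i, measurable (A i : set (measurableTypeR R))) ->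
  measurable (box A : set (g_sigma_algebraType (@open 'rV[R]_n))).
Proof.
move=> mA; rewrite (_ : box A = \bigcap_(i in [set: 'I_n])
  ((fun a : g_sigma_algebraType (@open 'rV[R]_n) =>
       (a 0 i : measurableTypeR R)) @^-1` A i)); last first.
  by apply/seteqP; split => [t h i _|t h i] /=; [exact: h|exact: (h i I)].
apply: fin_bigcap_measurable => // i _.
rewrite -[X in measurable X]setTI.
suff : measurable_fun setT (fun a : g_sigma_algebraType (@open 'rV[R]_n) =>
       (a 0 i : measurableTypeR R)) by apply.
apply: (measurability _ (measurable_realfun.RGenOpens.measurableE R)) => _ [_ [x [y ->]] <-].
rewrite setTI; apply: open_borel.
by apply: open_comp => // a _; exact: coord_continuous.
Qed.

Lemma lebesgue_rV_itv_box n (a b : 'I_n -> R) : (forall i, a i <= b i) ->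
  lebesgue_rV (box (fun i => `[a i, b i]%classic)) = (\prod_(i < n) (b i - a i))%:E.
Proof.
move=> ab; rewrite lebesgue_rV_box => [|i]; last exact: measurable_itv.
rewrite -prodEFin; apply: eq_bigr => i _.
rewrite lebesgue_measure_itv /= lte_fin.
case: ltP => // ba; rewrite (_ : b i = a i) ?subrr //.
by apply/eqP; rewrite eq_le ba ab.
Qed.

Lemma measurable_dyadic_cube n k z :
  measurable (dyadic_cube k z : set (g_sigma_algebraType (@open 'rV[R]_n))).
Proof.
rewrite dyadic_cubeE; apply: measurable_box => i.
by apply: measurable_floor_fiber; rewrite exprn_gt0.
Qed.

Lemma lebesgue_rV_cube n k (z : {ffun 'I_n -> int}) :
  lebesgue_rV (dyadic_cube k z : set 'rV[R]_n) = (2 ^- k ^+ n)%:E.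
Proof.
have k0 : 0 < 2 ^+ k :> R by rewrite exprn_gt0.
rewrite dyadic_cubeE lebesgue_rV_box => [|i]; last exact: measurable_floor_fiber.
transitivity ((\prod_(i < n) 2 ^- k : R)%:E); last by rewrite prodr_const card_ord.
rewrite -prodEFin; apply: eq_bigr => i _.
rewrite (_ : [set r | _] = `[(z i)%:~R / 2 ^+ k, (z i + 1)%:~R / 2 ^+ k[%classic).
  rewrite lebesgue_measure_itv /= lte_fin ltr_pM2r ?invr_gt0 // ltr_int.
  by rewrite ltzD1 lexx -EFinB -mulrBl intrD addrC addKr mul1r.
apply/seteqP; split => r /=; rewrite in_itv /= ler_pdivrMr // ltr_pdivlMr //.
  by move=> <-; rewrite [r * _]mulrC floor_itv.
by rewrite [r * _]mulrC; exact: floor_def.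
Qed.

End lebesgue_volume.

(** * Regularity and comparison of Borel measures *)

Section regularity.
Variables (R : realType) (n : nat).
Local Notation Rn := 'rV[R]_n.
Local Notation borelR := (g_sigma_algebraType (@open Rn)).
Local Open Scope ereal_scope.

Lemma measure_decreasing_small (mu : {measure set borelR -> \bar R})
    (G : (set borelR)^nat) (e : R) :
  mu setT < +oo -> (forall i, measurable (G i)) ->
  {homo G : i j / (i <= j)%N >-> (j <= i)%O} -> \bigcap_i G i = set0 ->
  (0 < e)%R -> exists i, mu (G i) <= e%:E.
Proof.
move=> muT mG ndG G0 e0; apply: contrapT => /forallNP Ge.
have muG0 : mu (G 0%N) < +oo.
  by apply: le_lt_trans muT; apply: le_measure; rewrite ?inE.
have mcap : measurable (\bigcap_i G i) by rewrite G0.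
have := nonincreasing_cvg_mu muG0 mG mcap ndG; rewrite G0 measure0 => cv.
have : e%:E <= limn (mu \o G).
  apply: lime_ge; first by apply/cvg_ex; exists 0.
  by apply: nearW => i /=; rewrite leNgt; apply/negP => /ltW/(Ge i).
by rewrite (cvg_lim _ cv) // lee_fin leNgt e0.
Qed.

(** The closed sets of the points at distance at least [1 / m.+1] from the
    complement exhaust an open set. *)
Lemma open_inner_closed (O : set Rn) : open O ->
  exists F : (set Rn)^nat, [/\ forall m, closed (F m),
    {homo F : i j / (i <= j)%N >-> i `<=` j} & O = \bigcup_m F m].
Proof.
move=> oO.
exists (fun m => ~` \bigcup_(y in ~` O) ball y (m.+1%:R^-1)%R); split.
- move=> m; apply: open_closedC; apply: bigcup_open => y _.
  by apply: ball_open; rewrite invr_gt0.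
- move=> i j ij x + [y yO yx]; apply; exists y => //.
  by apply: le_ball yx; rewrite lef_pV2 ?posrE ?ler_nat.
- apply/seteqP; split => [x Ox|x [m _ h]]; last first.
    apply: contrapT => xO; apply: h; exists x => //.
    by apply: ballxx; rewrite invr_gt0.
  have /nbhs_ballP[e /= e0 eO] : nbhs x O by apply: open_nbhs_nbhs.
  exists (Num.truncn e^-1)%R => // -[y yO yx]; apply: yO; apply: eO.
  apply: (@le_ball _ _ _ ((Num.truncn e^-1).+1%:R^-1)%R); last exact: ball_sym.
  by rewrite invf_ple ?posrE // ltW // truncnS_gt.
Qed.

(** Sets squeezed between a closed and an open set up to small measure form a
    sigma-algebra. *)
Lemma finite_borel_regular (mu : {measure set borelR -> \bar R}) (E : set borelR) :
  mu setT < +oo -> measurable E -> forall e : R, (0 < e)%R ->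
  exists O F : set Rn, [/\ open O, closed F, F `<=` E, E `<=` O &
    mu (O `\` F) <= e%:E].
Proof.
move=> muT.
pose C := [set E : set Rn | forall e : R, (0 < e)%R ->
  exists O F : set Rn, [/\ open O, closed F, F `<=` E, E `<=` O &
    mu (O `\` F) <= e%:E]].
suff CB : <<s @open Rn >> `<=` C by move=> mE; exact: CB mE.
apply: smallest_sub; last first.
  move=> O oO e e0; have [F [cF ndF FO]] := open_inner_closed oO.
  have [m mm] : exists m, mu (O `\` F m) <= e%:E.
    apply: (measure_decreasing_small muT) => //.
    - by move=> i; apply: measurableD; [exact: open_borel|exact: closed_borel].
    - by move=> i j /ndF ij; apply/subsetPset; exact: setDS.
    - apply/seteqP; split => // x h; have [+ _] := h 0%N I.
      by rewrite FO => -[m _ Fm]; have [] := h m I.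
  exists O, (F m); split => //.
  by rewrite FO; exact: bigcup_sup.
split.
- move=> e e0; exists set0, set0.
  split; [exact: open0|exact: closed0|by []|by []|].
  by rewrite setD0 measure0 lee_fin ltW.
- move=> A CA e e0; have [ O [F [oO cF FA AO mOF]]] := CA e e0.
  exists (~` F), (~` O); split.
  + exact: closed_openC.
  + exact: open_closedC.
  + by rewrite setTD; exact: subsetC.
  + by rewrite setTD; exact: subsetC.
  + by rewrite setDE setCK setIC -setDE.
- move=> A CA e e0.
  have e20 i : (0 < e / 2 / (2 ^ i.+1)%:R)%R by rewrite !divr_gt0 // ltr0n expn_gt0.
  have /choice[OF OFP] : forall i, exists OF : set Rn * set Rn,
    [/\ open OF.1, closed OF.2, OF.2 `<=` A i, A i `<=` OF.1 &
    mu (OF.1 `\` OF.2) <= (e / 2 / (2 ^ i.+1)%:R)%:E].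
    by move=> i; have [ O [F OFP]] := CA i _ (e20 i); exists (O, F).
  pose O i := (OF i).1; pose F i := (OF i).2.
  have oO i : open (O i) by have [] := OFP i.
  have cF i : closed (F i) by have [] := OFP i.
  have mO i : measurable (O i : set borelR) by exact: open_borel.
  have mF i : measurable (F i : set borelR) by exact: closed_borel.
  pose FN N := \big[setU/set0]_(i < N) F i.
  have cFN N : closed (FN N).
    by rewrite /FN; apply: (big_ind closed); [exact: closed0|exact: closedU|].
  pose G N : set borelR := \bigcup_i F i `\` FN N.
  have mFU : measurable (\bigcup_i F i : set borelR) by apply: bigcup_measurable.
  have mG N : measurable (G N) by apply: measurableD => //; exact: closed_borel.
  have [N GN] : exists N, mu (G N) <= (e / 2)%:E.
    apply: (measure_decreasing_small muT mG); last by rewrite divr_gt0.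
      move=> i j ij; apply/subsetPset; apply: setDS; rewrite /FN.
      exact: subset_bigsetU.
    apply/seteqP; split => // x h; have [[i _ Fi] _] := h 0%N I.
    have [_] := h i.+1 I; apply; rewrite /FN -bigcup_mkord.
    by exists i => /=.
  exists (\bigcup_i O i), (FN N); split => //.
  + by apply: bigcup_open.
  + rewrite /FN -bigcup_mkord => x [i _ Fi]; exists i => //.
    by have [_ _ + _ _] := OFP i; apply.
  + move=> x [i _ Ai]; exists i => //.
    by have [_ _ _ + _] := OFP i; apply.
  + have mOFi i : measurable (O i `\` F i : set borelR) by exact: measurableD.
    have mOF : measurable (\bigcup_i (O i `\` F i) : set borelR).
      by apply: bigcup_measurable.
    apply: (@le_trans _ _ (mu (\bigcup_i (O i `\` F i) `|` G N))).
      apply: le_measure; rewrite ?inE.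
      * by apply: measurableD; [exact: bigcup_measurable|exact: closed_borel].
      * exact: measurableU.
      move=> x [[i _ Oi] xF].
      have [Fx|nFx] := pselect ((\bigcup_i F i) x); first by right.
      by left; exists i => //; split => // Fi; apply: nFx; exists i.
    apply: le_trans (measureU2 _ mOF (mG N)) _.
    rewrite (splitr e) EFinD; apply: leeD => //.
    apply: (@le_trans _ _ (\sum_(0 <= i <oo) mu (O i `\` F i))).
      exact: measure_sigma_subadditive.
    apply: (@le_trans _ _ (\sum_(0 <= i <oo) (0 + (e / 2 / (2 ^ i.+1)%:R)%:E))).
      by apply: lee_nneseries => // i _; rewrite add0e; have [] := OFP i.
    apply: le_trans (epsilon_trick _ _ _) _ => //.
      by rewrite divr_ge0 // ltW.
    by rewrite eseries0 // add0e.
Qed.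

(** A domination between measures may be tested on dyadic cubes: it passes
    from cubes to open sets, which they fill in a countable disjoint way, and
    from open sets to Borel sets by outer regularity. *)
Lemma measure_le_dyadic (mu nu : {measure set borelR -> \bar R}) (W : set Rn) :
  open W -> mu W < +oo ->
  (forall k z, dyadic_cube k z `<=` W ->
     nu (dyadic_cube k z) <= mu (dyadic_cube k z)) ->
  forall E : set borelR, measurable E -> E `<=` W -> nu E <= mu E.
Proof.
move=> oW muW cubes.
have mpiece k O m : measurable (dyadic_piece k O m : set borelR).
  rewrite /dyadic_piece; case: pickle_inv => // z.
  have [zO|zO] := pselect (dyadic_cube k z `<=` O).
    rewrite (_ : [set a | _] = dyadic_cube k z); first exact: measurable_dyadic_cube.
    by apply/seteqP; split => a; [case|split].
  by rewrite (_ : [set a | _] = set0) //; apply/seteqP; split => a; [case|].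
have mint k O : measurable (dyadic_interior k O : set borelR).
  by rewrite dyadic_interiorE; apply: bigcup_measurable.
have opens (O : set Rn) : open O -> O `<=` W -> nu O <= mu O.
  move=> oO OW.
  have intk k : nu (dyadic_interior k O) <= mu (dyadic_interior k O).
    rewrite dyadic_interiorE !measure_bigcup //; try exact: trivIset_dyadic_piece.
    apply: lee_nneseries => // m _; rewrite /dyadic_piece.
    case: pickle_inv => [z|]; last by rewrite !measure0.
    have [zO|zO] := pselect (dyadic_cube k z `<=` O).
      rewrite (_ : [set a | _] = dyadic_cube k z); last first.
        by apply/seteqP; split => a; [case|split].
      by apply: cubes; exact: subset_trans zO OW.
    rewrite (_ : [set a | _] = set0) ?measure0 //.
    by apply/seteqP; split => a; [case|].
  have OE := open_dyadic oO.
  have mU : measurable (\bigcup_k dyadic_interior k O : set borelR).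
    by apply: bigcup_measurable.
  have nd : {homo (fun k => dyadic_interior k O : set borelR) :
      i j / (i <= j)%N >-> (i <= j)%O}.
    by move=> i j ij; apply/subsetPset; exact: dyadic_interior_nd.
  have cv := nondecreasing_cvg_mu (mu := nu) (fun k => mint k O) mU nd.
  rewrite {1}OE -(cvg_lim _ cv) //; apply: lime_le; first by apply/cvg_ex; eexists; exact: cv.
  apply: nearW => k /=; apply: le_trans (intk k) _; apply: le_measure; rewrite ?inE //.
    exact: open_borel.
  by move=> x [z zx zO]; exact: zO.
move=> E mE EW.
have mW : measurable (W : set borelR) by exact: open_borel.
apply/lee_addgt0Pr => e e0.
have [ O [F [oO cF FE EO mOF]]] :=
  @finite_borel_regular (mrestr mu mW) E
    (le_lt_trans (le_measure mu (mem_set (measurableI _ _ measurableT mW)) (mem_set mW) (@subIsetr _ _ _)) muW) mE e e0.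
have mO : measurable (O : set borelR) by exact: open_borel.
have mF : measurable (F : set borelR) by exact: closed_borel.
apply: (@le_trans _ _ (nu (O `&` W))).
  by apply: le_measure; rewrite ?inE //; [exact: measurableI|move=> x Ex; split; [exact: EO|exact: EW]].
apply: (@le_trans _ _ (mu (O `&` W))).
  by apply: opens; [exact: openI|exact: subIsetr].
apply: (@le_trans _ _ (mu (E `|` ((O `\` F) `&` W)))).
  apply: le_measure; rewrite ?inE //.
  - exact: measurableI.
  - by apply: measurableU => //; apply: measurableI => //; exact: measurableD.
  - move=> x [Ox Wx]; have [Ex|nEx] := pselect (E x); first by left.
    by right; split => //; split => // /FE.
have mOFW : measurable ((O `\` F) `&` W : set borelR).
  by apply: measurableI => //; exact: measurableD.
apply: le_trans (measureU2 _ mE mOFW) _.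
exact: leeD.
Qed.

End regularity.

(** * Multiplicative functions of matrices *)

(** A multiplicative function is trivial on shears, which are conjugate to their
    squares by a diagonal matrix, and on transpositions, which are involutions;
    so Gaussian elimination reduces it to its values on diagonal matrices. *)
Lemma multiplicative_abs_det (F : realFieldType) n (c : 'M[F]_n -> F) :
  (forall A B, A \in unitmx -> B \in unitmx -> c (A *m B) = c A * c B) ->
  (forall A, 0 <= c A) ->
  (forall d : 'rV[F]_n, (forall i, d 0 i != 0) -> c (diag_mx d) = \prod_i `|d 0 i|) ->
  forall A, A \in unitmx -> c A = `|\det A|.
Proof.
elim: n c => [|n IHn] c cM c0 cD A Au.
  rewrite (_ : A = diag_mx 0) ?cD ?big_ord0 ?det_mx00 ?normr1 //; try by case.
  by apply/matrixP; case.
have cD' (d : 'rV[F]_(1 + n)) : (forall i, d 0 i != 0) ->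
    c (diag_mx d) = \prod_(i < 1 + n) `|d 0 i| by exact: cD.
have c1 : c 1%:M = 1.
  rewrite -diag_const_mx cD => [|i]; last by rewrite mxE oner_eq0.
  by rewrite big1 // => i _; rewrite mxE normr1.
have cN B : B \in unitmx -> c B != 0.
  move=> Bu; apply/eqP => cB; have := cM B (invmx B) Bu.
  by rewrite unitmx_inv mulmxV // c1 cB mul0r => /(_ Bu)/eqP; rewrite oner_eq0.
have cdiag1 (a : F) : a != 0 ->
    c (block_mx a%:M 0 0 1%:M : 'M[F]_(1 + n)) = `|a|.
  move=> a0; rewrite -diag_const_mx -(@diag_const_mx _ n) -diag_mx_row cD' => [|i].
    rewrite big_split_ord big_ord1 row_mxEl mxE big1 => [|i _]; first exact: mulr1.
    by rewrite row_mxEr mxE normr1.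
  by case: (split_ordP i) => j ->; rewrite ?row_mxEl ?row_mxEr mxE ?oner_eq0.
have unit_block (a : F) (S : 'M[F]_n) : a != 0 -> S \in unitmx ->
    (block_mx a%:M 0 0 S : 'M[F]_(1 + n)) \in unitmx.
  move=> a0 Su; rewrite unitmxE det_lblock det_scalar1 unitrM.
  by rewrite unitfE a0 -unitmxE.
have unitL (l : 'M[F]_(n, 1)) : (block_mx 1%:M 0 l 1%:M : 'M[F]_(1 + n)) \in unitmx.
  by rewrite unitmxE det_lblock !det1 mulr1 unitr1.
have unitU (u : 'M[F]_(1, n)) : (block_mx 1%:M u 0 1%:M : 'M[F]_(1 + n)) \in unitmx.
  by rewrite unitmxE det_ublock !det1 mulr1 unitr1.
pose D : 'M[F]_(1 + n) := block_mx 2%:M 0 0 1%:M.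
have Du : D \in unitmx by apply: unit_block; rewrite ?unitmx1 // pnatr_eq0.
have cD0 : c D != 0 by exact: cN.
have idem x y : x != 0 -> y != 0 -> x * y = y * (x * x) -> x = 1 :> F.
  move=> x0 y0; rewrite [x * y]mulrC => /(mulfI y0) h.
  by apply: (mulfI x0); rewrite mulr1 -h.
have cL (l : 'M[F]_(n, 1)) : c (block_mx 1%:M 0 l 1%:M : 'M[F]_(1 + n)) = 1.
  set L := block_mx _ _ _ _.
  have Lu : (L : 'M[F]_(1 + n)) \in unitmx := unitL l.
  have LD : L *m D = D *m (L *m L) :> 'M[F]_(1 + n).
    rewrite /L /D !mulmx_block !(mulmx0, mulmx1, mul0mx, mul1mx, addr0, add0r).
    by rewrite mul_mx_scalar scaler_nat mulr2n.
  apply: (idem _ (c D)) => //; first exact: cN.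
  by rewrite -!cM ?unitmx_mul ?Lu //; congr c; exact: LD.
have cU (u : 'M[F]_(1, n)) : c (block_mx 1%:M u 0 1%:M : 'M[F]_(1 + n)) = 1.
  set U := block_mx _ _ _ _.
  have Uu : (U : 'M[F]_(1 + n)) \in unitmx := unitU u.
  have UD : D *m U = U *m U *m D :> 'M[F]_(1 + n).
    rewrite /U /D !mulmx_block !(mulmx0, mulmx1, mul0mx, mul1mx, addr0, add0r).
    by rewrite mul_scalar_mx scaler_nat mulr2n.
  apply: (idem _ (c D)) => //; first exact: cN.
  by rewrite mulrC [RHS]mulrC -!cM ?unitmx_mul ?Uu //; congr c; exact: UD.
have IH S : S \in unitmx -> c (block_mx 1%:M 0 0 S : 'M[F]_(1 + n)) = `|\det S|.
  apply: (IHn (fun S => c (block_mx 1%:M 0 0 S : 'M[F]_(1 + n)))).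
  - move=> X Y Xu Yu; rewrite -cM ?unit_block ?oner_eq0 //; congr c.
    have -> : block_mx 1%:M 0 0 (X *m Y) =
        block_mx 1%:M 0 0 X *m block_mx 1%:M 0 0 Y :> 'M[F]_(1 + n).
      by rewrite mulmx_block !(mulmx0, mulmx1, mul0mx, mul1mx, addr0, add0r).
    by [].
  - by move=> X.
  - move=> d d0; rewrite -diag_const_mx -diag_mx_row cD' => [|i].
      rewrite big_split_ord big_ord1 row_mxEl mxE normr1 [LHS]mul1r.
      by apply: eq_bigr => i _; rewrite row_mxEr.
    case: (split_ordP i) => j ->; rewrite ?row_mxEl ?row_mxEr //.
    by rewrite mxE oner_eq0.
have pivot (B : 'M[F]_(1 + n)) : B \in unitmx -> B 0 0 != 0 -> c B = `|\det B|.
  move=> Bu a0; set a := B 0 0 in a0.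
  pose u := a^-1 *: ursubmx B; pose l := a^-1 *: dlsubmx B.
  pose S := drsubmx B - a^-1 *: (dlsubmx B *m ursubmx B).
  have BE : B = (block_mx 1%:M 0 l 1%:M : 'M[F]_(1 + n)) *m
      (block_mx a%:M 0 0 1%:M *m (block_mx 1%:M 0 0 S *m block_mx 1%:M u 0 1%:M)).
    rewrite !mulmx_block !(mulmx0, mulmx1, mul0mx, mul1mx, addr0, add0r).
    rewrite -[LHS]submxK; congr block_mx.
    - by rewrite [LHS]mx11_scalar; congr _%:M; rewrite !mxE !lshift0.
    - by rewrite mul_scalar_mx scalerA mulfV // scale1r.
    - by rewrite mul_mx_scalar scalerA mulfV // scale1r.
    - rewrite /l /u mul_scalar_mx -!scalemxAl -!scalemxAr !scalerA.
      by rewrite mulfV // mulr1 /S addrC subrK.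
  have dB : \det B = a * \det S.
    by rewrite BE !det_mulmx !det_lblock det_ublock !det1 det_scalar1; ring.
  have Su : S \in unitmx.
    by move: Bu; rewrite !unitmxE dB unitrM => /andP[].
  have V1 := unit_block _ _ a0 (unitmx1 F n).
  have V2 := unit_block _ _ (oner_neq0 F) Su.
  rewrite {1}BE cM ?unitL ?unitmx_mul ?V1 ?V2 ?unitU //.
  rewrite cM ?V1 ?unitmx_mul ?V2 ?unitU //.
  rewrite cM ?V2 ?unitU // cL cU cdiag1 // IH // mul1r mulr1.
  by rewrite dB normrM.
have [i Ai0] : exists i, A i 0 != 0.
  apply: contrapT => /forallNP h; move: Au; rewrite unitmxE unitfE.
  by rewrite (expand_det_col _ 0) big1 ?eqxx // => i _;
     have /negP/negPn/eqP -> := h i; rewrite mul0r.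
have Pu : (tperm_mx 0 i : 'M[F]_n.+1) \in unitmx by exact: unitmx_perm.
have cP : c (tperm_mx 0 i) = 1.
  have PP : (tperm_mx 0 i : 'M[F]_n.+1) *m tperm_mx 0 i = 1%:M.
    by rewrite -perm_mxM tperm2 perm_mx1.
  have := cM _ _ Pu Pu; rewrite PP c1 => /esym/eqP; rewrite -expr2 sqrf_eq1.
  by case/orP => /eqP // h; have := c0 (tperm_mx 0 i); rewrite h oppr_ge0 ler10.
have := pivot (tperm_mx 0 i *m A).
rewrite unitmx_mul Pu Au cM // cP mul1r det_mulmx normrM det_perm normrX normrN1.
rewrite expr1n mul1r; apply => //.
by rewrite -xrowE /xrow mxE tpermL.
Qed.

(** * Lebesgue measure under linear maps *)

Section continuous_borel.
Variables (X Y : ptopologicalType).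

Lemma continuous_on_borel (D : set X) (f : X -> Y) : open D ->
  (forall x, D x -> {for x, continuous f}) ->
  measurable_fun (D : set (g_sigma_algebraType (@open X)))
    (f : g_sigma_algebraType (@open X) -> g_sigma_algebraType (@open Y)).
Proof.
move=> oD cf; apply: (@measurability _ _ (g_sigma_algebraType (@open X))
  (g_sigma_algebraType (@open Y)) D f (@open Y) erefl) => _ [B oB <-].
apply: sub_sigma_algebra; rewrite openE => x [Dx Bfx].
apply: filterI; first by apply: open_nbhs_nbhs.
by apply: (cf x Dx); apply: open_nbhs_nbhs.
Qed.

End continuous_borel.

Lemma continuous_at_rV (R : realType) (n : nat) (X : topologicalType) (x : X)
    (f : X -> 'rV[R]_n) :
  (forall i, {for x, continuous (fun a => f a 0 i)}) -> {for x, continuous f}.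
Proof.
move=> cf; apply/cvg_ballP => e e0.
have : \forall y \near x, forall i, ball (f x 0 i) e (f y 0 i).
  apply: filter_forall => i; have /cvg_ballP := cf i; exact.
by apply: filterS => y h; apply/(rV_ball _ _ e0).
Qed.

Section linear_maps.
Variables (R : realType) (n : nat).
Local Notation Rn := 'rV[R]_n.
Local Notation borelR := (g_sigma_algebraType (@open Rn)).
Local Notation L := (@lebesgue_rV R n).
Local Open Scope ereal_scope.

Definition open_cube (r : R) : set Rn := [set a | forall i, (`|a 0 i| < r)%R].

Lemma open_open_cube r : open (open_cube r).
Proof.
suff H (a : Rn) : open_cube r a -> nbhs a (open_cube r) by rewrite openE => a /H.
move=> ar.
apply: (@filter_forall Rn 'I_n (fun i (b : Rn) => (`|b 0 i| < r)%R) (nbhs a)) => i.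
have ci : (fun b : Rn => `|b 0 i|%R) @ a --> `|a 0 i|%R.
  exact: (cvg_comp _ _ (@coord_continuous R 1 n 0%R i a) (@norm_continuous R R _)).
exact: (cvgr_lt _ ci _ (ar i)).
Qed.

Lemma lebesgue_open_cube r : L (open_cube r) < +oo.
Proof.
have mB : measurable (box (fun=> `[(- `|r|)%R, `|r|%R]%classic) : set borelR).
  by apply: measurable_box => i; exact: measurable_itv.
have h : L (open_cube r) <= L (box (fun=> `[(- `|r|)%R, `|r|%R]%classic)).
  apply: le_measure; rewrite ?inE //.
    by apply: open_borel; exact: open_open_cube.
  move=> a ar i /=; rewrite in_itv /= -ler_norml.
  by apply: le_trans (ltW (ar i)) _; exact: ler_norm.
apply: le_lt_trans h _.
rewrite lebesgue_rV_itv_box ?ltry // => i.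
by rewrite -subr_ge0 opprK addr_ge0.
Qed.

Lemma open_cube_cover : \bigcup_m open_cube m%:R = setT.
Proof.
rewrite -subTset => a _.
exists (\max_i (Num.truncn `|a 0%R i|%R).+1)%N => // i.
apply: lt_le_trans (truncnS_gt _) _; rewrite ler_nat.
exact: (@leq_bigmax 'I_n (fun i => (Num.truncn `|a 0%R i|%R).+1) i).
Qed.

(** Dyadic cubes determine a measure: apply the comparison on cubes in both
    directions on bounded sets, then exhaust the space by them. *)
Lemma lebesgue_rV_unique (nu : {measure set borelR -> \bar R}) (c : R) : (0 <= c)%R ->
  (forall k z, nu (dyadic_cube k z) = c%:E * L (dyadic_cube k z)) ->
  forall E, measurable E -> nu E = c%:E * L E.
Proof.
move=> c0 nuc.
pose mu : {measure set borelR -> \bar R} := mscale (NngNum c0) L.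
have muE E : mu E = c%:E * L E by [].
have bounded r (E : set borelR) : measurable E -> E `<=` open_cube r -> nu E = mu E.
  move=> mE Er; apply/eqP; rewrite eq_le; apply/andP; split.
    apply: (@measure_le_dyadic R n mu nu _ (@open_open_cube r) _ _ _ mE Er).
      by rewrite -[X in X < _]/(c%:E * L _) lte_mul_pinfty // ?lebesgue_open_cube // ltry.
    by move=> k z _; rewrite nuc.
  have nur : nu (open_cube r) < +oo.
    have : nu (open_cube r) <= mu (open_cube r).
      apply: (@measure_le_dyadic R n mu nu _ (@open_open_cube r) _ _ _ _ (@subset_refl _ _)).
      - by rewrite -[X in X < _]/(c%:E * L _) lte_mul_pinfty // lebesgue_open_cube.
      - by move=> k z _; rewrite nuc.
      - by apply: open_borel; exact: open_open_cube.
    move=> /le_lt_trans; apply.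
    by rewrite -[X in X < _]/(c%:E * L _) lte_mul_pinfty // lebesgue_open_cube.
  apply: (@measure_le_dyadic R n nu mu _ (@open_open_cube r) nur _ _ mE Er).
  by move=> k z _; rewrite nuc.
move=> E mE; rewrite -muE.
pose F m : set borelR := E `&` open_cube m%:R.
have mF m : measurable (F m).
  by apply: measurableI => //; apply: open_borel; exact: open_open_cube.
have FE : \bigcup_m F m = E by rewrite -setI_bigcupr open_cube_cover setIT.
have ndF : {homo F : i j / (i <= j)%N >-> (i <= j)%O}.
  move=> i j ij; apply/subsetPset => a [Ea ai]; split => // l.
  by apply: lt_le_trans (ai l) _; rewrite ler_nat.
have mUF : measurable (\bigcup_m F m) by rewrite FE.
have c1 := nondecreasing_cvg_mu (mu := nu) mF mUF ndF.
have c2 := nondecreasing_cvg_mu (mu := mu) mF mUF ndF.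
rewrite FE in c1 c2.
have e : nu \o F = mu \o F.
  by apply/funext => m /=; apply: (@bounded m%:R) => //; exact: subIsetr.
by rewrite e in c1; exact: (cvg_unique _ c1 c2).
Qed.

Lemma lebesgue_affine_fiber (k : nat) (d v : R) (z : int) : d != 0%R ->
  lebesgue_measure ([set r | Num.floor (2 ^+ k * (d * r + v)) = z] : set (measurableTypeR R))
    = (2 ^- k * `|d|^-1)%:E /\
  measurable ([set r | Num.floor (2 ^+ k * (d * r + v)) = z] : set (measurableTypeR R)).
Proof.
move=> d0; have k0 : (0 < 2 ^+ k :> R)%R by rewrite exprn_gt0.
have SE : [set r | Num.floor (2 ^+ k * (d * r + v)) = z] =
  [set r | (z%:~R / 2 ^+ k - v <= d * r < (z + 1)%:~R / 2 ^+ k - v)%R].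
  apply/seteqP; split => r /=.
    move=> <-; rewrite lerBlDr ltrBrDr ler_pdivrMr // ltr_pdivlMr //.
    by rewrite [((_ + v) * _)%R]mulrC floor_itv.
  rewrite lerBlDr ltrBrDr ler_pdivrMr // ltr_pdivlMr //.
  by rewrite [((_ + v) * _)%R]mulrC; exact: floor_def.
have len : ((z + 1)%:~R / 2 ^+ k - v - (z%:~R / 2 ^+ k - v) = 2 ^- k)%R.
  by rewrite intrD mulrDl; ring.
have lt1 : (z%:~R / 2 ^+ k - v < (z + 1)%:~R / 2 ^+ k - v)%R.
  by rewrite -subr_gt0 len invr_gt0.
move: SE len lt1; set x := (z%:~R / _ - v)%R; set y := (_ / _ - v)%R => SE len lt1.
have [dp|dn|/esym/eqP] := ltgtP 0%R d; last by rewrite (negbTE d0).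
  have -> : [set r | Num.floor (2 ^+ k * (d * r + v)) = z] = `[(x / d)%R, (y / d)%R[%classic.
    rewrite SE; apply/seteqP; split => r /=; rewrite in_itv /=;
    by rewrite ler_pdivrMr // ltr_pdivlMr // [(r * d)%R]mulrC.
  split; last exact: measurable_itv.
  rewrite lebesgue_measure_itv /= lte_fin ltr_pM2r ?invr_gt0 // lt1 -EFinB.
  by rewrite -mulrBl len gtr0_norm.
have -> : [set r | Num.floor (2 ^+ k * (d * r + v)) = z] = `](y / d)%R, (x / d)%R]%classic.
  rewrite SE; apply/seteqP; split => r /=; rewrite in_itv /=;
  by rewrite ler_ndivlMr // ltr_ndivrMr // [(r * d)%R]mulrC andbC.
split; last exact: measurable_itv.
rewrite lebesgue_measure_itv /= lte_fin ltr_nM2r ?invr_lt0 // lt1 -EFinB.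
by rewrite -mulrBl -opprB len ltr0_norm // invrN mulrN mulNr.
Qed.

Lemma lebesgue_rV_diag (d v : 'rV[R]_n) (E : set borelR) : (forall i, d 0 i != 0)%R ->
  measurable E ->
  L [set a | E (\row_i (d 0 i * a 0 i + v 0 i))%R] = (\prod_i `|d 0 i|^-1)%:E * L E.
Proof.
move=> d0 mE.
pose f (a : Rn) : Rn := (\row_i (d 0 i * a 0 i + v 0 i))%R.
have cf : continuous f.
  move=> a; apply: continuous_at_rV => i.
  rewrite (_ : (fun b => f b 0%R i) = (fun b : Rn => d 0 i * b 0 i + v 0 i)%R).
    have gc : continuous (fun r : R => d 0 i * r + v 0 i)%R.
      by move=> r; apply: cvgD; [apply: cvgMr; exact: cvg_id|exact: cvg_cst].
    exact: (cvg_comp _ _ (@coord_continuous R 1 n 0%R i a) (gc _)).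
  by apply/funext => b; rewrite mxE.
have mf : measurable_fun setT (f : borelR -> borelR).
  exact: (@continuous_on_borel Rn Rn setT f openT (fun x _ => cf x)).
pose mk := measure_function_pushforward__canonical__measure_function_Measure L mf.
have c0 : (0 <= \prod_i `|d 0 i|^-1)%R by apply: prodr_ge0 => i _; rewrite invr_ge0.
apply: (@lebesgue_rV_unique mk _ c0 _ E mE) => k z.
rewrite lebesgue_rV_cube -[LHS]/(L (f @^-1` dyadic_cube k z)).
rewrite (_ : f @^-1` _ =
    box (fun i => [set r | Num.floor (2 ^+ k * (d 0 i * r + v 0 i))%R = z i])); last first.
  by apply/seteqP; split => a h i; have := h i; rewrite mxE.
rewrite lebesgue_rV_box => [|i]; last by have [] := lebesgue_affine_fiber k (v 0%R i) (z i) (d0 i).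
transitivity ((\prod_(i < n) (2 ^- k * `|d 0 i|^-1))%:E : \bar R).
  rewrite -prodEFin; apply: eq_bigr => i _.
  by have [] := lebesgue_affine_fiber k (v 0%R i) (z i) (d0 i).
by rewrite -EFinM big_split /= prodr_const card_ord mulrC.
Qed.

Definition linear_scale (T : 'M[R]_n) : R :=
  fine (L [set a | dyadic_cube 0 [ffun=> 0%R] (a *m T)]).

Lemma continuous_mulmxr (T : 'M[R]_n) : continuous (fun a : Rn => a *m T : Rn).
Proof.
move=> a; apply: continuous_at_rV => i.
rewrite (_ : (fun b => (b *m T) 0%R i) = (fun b : Rn => \sum_j b 0 j * T j i)%R).
  have cs : continuous (fun b : Rn => \sum_j b 0 j * T j i)%R.
    apply: continuous_big => [|j _ b]; first exact: add_continuous.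
    have gc : continuous (fun r : R => r * T j i)%R.
      by move=> r; apply: cvgMl; exact: cvg_id.
    exact: (cvg_comp _ _ (@coord_continuous R 1 n 0%R j b) (gc _)).
  exact: cs.
by apply/funext => b; rewrite mxE.
Qed.

Lemma measurable_mulmxr (T : 'M[R]_n) (E : set borelR) :
  measurable E -> measurable ([set a | E (a *m T)] : set borelR).
Proof.
move=> mE.
have := @continuous_on_borel Rn Rn setT (fun a => a *m T) openT
  (fun x _ => @continuous_mulmxr T x).
by move=> /(_ measurableT E mE); rewrite setTI.
Qed.

(** The cubes of all levels are images of the unit cube under a translation and a
    scaling.  Pulled back by a linear map, these become again a translation and
    a scaling by the same factor, so the image of Lebesgue measure by the map is
    proportional to Lebesgue measure. *)
Lemma lebesgue_rV_linear_scale (T : 'M[R]_n) (E : set borelR) : T \in unitmx ->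
  measurable E -> L [set a | E (a *m T)] = (linear_scale T)%:E * L E.
Proof.
move=> Tu mE.
have mf : measurable_fun setT ((fun a : Rn => a *m T) : borelR -> borelR).
  exact: (@continuous_on_borel Rn Rn setT _ openT (fun x _ => @continuous_mulmxr T x)).
pose nu := measure_function_pushforward__canonical__measure_function_Measure L mf.
have nuE F : nu F = L [set a | F (a *m T)] by [].
pose Q0 : set Rn := dyadic_cube 0 [ffun=> 0%R].
have fin : L [set a | Q0 (a *m T)] < +oo.
  pose r := (1 + \sum_i \sum_j `|invmx T i j|)%R.
  apply: le_lt_trans (lebesgue_open_cube r).
  apply: le_measure; rewrite ?inE.
  - by apply: measurable_mulmxr; exact: measurable_dyadic_cube.
  - by apply: open_borel; exact: open_open_cube.
  move=> a /dyadic_cubeP h i.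
  rewrite -(mulmxK Tu a) mxE; apply: le_lt_trans (ler_norm_sum _ _ _) _.
  rewrite /r ltr_pwDl // ; apply: ler_sum => j _.
  rewrite normrM; apply: (@le_trans _ _ `|invmx T j i|%R).
    rewrite ler_piMl // ger0_norm; have := h j; rewrite ffunE expr0 mul1r add0r.
      by case/andP => _ /ltW.
    by case/andP.
  by rewrite (bigD1 i) //= lerDl sumr_ge0.
have cE : (linear_scale T)%:E = nu Q0.
  by rewrite nuE /linear_scale fineK // ge0_fin_numE.
rewrite -[LHS]/(nu E).
apply: (@lebesgue_rV_unique nu) => //; first exact: fine_ge0.
move=> k z; rewrite cE lebesgue_rV_cube.
pose v : Rn := (- (\row_i (z i)%:~R) *m invmx T)%R.
pose d : Rn := (\row__ 2 ^+ k)%R.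
have d0 i : (d 0 i != 0)%R by rewrite mxE expf_neq0 // pnatr_eq0.
have mQ0 : measurable ([set a | Q0 (a *m T)] : set borelR).
  by apply: measurable_mulmxr; exact: measurable_dyadic_cube.
have hD := lebesgue_rV_diag v d0 mQ0.
have keyE (a : Rn) i : (((\row_i (d 0 i * a 0 i + v 0 i)) *m T) 0 i)%R =
    (2 ^+ k * (a *m T) 0 i - (z i)%:~R)%R.
  rewrite (_ : (\row_i _)%R = (2 ^+ k *: a + v)%R); last first.
    by apply/rowP => j; rewrite !mxE.
  rewrite mulmxDl -scalemxAl mxE [X in (X + _)%R]mxE /v mulmxKV //; congr (_ + _)%R.
  by rewrite !mxE.
have SE : [set a : Rn | [set b : Rn | Q0 (b *m T)] (\row_i (d 0 i * a 0 i + v 0 i))%R] =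
    [set a | dyadic_cube k z (a *m T)].
  apply/seteqP; split=> a /dyadic_cubeP h; apply/dyadic_cubeP => i; have := h i.
    rewrite keyE ffunE expr0 mul1r add0r subr_ge0 => /andP[-> /=].
    by rewrite ltrBlDr intrD addrC.
  rewrite keyE ffunE expr0 mul1r add0r subr_ge0 => /andP[-> /=].
  by rewrite ltrBlDr intrD addrC.
transitivity (L [set a : Rn | dyadic_cube k z (a *m T)]) => //; rewrite -SE.
rewrite [LHS]hD muleC; congr (_ * _); congr EFin.
rewrite -exprVn -[in RHS](card_ord n) -prodr_const.
by apply: eq_bigr => i _; rewrite mxE gtr0_norm ?exprVn ?exprn_gt0.
Qed.

(** The proportionality factor is multiplicative in [T] and known for diagonal
    matrices, hence it is given by the determinant. *)
Lemma lebesgue_rV_mulmx (T : 'M[R]_n) (E : set borelR) : T \in unitmx ->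
  measurable E -> L [set a | E (a *m T)] = (`|\det T|^-1)%:E * L E.
Proof.
move=> Tu mE; rewrite lebesgue_rV_linear_scale //; congr (_%:E * _).
pose Q0 : set Rn := dyadic_cube 0 [ffun=> 0%R].
have mQ0 : measurable (Q0 : set borelR) by exact: measurable_dyadic_cube.
have LQ0 : L Q0 = 1 by rewrite lebesgue_rV_cube expr0 invr1 expr1n.
have c_ge0 A : (0 <= linear_scale A)%R by exact: fine_ge0.
have cE A : A \in unitmx -> (linear_scale A)%:E = L [set a | Q0 (a *m A)].
  by move=> Au; rewrite lebesgue_rV_linear_scale // LQ0 mule1.
have cM A B : A \in unitmx -> B \in unitmx ->
    linear_scale (A *m B) = (linear_scale A * linear_scale B)%R.
  move=> Au Bu; apply: EFin_inj.
  rewrite cE ?unitmx_mul ?Au // EFinM [X in _ * X]cE //.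
  rewrite -lebesgue_rV_linear_scale //; last exact: measurable_mulmxr.
  by congr (L _); apply/seteqP; split=> a /=; rewrite mulmxA.
apply: invr_inj; rewrite invrK.
apply: (@multiplicative_abs_det R n (fun A => (linear_scale A)^-1)%R) => //.
- by move=> A B Au Bu; rewrite cM // invfM.
- by move=> A; rewrite invr_ge0.
- move=> d d0; apply: invr_inj; rewrite invrK; apply: EFin_inj.
  have Du : diag_mx d \in unitmx.
    by rewrite unitmxE det_diag unitfE; apply/prodf_neq0 => i _.
  rewrite cE // -prodfV -[RHS]mule1 -LQ0.
  rewrite -(@lebesgue_rV_diag d 0 _ d0 mQ0); congr (L _).
  apply/seteqP; split=> a /=.
    by rewrite mul_mx_diag; congr Q0; apply/rowP => i; rewrite !mxE addr0 mulrC.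
  by rewrite mul_mx_diag; congr Q0; apply/rowP => i; rewrite !mxE addr0 mulrC.
Qed.

End linear_maps.

(** * Mean value and diameter estimates *)

Section lipschitz_estimate.
Variables (R : realType) (n : nat).
Local Notation Rn := 'rV[R]_n.
Local Notation borelR := (g_sigma_algebraType (@open Rn)).
Local Notation L := (@lebesgue_rV R n).

Lemma is_derive_line (F : Rn -> Rn) (A : 'M[R]_n) (i : 'I_n) (y v : Rn) (s : R) :
  derivable F (y + s *: v) v ->
  is_derive s 1 (fun t : R => (F (y + t *: v) *m A) 0 i)
    (('D_v F (y + s *: v) *m A) 0 i).
Proof.
move=> dF; pose lin (u : Rn) : R := (u *m A) 0 i.
have clin : continuous lin.
  move=> u.
  exact: (cvg_comp _ _ (@continuous_mulmxr R n A u) (@coord_continuous R 1 n 0 i _)).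
have cF : (fun h : R => h^-1 *: ((F \o shift (y + s *: v)) (h *: v) - F (y + s *: v)))
    @ 0^' --> ('D_v F (y + s *: v) : Rn) := dF.
have h := cvg_comp _ _ cF (clin _).
have E : (fun h : R => h^-1 *: (((fun t : R => (F (y + t *: v) *m A) 0 i)
    \o shift s) (h *: 1) - (F (y + s *: v) *m A) 0 i)) =
  lin \o (fun h : R => h^-1 *: ((F \o shift (y + s *: v)) (h *: v) - F (y + s *: v))).
  apply/funext => h1; rewrite /lin /=.
  have -> : h1 *: (1 : R) = h1 by exact: mulr1.
  have -> : y + (h1 + s) *: v = h1 *: v + (y + s *: v) by rewrite scalerDl addrCA.
  rewrite -scalemxAl mulmxBl [RHS]mxE; congr (_ * _).
  by rewrite [RHS]mxE; congr (_ + _); rewrite [RHS]mxE.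
apply: DeriveDef; first by apply/cvg_ex; exists (lin ('D_v F (y + s *: v))); rewrite E.
by apply: cvg_lim => //; rewrite E.
Qed.

(** The matrix [A] will be the inverse of the derivative of [F] at a fixed
    point, so that the estimate is made for a map close to the identity. *)
Lemma mean_value_bound (F : Rn -> Rn) (A : 'M[R]_n) (i : 'I_n) (x y : Rn) (K : R) :
  (forall t : R, 0 <= t <= 1 -> derivable F (y + t *: (x - y)) (x - y)) ->
  (forall t : R, 0 <= t <= 1 ->
     `|('D_(x - y) F (y + t *: (x - y)) *m A) 0 i| <= K) ->
  `|(F x *m A) 0 i - (F y *m A) 0 i| <= K.
Proof.
move=> dF DK.
pose g (t : R) := (F (y + t *: (x - y)) *m A) 0 i.
have [//|||c c01] := @MVT_segment R g
  (fun t => ('D_(x - y) F (y + t *: (x - y)) *m A) 0 i) 0 1.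
- move=> t; rewrite in_itv /= => /andP[/ltW t0 /ltW t1].
  by apply: is_derive_line; apply: dF; rewrite t0 t1.
- apply: derivable_within_continuous => t; rewrite in_itv /= => t01.
  by have [] := is_derive_line A i (dF t t01).
rewrite /g scale1r scale0r addr0 [y + (x - y)]addrC subrK subr0 mulr1 => ->.
by apply: DK; rewrite in_itv in c01.
Qed.

(** For the sup norm a set of diameter [D] lies in a cube of side [D]. *)
Lemma lebesgue_diam_bound (S : set borelR) (D : R) : 0 <= D -> measurable S ->
  (forall x y, S x -> S y -> forall i, `|x 0 i - y 0 i| <= D) ->
  (L S <= (D ^+ n)%:E)%E.
Proof.
move=> D0 mS diam.
have [->|/set0P[a Sa]] := eqVneq S set0; first by rewrite measure0 lee_fin exprn_ge0.
pose I i : set R := [set x 0 i | x in (S : set Rn)].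
have lbI i : lbound (I i) (a 0 i - D).
  by move=> _ [x Sx <-]; have := diam a x Sa Sx i; rewrite ler_norml => /andP[_]; lra.
pose m i := inf (I i).
have mE : measurable (box (fun i => `[m i, m i + D]%classic) : set borelR).
  by apply: measurable_box => i; exact: measurable_itv.
apply: (@le_trans _ _ (L (box (fun i => `[m i, m i + D]%classic)))).
  apply: le_measure; rewrite ?inE // => x Sx i /=; rewrite in_itv /=; apply/andP; split.
    by apply: ge_inf; [exists (a 0 i - D); exact: lbI|exists x].
  rewrite -lerBlDr; apply: lb_le_inf; first by exists (x 0 i); exists x.
  by move=> _ [y Sy <-]; have := diam x y Sx Sy i; rewrite ler_norml => /andP[_]; lra.
rewrite lebesgue_rV_itv_box => [|i]; last by rewrite lerDl.
by under eq_bigr do rewrite addrC addKr; rewrite prodr_const card_ord.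
Qed.

End lipschitz_estimate.

(** * Volume distortion by maps of class C^1 *)

Section local_distortion.
Variables (R : realType) (n : nat).
Local Notation Rn := 'rV[R]_n.
Local Notation borelR := (g_sigma_algebraType (@open Rn)).
Local Notation L := (@lebesgue_rV R n).

Lemma convex_rV_ball (a x y : Rn) (r t : R) : 0 < r -> ball a r x -> ball a r y ->
  0 <= t <= 1 -> ball a r (y + t *: (x - y)).
Proof.
move=> r0 /(rV_ball _ _ r0) ax /(rV_ball _ _ r0) ay /andP[t0 t1].
apply/(rV_ball _ _ r0) => i; rewrite !mxE.
have -> : a 0 i - (y 0 i + t * (x 0 i - y 0 i)) =
    t * (a 0 i - x 0 i) + (1 - t) * (a 0 i - y 0 i) by ring.
have t1' : 0 <= 1 - t by rewrite subr_ge0.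
apply: le_lt_trans (ler_normD _ _) _; rewrite !normrM (ger0_norm t0) (ger0_norm t1').
have [->|tp] := eqVneq t 0; first by rewrite mul0r add0r subr0 mul1r.
have -> : r = t * r + (1 - t) * r by ring.
apply: ltr_leD; first by rewrite ltr_pM2l // lt_def tp.
by rewrite ler_wpM2l // ltW.
Qed.

(** The entries of the derivative of [F *m invmx ('J F a)] are continuous and
    form the identity matrix at [a]; where each is within [e / n.+1] of its
    value, every column has absolute sum at most [1 + e]. *)
Lemma C1_near_linear (U : set Rn) (F : Rn -> Rn) (a : Rn) (e : R) :
  open U -> Cr_on 1 U F -> U a -> 'J F a \in unitmx -> 0 < e ->
  exists r : R, [/\ 0 < r, ball a r `<=` U &
    forall x y M, ball a r x -> ball a r y -> (forall j, `|x 0 j - y 0 j| <= M) ->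
      forall i, `|(F x *m invmx ('J F a)) 0 i - (F y *m invmx ('J F a)) 0 i|
                <= (1 + e) * M].
Proof.
move=> oU [dF cDF] Ua Tu e0; set A := invmx ('J F a).
pose P (j i : 'I_n) (x : Rn) : R := ('D_(delta_mx 0 j) F x *m A) 0 i.
have cP j i : {for a, continuous (P j i)}.
  have h := cvg_comp _ _ (cDF (delta_mx 0 j) a Ua) (@continuous_mulmxr R n A _).
  exact: (cvg_comp _ _ h (@coord_continuous R 1 n 0 i _)).
have Pa j i : P j i a = (j == i)%:R.
  rewrite /P deriveEjacobian; last exact: dF.
  by rewrite -mulmxA mulmxV // mulmx1 mxE eqxx eq_sym.
pose d := e / n.+1%:R.
have d0 : 0 < d by rewrite divr_gt0.
have nearP : \forall x \near a, forall ji : 'I_n * 'I_n, `|P ji.1 ji.2 a - P ji.1 ji.2 x| < d.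
  apply: (@filter_forall Rn _ (fun ji x => `|P ji.1 ji.2 a - P ji.1 ji.2 x| < d) (nbhs a)).
  move=> [j i] /=; have /cvgrPdist_lt/(_ d d0) := cP j i; exact.
have Unear : nbhs a U by apply: open_nbhs_nbhs.
have /nbhs_ballP[r /= r0 ballr] : nbhs a
    (U `&` [set x | forall ji : 'I_n * 'I_n, `|P ji.1 ji.2 a - P ji.1 ji.2 x| < d]).
  exact: filterI.
exists r; split => //; first by move=> x /ballr[].
move=> x y M ax ay xyM i.
have inb t : 0 <= t <= 1 -> ball a r (y + t *: (x - y)) by exact: convex_rV_ball.
have dFt t : 0 <= t <= 1 -> differentiable F (y + t *: (x - y)).
  by move=> /inb/ballr[Ut _]; exact: dF.
apply: mean_value_bound => [t /dFt|t t01]; first exact: diff_derivable.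
have [_ Pt] := ballr _ (inb t t01).
set p := y + t *: (x - y) in Pt *.
have -> : 'D_(x - y) F p *m A = \sum_j (x 0 j - y 0 j) *: ('D_(delta_mx 0 j) F p *m A).
  rewrite deriveEjacobian; last exact: dFt.
  rewrite {1}[x - y]row_sum_delta !mulmx_suml; apply: eq_bigr => j _.
  rewrite (deriveEjacobian _ (dFt t t01)) -!scalemxAl; congr (_ *: _).
  by rewrite !mxE.
rewrite summxE; apply: le_trans (ler_norm_sum _ _ _) _.
have M0 (j : 'I_n) : 0 <= M by exact: le_trans (normr_ge0 _) (xyM j).
apply: (@le_trans _ _ (\sum_j M * ((j == i)%:R + d))).
  apply: ler_sum => j _; rewrite mxE normrM ler_pM //.
  have := Pt (j, i); rewrite /= Pa -/(P j i p) => h.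
  rewrite -[P j i p](subrK ((j == i)%:R)); apply: le_trans (ler_normD _ _) _.
  by rewrite addrC lerD // ?normr_nat // distrC ltW.
rewrite -mulr_sumr big_split /= mulrC ler_wpM2r ?(M0 i) //.
rewrite sumr_const card_ord (bigD1 i) //= eqxx big1 ?addr0 => [|j /negbTE-> //].
have -> : d *+ n = e * (n%:R / n.+1%:R) by rewrite -(mulr_natr d) /d mulrAC mulrA.
rewrite lerD2l ler_piMr ?ltW //.
by rewrite ltr_pdivrMr // mul1r ltr_nat.
Qed.

(** Composed with the inverse of its derivative at [a], a C^1 map is
    nearly 1-Lipschitz for the sup norm, hence maps a small cube into a cube of nearly
    the same side; the derivative itself contributes its determinant. *)
Lemma local_volume_distortion (U U' : set Rn) (F H : Rn -> Rn) (a : Rn) (t : R) :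
  open U -> open U' -> Cr_on 1 U F ->
  (forall x, U x -> U' (F x) /\ H (F x) = x) ->
  (forall y, U' y -> U (H y) /\ F (H y) = y) ->
  (forall y, U' y -> {for y, continuous H}) ->
  U a -> 'J F a \in unitmx -> `|\det ('J F a)| < t ->
  exists V : set Rn, [/\ open V, V a, V `<=` U &
    forall E : set borelR, measurable E -> E `<=` V ->
      (L (F @` E) <= t%:E * L E)%E].
Proof.
move=> oU oU' cF FK HK cH Ua Tu dt; set T := 'J F a in Tu dt.
have t0 : 0 < t by apply: le_lt_trans dt.
have T0 : 0 < `|\det T| by rewrite normr_gt0 -unitfE -unitmxE.
(* the slack between the determinant and t absorbs the n-th power of the
   Lipschitz constant *)
have [e [e0 et]] : exists e, 0 < e /\ `|\det T| * (1 + e) ^+ n <= t.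
  have ch : {for (0 : R), continuous (fun e : R => `|\det T| * (1 + e) ^+ n)}.
    apply: continuousM; first exact: cst_continuous.
    have c1 : {for (0 : R), continuous (fun e : R => 1 + e)}.
      by apply: continuousD; [exact: cst_continuous|exact: cvg_id].
    exact: (cvg_comp _ _ c1 (@exprn_continuous R n _)).
  have h0 : `|\det T| * (1 + 0) ^+ n < t by rewrite addr0 expr1n mulr1.
  have /nbhs_ballP[r /= r0 hr] : nbhs (0 : R) [set e | `|\det T| * (1 + e) ^+ n < t].
    exact: (cvgr_lt _ ch _ h0).
  exists (r / 2); split; first by rewrite divr_gt0.
  apply/ltW/(hr (r / 2)); rewrite /ball /= sub0r normrN gtr0_norm ?divr_gt0 //.
  by rewrite ltr_pdivrMr // ltr_pMr // ltr1n.
have [r [r0 rU lip]] := C1_near_linear oU cF Ua Tu e0.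
have oV : open (ball a r : set Rn) by exact: ball_open.
exists (ball a r); split => //; first exact: ballxx.
have mU' : measurable (U' : set borelR) by exact: open_borel.
have mH := @continuous_on_borel Rn Rn U' H oU' cH.
have imE (E : set Rn) : E `<=` U -> F @` E = U' `&` H @^-1` E.
  move=> EU; apply/seteqP; split => [_ [x Ex <-]|y [U'y Ey]].
    by have [U'F HF] := FK x (EU x Ex); split => //=; rewrite HF.
  by exists (H y) => //; have [] := HK y U'y.
have mim (E : set borelR) : measurable E -> E `<=` U -> measurable (F @` E : set borelR).
  by move=> mE EU; rewrite imE //; exact: mH.
(* H is only continuous on U'; it is made total to have an image measure. *)
pose H' (y : Rn) : Rn := if pselect (U' y) then H y else a.
have mH' : measurable_fun setT (H' : borelR -> borelR).
  move=> _ B mB; rewrite setTI.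
  have [Ba|nBa] := pselect (B a).
    rewrite (_ : H' @^-1` B = (U' `&` H @^-1` B) `|` ~` U').
      by apply: measurableU; [exact: mH|exact: measurableC].
    apply/seteqP; split => y; rewrite /H' /=; case: pselect => U'y.
    - by left.
    - by right.
    - by case=> [[]//|/(_ U'y)].
    - by [].
  rewrite (_ : H' @^-1` B = U' `&` H @^-1` B); first exact: mH.
  by apply/seteqP; split => y; rewrite /H' /=; case: pselect => U'y; [split| |case|case].
pose nu := measure_function_pushforward__canonical__measure_function_Measure
  (mrestr L mU') mH'.
have nuE (E : set borelR) : E `<=` U -> nu E = L (F @` E).
  move=> EU; rewrite -[LHS]/(L (H' @^-1` E `&` U')); congr (L _).
  rewrite imE //; apply/seteqP; split => y; rewrite /H' /=; case: pselect => U'y;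
  by [case|case; split|split|case].
pose mu : {measure set borelR -> \bar R} := mscale (NngNum (ltW t0)) L.
have muE E : mu E = (t%:E * L E)%E by [].
have finV : (L (ball a r) < +oo)%E.
  have r2 : 0 <= r + r by rewrite addr_ge0 // ltW.
  apply: le_lt_trans (lebesgue_diam_bound r2 (open_borel oV) _) (ltry _).
  move=> x y /(rV_ball _ _ r0) ax /(rV_ball _ _ r0) ay i.
  rewrite -(subrKA (a 0 i)) addrC; apply: le_trans (ler_normD _ _) _.
  by rewrite lerD // ?[`|x _ _ - _|]distrC ltW.
have finmu : (mu (ball a r) < +oo)%E by rewrite muE lte_mul_pinfty // ltW // lte_fin.
move=> E mE EV; rewrite -muE -nuE; last exact: subset_trans EV rU.
apply: (measure_le_dyadic oV finmu _ mE EV) => k z zV.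
have zU := subset_trans zV rU.
rewrite nuE // muE lebesgue_rV_cube.
have mz : measurable (dyadic_cube k z : set borelR) by exact: measurable_dyadic_cube.
have mFz := mim _ mz zU.
have LT := lebesgue_rV_mulmx Tu mFz.
have -> : L (F @` dyadic_cube k z) =
    (`|\det T|%:E * L [set b | (F @` dyadic_cube k z) (b *m T)])%E.
  by rewrite LT muleA -EFinM mulfV ?gt_eqF // mul1e.
have k0 : 0 <= (2 ^- k : R) by rewrite invr_ge0 exprn_ge0.
have D0 : 0 <= (1 + e) * 2 ^- k by rewrite mulr_ge0 // addr_ge0 // ltW.
have mS := measurable_mulmxr T mFz.
have := lebesgue_diam_bound D0 mS.
have diamS x y : (F @` dyadic_cube k z) (x *m T) -> (F @` dyadic_cube k z) (y *m T) ->
    forall i, `|x 0 i - y 0 i| <= (1 + e) * 2 ^- k.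
  move=> [x' zx' xE] [y' zy' yE] i.
  have := lip x' y' (2 ^- k) (zV _ zx') (zV _ zy').
  rewrite xE yE !mulmxK //; apply => j; apply: ltW; exact: dyadic_cube_diam zx' zy'.
move=> /(_ diamS) LS.
apply: (@le_trans _ _ (`|\det T|%:E * (((1 + e) * 2 ^- k) ^+ n)%:E)%E).
  by apply: lee_wpmul2l.
by rewrite -!EFinM lee_fin exprMn mulrA ler_wpM2r // exprn_ge0.
Qed.

End local_distortion.

(** * Calculus in charts *)

Section jacobian_calculus.
Variables (R : realType).

Lemma jacobian_comp (l m n : nat) (f : 'rV[R]_l -> 'rV[R]_m) (g : 'rV[R]_m -> 'rV[R]_n)
    (a : 'rV[R]_l) (b : 'rV[R]_m) :
  f a = b -> differentiable f a -> differentiable g b ->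
  'J (g \o f) a = 'J f a *m 'J g b.
Proof.
move=> <- df dg; apply/row_matrixP => i; rewrite !rowE mulmxA.
rewrite -deriveEjacobian; last exact: differentiable_comp.
rewrite -(deriveEjacobian _ df) -(deriveEjacobian _ dg) !deriveE //.
  by rewrite diff_comp.
exact: differentiable_comp.
Qed.

Lemma jacobian_near_eq (m n : nat) (f g : 'rV[R]_m -> 'rV[R]_n) (a : 'rV[R]_m) :
  differentiable f a -> differentiable g a -> (\forall x \near a, f x = g x) ->
  'J f a = 'J g a.
Proof.
move=> df dg fg.
have H (v : 'rV[R]_m) : v *m 'J f a = v *m 'J g a.
  have hf := deriveEjacobian v df; have hg := deriveEjacobian v dg.
  exact: etrans (esym hf) (etrans (near_eq_derive v fg) hg).
by apply/row_matrixP => i; rewrite [LHS]rowE [RHS]rowE; exact: H.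
Qed.

Lemma jacobian_id_near (n : nat) (f : 'rV[R]_n -> 'rV[R]_n) (a : 'rV[R]_n) :
  differentiable f a -> (\forall x \near a, f x = x) -> 'J f a = 1%:M.
Proof.
move=> df fa; have H (v : 'rV[R]_n) : v *m 'J f a = v *m 1%:M.
  have hf := deriveEjacobian v df; rewrite mulmx1.
  exact: etrans (esym hf) (etrans (near_eq_derive (g := id) v fa) (derive_id _ _)).
by apply/row_matrixP => i; rewrite [LHS]rowE [RHS]rowE; exact: H.
Qed.

Lemma continuous_det (n : nat) : continuous (fun A : 'M[R]_n => \det A).
Proof.
apply: continuous_big => [|s _]; first exact: add_continuous.
have cprod : continuous (fun A : 'M[R]_n => \prod_i A i (s i)).
  apply: continuous_big => [|i _ A]; first exact: mul_continuous.
  exact: coord_continuous.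
have csign : continuous (fun r : R => (-1) ^+ s * r).
  by move=> r; apply: cvgMr; exact: cvg_id.
by move=> A; exact: (cvg_comp _ _ (cprod A) (csign _)).
Qed.

Lemma continuous_at_mx (m n : nat) (X : topologicalType) (x : X)
    (f : X -> 'M[R]_(m, n)) :
  (forall i j, {for x, continuous (fun a => f a i j)}) -> {for x, continuous f}.
Proof.
move=> cf; apply/cvg_ballP => e e0.
have : \forall y \near x, forall ij : 'I_m * 'I_n, ball (f x ij.1 ij.2) e (f y ij.1 ij.2).
  apply: filter_forall => -[i j]; have /cvg_ballP := cf i j; exact.
by apply: filterS => y h; split => // i j; exact: (h (i, j)).
Qed.

Lemma jacobian_continuous (m n : nat) (U : set 'rV[R]_m) (f : 'rV[R]_m -> 'rV[R]_n)
    (a : 'rV[R]_m) : open U -> Cr_on 1 U f -> U a -> {for a, continuous (fun x => 'J f x)}.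
Proof.
move=> oU [df cDf] Ua; apply: continuous_at_mx => i j.
have h := cvg_comp _ _ (cDf (delta_mx 0 i) a Ua) (@coord_continuous R 1 n 0 j _).
have E x : U x -> 'J f x i j = ('D_(delta_mx 0 i) f x) 0 j.
  by move=> Ux; rewrite (deriveEjacobian _ (df x Ux)) -rowE [RHS]mxE.
suff : (fun x => 'J f x i j) @ a --> ('D_(delta_mx 0 i) f a) 0 j.
  by rewrite -E.
have Un : nbhs a U by apply: open_nbhs_nbhs.
have nE : {near nbhs a, (fun x => ('D_(delta_mx 0 i) f x) 0 j) =1 (fun x => 'J f x i j)}.
  by apply: (@filterS _ (nbhs a) (nbhs_filter a) U) => // x Ux; rewrite E.
exact: cvg_trans (@near_eq_cvg _ _ (nbhs a) (nbhs_filter a) _ _ nE) h.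
Qed.

End jacobian_calculus.

Section chart_calculus.
Variables (R : realType) (n : nat).
Implicit Types M N : manifold R n.

Lemma chart_image_open M (c : chart R n M) (A : set M) :
  atlas c -> open A -> open (cmap c @` (cdom c `&` A)).
Proof.
move=> /atlas_chart hc oA.
rewrite openE => _ [x [cx Ax] <-].
have h1 : nbhs (cmap c x) (cmap c @` cdom c).
  by apply: open_nbhs_nbhs; split; [exact: open_cimage|exists x].
have h2 : nbhs (cmap c x) (cinv c @^-1` A).
  apply: (cinv_continuous hc cx); rewrite (cmapK hc cx).
  by apply: open_nbhs_nbhs.
apply: filterS (filterI h1 h2) => _ [[y cy <-] /=].
by rewrite (cmapK hc cy) => Ay; exists y.
Qed.

Lemma chart_imageE M (c : chart R n M) (A : set M) : is_chart c -> A `<=` cdom c ->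
  cmap c @` A = (cmap c @` cdom c) `&` cinv c @^-1` A.
Proof.
move=> hc Ac; apply/seteqP; split => [_ [x Ax <-]|_ [[x cx <-]]] /=.
  by rewrite (cmapK hc (Ac _ Ax)); split => //; exists x => //; exact: Ac.
by rewrite (cmapK hc cx) => Ax; exists x.
Qed.

Lemma measurable_chart_image M (c : chart R n M) (A : set (borel M)) :
  atlas c -> A `<=` cdom c -> measurable A ->
  measurable (cmap c @` A : set (g_sigma_algebraType (@open 'rV[R]_n))).
Proof.
move=> ac Ac mA; have hc := atlas_chart ac; rewrite chart_imageE //.
have oD := open_cimage hc.
apply: (@continuous_on_borel _ M _ (cinv c) oD) => //.
- by move=> _ [x cx <-]; exact: cinv_continuous.
- exact: open_borel.
Qed.

Lemma smooth_on_differentiable (W : normedModType R) (U : set 'rV[R]_n)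
    (f : 'rV[R]_n -> W) a : smooth_on U f -> U a -> differentiable f a.
Proof. by move=> /(_ 1%N)[df _] /df. Qed.

(** The chain rule for a transition map and its inverse. *)
Lemma frame_unit M (c : chart R n M) (x : M) : atlas c -> cdom c x ->
  frame c x \in unitmx.
Proof.
move=> ac cx; rewrite /frame; set c' := chart_at x.
have ac' := chart_at_atlas x; rewrite -/c' in ac'.
have c'x := chart_at_dom x; rewrite -/c' in c'x.
have hc := atlas_chart ac; have hc' := atlas_chart ac'.
have d1 : differentiable (cmap c' \o cinv c) (cmap c x).
  by apply: (smooth_on_differentiable (atlas_smooth ac ac')); exists x.
have E : (cmap c' \o cinv c) (cmap c x) = cmap c' x by rewrite /= cmapK.
have d2 : differentiable (cmap c \o cinv c') ((cmap c' \o cinv c) (cmap c x)).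
  by rewrite E; apply: (smooth_on_differentiable (atlas_smooth ac' ac)); exists x.
have J1 : 'J ((cmap c \o cinv c') \o (cmap c' \o cinv c)) (cmap c x) = 1%:M.
  apply: jacobian_id_near; first exact: differentiable_comp.
  have : nbhs (cmap c x) (cmap c @` (cdom c `&` cdom c')).
    apply: open_nbhs_nbhs; split; last by exists x.
    by apply: chart_image_open => //; exact: open_cdom.
  by apply: filterS => _ [y [cy c'y] <-] /=; rewrite (cmapK hc cy) (cmapK hc' c'y).
exact: (mulmx1_unit (etrans (esym (jacobian_comp erefl d1 d2)) J1)).1.
Qed.

(** The tangent map is defined in the preferred charts at [x] and [f x], which
    vary wildly with the point; the chain rule expresses it by the Jacobian in
    fixed charts, which is continuous. *)
Lemma tangent_map_chart M N (f : M -> N) (c : chart R n M) (c' : chart R n N) (x : M) :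
  smooth_map f -> atlas c -> atlas c' -> cdom c x -> cdom c' (f x) ->
  frame c x *m tangent_map f x =
  'J (cmap c' \o f \o cinv c) (cmap c x) *m frame c' (f x).
Proof.
move=> [cf sf] ac ac' cx c'fx; rewrite /frame /tangent_map.
set d := chart_at x; set d' := chart_at (f x).
have ad : atlas d by exact: chart_at_atlas.
have ad' : atlas d' by exact: chart_at_atlas.
have dx : cdom d x by exact: chart_at_dom.
have d'fx : cdom d' (f x) by exact: chart_at_dom.
have [hc hc' hd hd'] : [/\ is_chart c, is_chart c', is_chart d & is_chart d'].
  by split; exact: atlas_chart.
have D1 : differentiable (cmap d \o cinv c) (cmap c x).
  by apply: (smooth_on_differentiable (atlas_smooth ac ad)); exists x.
have D2 : differentiable (cmap d' \o f \o cinv d) (cmap d x).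
  by apply: (smooth_on_differentiable (sf _ _ ad ad')); exists x.
have D3 : differentiable (cmap c' \o f \o cinv c) (cmap c x).
  by apply: (smooth_on_differentiable (sf _ _ ac ac')); exists x.
have D4 : differentiable (cmap d' \o cinv c') (cmap c' (f x)).
  by apply: (smooth_on_differentiable (atlas_smooth ac' ad')); exists (f x).
have E1 : (cmap d \o cinv c) (cmap c x) = cmap d x by rewrite /= cmapK.
have E3 : (cmap c' \o f \o cinv c) (cmap c x) = cmap c' (f x) by rewrite /= cmapK.
apply: (etrans (esym (jacobian_comp E1 D1 D2))).
apply: (etrans _ (jacobian_comp E3 D3 D4)).
rewrite -E1 in D2; rewrite -E3 in D4.
apply: jacobian_near_eq; [exact: differentiable_comp..|].
have oW : open (cdom d `&` f @^-1` (cdom c' `&` cdom d')).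
  apply: openI; first exact: open_cdom.
  by move/continuousP: cf; apply; apply: openI; exact: open_cdom.
have : nbhs (cmap c x) (cmap c @` (cdom c `&` (cdom d `&` f @^-1` (cdom c' `&` cdom d')))).
  by apply: open_nbhs_nbhs; split; [exact: chart_image_open|exists x].
apply: filterS => _ [y [cy [dy [c'y d'y]]] <-] /=.
by rewrite (cmapK hc cy) (cmapK hd dy) (cmapK hc' c'y).
Qed.

Lemma tangent_map_comp_id M N (f : M -> N) (g : N -> M) (x : M) :
  smooth_map f -> smooth_map g -> cancel f g ->
  tangent_map f x *m tangent_map g (f x) = 1%:M.
Proof.
move=> [cf sf] [cg sg] fK; rewrite /tangent_map fK.
set d := chart_at x; set d' := chart_at (f x).
have ad : atlas d by exact: chart_at_atlas.
have ad' : atlas d' by exact: chart_at_atlas.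
have dx : cdom d x by exact: chart_at_dom.
have d'fx : cdom d' (f x) by exact: chart_at_dom.
have hd := atlas_chart ad; have hd' := atlas_chart ad'.
have D1 : differentiable (cmap d' \o f \o cinv d) (cmap d x).
  by apply: (smooth_on_differentiable (sf _ _ ad ad')); exists x.
have D2 : differentiable (cmap d \o g \o cinv d') (cmap d' (f x)).
  by apply: (smooth_on_differentiable (sg _ _ ad' ad)); exists (f x) => //; split => //; rewrite /= fK.
have E1 : (cmap d' \o f \o cinv d) (cmap d x) = cmap d' (f x) by rewrite /= cmapK.
apply: (etrans (esym (jacobian_comp E1 D1 D2))); rewrite -E1 in D2.
apply: jacobian_id_near; first exact: differentiable_comp.
have oW : open (f @^-1` cdom d') by move/continuousP: cf; apply; exact: open_cdom.
have : nbhs (cmap d x) (cmap d @` (cdom d `&` f @^-1` cdom d')).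
  by apply: open_nbhs_nbhs; split; [exact: chart_image_open|exists x].
by apply: filterS => _ [y [dy d'y] <-] /=; rewrite (cmapK hd dy) (cmapK hd' d'y) fK.
Qed.

End chart_calculus.

(** * Change of variables for lower integrals *)

Section lower_integrals.
Import HBNNSimple.
Local Open Scope ereal_scope.
Context d (T : measurableType d) (R : realType).
Variable mu : {measure set T -> \bar R}.

(** The integral of a nonnegative function is the supremum of the integrals of the
    simple functions below it, so monotonicity and scaling hold without
    measurability.  They will be applied to powers of spectral norms, which are
    suprema over uncountable families. *)
Lemma lower_integral_le (D : set T) (f g : T -> \bar R) :
  (forall x, D x -> 0 <= f x) -> (forall x, D x -> f x <= g x) ->
  \int[mu]_(x in D) f x <= \int[mu]_(x in D) g x.
Proof.
move=> f0 fg; have g0 x : D x -> 0 <= g x.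
  by move=> Dx; apply: le_trans (f0 _ Dx) (fg _ Dx).
rewrite !ge0_integralE //; apply: ub_ereal_sup => _ [h hf <-].
apply: ereal_sup_ubound; exists h => // x; apply: le_trans (hf x) _.
by rewrite !patchE; case: ifPn => // /set_mem; exact: fg.
Qed.

Lemma lower_integral_scale (c : R) (g : T -> \bar R) : (0 < c)%R ->
  (forall x, 0 <= g x) ->
  \int[mu]_x (c%:E * g x) <= c%:E * \int[mu]_x g x.
Proof.
move=> c0 g0; have cg0 x : 0 <= c%:E * g x by rewrite mule_ge0 // lee_fin ltW.
rewrite !ge0_integralTE //; apply: ub_ereal_sup => _ [h hg <-].
have ci0 : (0 <= c^-1)%R by rewrite invr_ge0 ltW.
pose h' := scale_nnsfun h ci0.
have hE : sintegral mu h = c%:E * sintegral mu h'.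
  rewrite -(sintegralrM mu c h'); apply: eq_sintegral => x /=.
  by rewrite mulrA mulfV ?mul1r // gt_eqF.
rewrite hE lee_pmul2l ?lte_fin //; apply: ereal_sup_ubound; exists h' => // x /=.
by rewrite EFinM lee_pdivrMl // -EFinM.
Qed.

(** The exceptional null set can be cut out on the left, where the function is
    measurable. *)
Lemma integral_le_lower_ae (f g : T -> \bar R) : measurable_fun setT f ->
  (forall x, 0 <= f x) -> (forall x, 0 <= g x) -> {ae mu, forall x, f x <= g x} ->
  \int[mu]_x f x <= \int[mu]_x g x.
Proof.
move=> mf f0 g0 [Z [mZ muZ fgZ]].
rewrite (ge0_negligible_integral mZ measurableT mf) //.
rewrite setTD integral_mkcond; apply: lower_integral_le => x _.
  by rewrite patchE; case: ifPn.
rewrite patchE; case: ifPn => // /set_mem nZ.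
by apply: contrapT => nfg; apply: nZ; apply: fgZ.
Qed.

End lower_integrals.

Section density_transfer.
Import HBNNSimple.
Local Open Scope ereal_scope.
Context d d' (X : measurableType d) (Y : measurableType d') (R : realType).
Variables (mu : {measure set X -> \bar R}) (nu : {measure set Y -> \bar R}).
Variables (phi : X -> Y) (tau : X -> \bar R).
Hypothesis mphi : measurable_fun setT phi.
Hypothesis mtau : measurable_fun setT tau.
Hypothesis tau0 : forall x, 0 <= tau x.
Hypothesis nu_tau : forall B, measurable B -> nu B <= \int[mu]_(x in phi @^-1` B) tau x.

Lemma sintegral_density_le (h : {nnsfun Y >-> R}) :
  sintegral nu h <= \int[mu]_x (tau x * (h (phi x))%:E).
Proof.
have mh r : measurable (phi @^-1` (h @^-1` [set r])).
  by rewrite -[X in measurable X]setTI; apply: mphi.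
(* absolute values only to have a nonnegative family over all of R *)
pose F r x := `|r|%:E * (tau x * (\1_(phi @^-1` (h @^-1` [set r])) x)%:E).
have mind r : measurable_fun setT (fun x => tau x * (\1_(phi @^-1` (h @^-1` [set r])) x : R)%:E).
  by apply: emeasurable_funM => //; apply/measurable_EFinP.
have ind0 r x : 0 <= tau x * (\1_(phi @^-1` (h @^-1` [set r])) x : R)%:E.
  by rewrite mule_ge0 // lee_fin indicE.
have F0 r x : 0 <= F r x by rewrite mule_ge0 // lee_fin.
have rng r : range h r -> (0 <= r)%R by case=> y _ <-.
rewrite sintegralE.
apply: (@le_trans _ _ (\sum_(r \in range h) \int[mu]_x F r x)).
  apply: lee_fsum => // r /rng r0.
  rewrite ge0_integralZl // ger0_norm //; apply: lee_wpmul2l => //.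
  apply: le_trans (nu_tau _) _ => //.
  rewrite integral_mkcond le_eqVlt; apply/orP; left; apply/eqP.
  apply: eq_integral => x _; rewrite patchE indicE.
  by case: (x \in _); rewrite ?mule1 ?mule0.
rewrite -ge0_integral_fsum //.
- apply: lower_integral_le => x _; first by apply: fsume_ge0.
  rewrite le_eqVlt; apply/orP; left; apply/eqP.
  rewrite (fsbigD1 (h (phi x))) //=; last by exists (phi x).
  rewrite fsbig1 => [|r [_ rn]]; last first.
    rewrite /F indicE memNset ?mule0 //= => /esym; exact: rn.
  by rewrite adde0 /F indicE mem_set //= mule1 muleC ger0_norm.
- by move=> r; apply: emeasurable_funM.
Qed.

(** A one-sided change of variables.  A simple function [h] below [F] gives the
    measurable function [tau * (h \o phi)], so [F \o phi] itself need not be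
    integrated. *)
Lemma lower_integral_transfer (F : Y -> \bar R) (G : X -> \bar R) :
  (forall y, 0 <= F y) -> (forall x, 0 <= G x) ->
  {ae mu, forall x, tau x * F (phi x) <= G x} ->
  \int[nu]_y F y <= \int[mu]_x G x.
Proof.
move=> F0 G0 FG; rewrite ge0_integralTE //; apply: ub_ereal_sup => _ [h hF <-].
apply: le_trans (sintegral_density_le h) _.
apply: integral_le_lower_ae => //.
- apply: emeasurable_funM => //; apply/measurable_EFinP.
  by apply: measurableT_comp.
- by move=> x; rewrite mule_ge0 // lee_fin.
- by apply: filterS FG => x; apply: le_trans; rewrite lee_wpmul2l.
Qed.

End density_transfer.

(** * Riemannian volume and its local distortion *)

Section riemannian_volume.
Variables (R : realType) (n : nat).
Implicit Types M N : manifold R n.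
Local Notation L := (@lebesgue_rV R n).

Lemma gram_posdef M (g : riemannian_metric M) x : posdef (gram g x).
Proof. by split; [exact: gram_sym|exact: gram_pos]. Qed.

Lemma sqrt_gram_gt0 M (g : riemannian_metric M) x : 0 < Num.sqrt (\det (gram g x)).
Proof. by rewrite sqrtr_gt0; exact: posdef_det_gt0 (gram_posdef g x). Qed.

Definition chart_density M (g : riemannian_metric M) (c : chart R n M) (x : M) : R :=
  Num.sqrt (\det (gram_in g c x)).

Lemma chart_densityE M (g : riemannian_metric M) (c : chart R n M) (x : M) :
  chart_density g c x = `|\det (frame c x)| * Num.sqrt (\det (gram g x)).
Proof.
rewrite /chart_density /gram_in !det_mulmx det_tr mulrC mulrA -expr2.
by rewrite sqrtrM ?sqr_ge0 // sqrtr_sqr.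
Qed.

Lemma chart_density_gt0 M (g : riemannian_metric M) (c : chart R n M) (x : M) :
  atlas c -> cdom c x -> 0 < chart_density g c x.
Proof.
move=> ac cx; rewrite chart_densityE mulr_gt0 ?sqrtr_gt0 ?posdef_det_gt0 //.
  by rewrite normr_gt0 -unitfE -unitmxE frame_unit.
exact: gram_posdef.
Qed.

Lemma continuous_chart_density M (g : riemannian_metric M) (c : chart R n M) x :
  atlas c -> cdom c x ->
  {for x, continuous (fun y => chart_density g c y)}.
Proof.
move=> ac cx; have hc := atlas_chart ac.
have cG := gram_smooth g ac 0%N _ (imageP (cmap c) cx).
have h1 := cvg_comp _ _ (cmap_continuous hc cx) cG.
have h2 := cvg_comp _ _ h1 (@continuous_det R n _).
have h3 := cvg_comp _ _ h2 (@sqrt_continuous R _).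
have E y : cdom c y -> chart_density g c y =
    (Num.sqrt \o ((fun A : 'M[R]_n => \det A) \o
    ((fun a => frame c (cinv c a) *m gram g (cinv c a) *m (frame c (cinv c a))^T)
      \o cmap c))) y.
  by move=> cy; rewrite /= (cmapK hc cy).
suff h : (fun y => chart_density g c y) @ x --> (Num.sqrt \o ((fun A : 'M[R]_n => \det A) \o
    ((fun a => frame c (cinv c a) *m gram g (cinv c a) *m (frame c (cinv c a))^T)
      \o cmap c))) x by rewrite -E in h.
apply: cvg_trans h3; apply: near_eq_cvg.
have : nbhs x (cdom c) by apply: open_nbhs_nbhs; split => //; exact: open_cdom.
by apply: filterS => y cy; rewrite E.
Qed.

Section bounds.
Variables (M : manifold R n) (g : riemannian_metric M).
Variables (mu : {measure set (borel M) -> \bar R}) (hmu : riemannian_volume g mu).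
Variables (c : chart R n M) (A : set (borel M)) (K : R).
Hypotheses (ac : atlas c) (mA : measurable A) (Ac : A `<=` cdom c) (K0 : 0 <= K).
Local Open Scope ereal_scope.

Let D : set (n.-tuple (measurableTypeR R)) :=
  [set t | (cmap c @` A) (row_of_tuple t)].

Let mD : measurable D.
Proof.
have := @measurable_row_of_tuple R n.
move=> /(_ measurableT _ (measurable_chart_image ac Ac mA)).
by rewrite setTI.
Qed.

Let cinvD t : D t -> A (cinv c (row_of_tuple t)).
Proof.
case=> x Ax <-; rewrite (cmapK (atlas_chart ac)) //; exact: Ac.
Qed.

Lemma volume_upper_bound : (forall x, A x -> (chart_density g c x <= K)%R) ->
  mu A <= K%:E * L (cmap c @` A).
Proof.
move=> AK; rewrite (hmu ac mA Ac).
apply: (@le_trans _ _ (\int[lebesgue_n R n]_(t in D) cst K%:E t)).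
  apply: lower_integral_le => t Dt; first by rewrite lee_fin sqrtr_ge0.
  by rewrite lee_fin; apply: AK; exact: cinvD.
by rewrite integral_cst.
Qed.

Lemma volume_lower_bound : (forall x, A x -> (K <= chart_density g c x)%R) ->
  K%:E * L (cmap c @` A) <= mu A.
Proof.
move=> AK; rewrite (hmu ac mA Ac).
apply: (@le_trans _ _ (\int[lebesgue_n R n]_(t in D) cst K%:E t)).
  by rewrite integral_cst.
apply: lower_integral_le => t Dt; first by rewrite lee_fin.
by rewrite lee_fin; apply: AK; exact: cinvD.
Qed.

End bounds.

(** The Jacobian determinant of [f] with respect to the two volume forms, that
    is, its determinant in orthonormal bases. *)
Definition volume_ratio M N (gM : riemannian_metric M) (gN : riemannian_metric N)
    (f : M -> N) (x : M) : R :=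
  `|\det (tangent_map f x)| * Num.sqrt (\det (gram gN (f x))) /
    Num.sqrt (\det (gram gM x)).

Lemma volume_ratio_chart M N (gM : riemannian_metric M) (gN : riemannian_metric N)
    (f : M -> N) c c' x : smooth_map f -> atlas c -> atlas c' ->
  cdom c x -> cdom c' (f x) ->
  volume_ratio gM gN f x =
  `|\det ('J (cmap c' \o f \o cinv c) (cmap c x))| * chart_density gN c' (f x)
    / chart_density gM c x.
Proof.
move=> sf ac ac' cx c'fx; rewrite /volume_ratio !chart_densityE.
have E : \det (frame c x) * \det (tangent_map f x) =
    \det ('J (cmap c' \o f \o cinv c) (cmap c x)) * \det (frame c' (f x)).
  exact: etrans (esym (det_mulmx _ _))
    (etrans (congr1 determinant (tangent_map_chart sf ac ac' cx c'fx)) (det_mulmx _ _)).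
have F0 : \det (frame c x) != 0.
  by have := frame_unit ac cx; rewrite unitmxE unitfE.
have G0 : Num.sqrt (\det (gram gM x)) != 0 by exact: lt0r_neq0 (sqrt_gram_gt0 gM x).
have alg (a b u v r s : R) : a * b = u * v -> a != 0 -> r != 0 ->
    `|b| * s / r = `|u| * (`|v| * s) / (`|a| * r).
  move=> abuv a0 r1; have -> : `|u| * (`|v| * s) = `|a| * `|b| * s.
    by rewrite mulrA -!normrM abuv.
  by field; rewrite normr_eq0 a0 r1.
exact: alg E F0 G0.
Qed.

Lemma near_density_estimates (X : topologicalType) (x0 : X) (j a b : X -> R)
    (theta : R) : 1 < theta -> 0 < j x0 -> 0 < a x0 -> 0 < b x0 ->
  {for x0, continuous j} -> {for x0, continuous a} -> {for x0, continuous b} ->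
  \forall x \near x0, [/\ a x0 / theta < a x, b x < theta * b x0 &
    j x0 * b x0 / a x0 / theta < j x * b x / a x].
Proof.
move=> th1 j0 a0 b0 cj ca cb; have th0 : 0 < theta by apply: lt_trans th1.
have lt_div (r : R) : 0 < r -> r / theta < r.
  by move=> r0; rewrite ltr_pdivrMr // ltr_pMr.
have J0 : 0 < j x0 * b x0 / a x0 by rewrite divr_gt0 // mulr_gt0.
have cJ : {for x0, continuous (fun x => j x * b x / a x)}.
  exact: (continuousM (continuousM cj cb) (continuousV (lt0r_neq0 a0) ca)).
have n1 : \forall x \near x0, a x0 / theta < a x.
  exact: (cvgr_gt _ ca _ (lt_div _ a0)).
have n2 : \forall x \near x0, b x < theta * b x0.
  by apply: (cvgr_lt _ cb); rewrite ltr_pMl.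
have n3 : \forall x \near x0, j x0 * b x0 / a x0 / theta < j x * b x / a x.
  exact: (cvgr_gt _ cJ _ (lt_div _ J0)).
by apply: filterS3 n1 n2 n3 => x ? ? ?; split.
Qed.

Lemma distortion_chain (theta j a b : R) (mN mM l l' : \bar R) :
  0 < theta -> 0 < j -> 0 < a -> 0 < b ->
  (mN <= (theta * b)%:E * l')%E -> (l' <= (theta * j)%:E * l)%E ->
  ((a / theta)%:E * l <= mM)%E ->
  (mN <= (theta ^+ 3 * (j * b / a))%:E * mM)%E.
Proof.
move=> th0 j0 a0 b0 up mid lo; apply: le_trans up _.
have k0 : 0 <= theta * b by rewrite mulr_ge0 // ltW.
apply: (@le_trans _ _ ((theta * b)%:E * ((theta * j)%:E * l))%E).
  by apply: lee_wpmul2l.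
have -> : theta ^+ 3 * (j * b / a) = (theta * b) * (theta * j) * (theta / a).
  by field; rewrite gt_eqF.
rewrite muleA -EFinM.
rewrite [X in (_ <= X * _)%E](EFinM (theta * b * (theta * j)) (theta / a)).
rewrite -[X in (_ <= X)%E]muleA; apply: lee_wpmul2l.
  by rewrite lee_fin mulr_ge0 // mulr_ge0 // ltW.
have q0 : 0 < theta / a by rewrite divr_gt0.
by rewrite -lee_pdivrMl // invf_div.
Qed.

Lemma distortion_slack (theta J y : R) : 0 < theta -> J / theta < y ->
  theta ^+ 3 * J <= theta ^+ 4 * y.
Proof.
move=> th0; rewrite ltr_pdivrMr // => /ltW h.
by rewrite [theta ^+ 4]exprSr -mulrA [theta * _]mulrC ler_wpM2l // exprn_ge0 // ltW.
Qed.

(** Near a point a diffeomorphism multiplies volumes by at most slightly more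
    than its Jacobian there: in charts it is a nearly linear map between
    nearly constant densities. The four factors [theta] account for the
    variation of the linear part, of both densities and of the Jacobian. *)
Lemma volume_distortion_local M N (gM : riemannian_metric M) (gN : riemannian_metric N)
    (muM : {measure set (borel M) -> \bar R}) (muN : {measure set (borel N) -> \bar R})
    (phi : diffeo M N) (e : R) (x0 : M) :
  riemannian_volume gM muM -> riemannian_volume gN muN -> 0 < e ->
  exists V : set M, [/\ open V, V x0 & exists t : R, [/\ 0 <= t,
    forall A : set (borel M), measurable A -> A `<=` V ->
      (muN (phi @` A) <= t%:E * muM A)%E &
    forall x, V x -> t <= (1 + e) * volume_ratio gM gN phi x]].
Proof.
move=> hM hN e0.
set c := chart_at x0; set c' := chart_at (phi x0).
have ac : atlas c by exact: chart_at_atlas.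
have ac' : atlas c' by exact: chart_at_atlas.
have hc := atlas_chart ac; have hc' := atlas_chart ac'.
have cx0 : cdom c x0 by exact: chart_at_dom.
have c'x0 : cdom c' (phi x0) by exact: chart_at_dom.
pose psi := Defs.dinv phi.
have [cphi sphi] := @dfun_smooth _ _ _ _ phi; have [cpsi spsi] := @dinv_smooth _ _ _ _ phi.
have phiK : cancel phi psi by exact: dfunK.
have psiK : cancel psi phi by exact: dinvK.
pose dom := cdom c `&` phi @^-1` cdom c'.
have opre (B : set N) : open B -> open (phi @^-1` B) by move/continuousP: cphi; apply.
have opre' (B : set M) : open B -> open (psi @^-1` B) by move/continuousP: cpsi; apply.
have odom : open dom by apply: openI; [|apply: opre]; exact: open_cdom.
have domx0 : dom x0 by split.
pose U := cmap c @` (cdom c `&` phi @^-1` cdom c').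
pose U' := cmap c' @` (cdom c' `&` psi @^-1` cdom c).
pose F := cmap c' \o phi \o cinv c; pose H := cmap c \o psi \o cinv c'.
have oU : open U by apply: chart_image_open => //; apply: opre; exact: open_cdom.
have oU' : open U' by apply: chart_image_open => //; apply: opre'; exact: open_cdom.
have FK a : U a -> U' (F a) /\ H (F a) = a.
  move=> [x [cx c'x] <-]; rewrite /F /H /= (cmapK hc cx) (cmapK hc' c'x) phiK.
  by split => //; exists (phi x) => //; split => //; rewrite /= phiK.
have HK b : U' b -> U (H b) /\ F (H b) = b.
  move=> [y [c'y cy] <-]; rewrite /F /H /= (cmapK hc' c'y) (cmapK hc cy) psiK.
  by split => //; exists (psi y) => //; split => //; rewrite /= psiK.
have cF1 : Cr_on 1 U F by exact: (sphi c c' ac ac' 1%N).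
have cH b : U' b -> {for b, continuous H} by exact: (spsi c' c ac' ac 0%N).
pose jac x := `|\det ('J F (cmap c x))|.
have JE x : dom x -> volume_ratio gM gN phi x =
    jac x * chart_density gN c' (phi x) / chart_density gM c x.
  by move=> [cx c'x]; rewrite (volume_ratio_chart _ _ (@dfun_smooth _ _ _ _ phi) ac ac').
have Ju : 'J F (cmap c x0) \in unitmx.
  have := tangent_map_chart (@dfun_smooth _ _ _ _ phi) ac ac' cx0 c'x0.
  have Tu : tangent_map phi x0 \in unitmx.
    exact: (mulmx1_unit (@tangent_map_comp_id R n M N phi psi x0
      (@dfun_smooth _ _ _ _ phi) (@dinv_smooth _ _ _ _ phi) phiK)).1.
  have unit_factor (A B A' B' : 'M[R]_n) : A *m B = A' *m B' -> A \in unitmx ->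
      B \in unitmx -> A' \in unitmx.
    move=> E Au Bu; have : A *m B \in unitmx by rewrite unitmx_mul Au.
    by rewrite E unitmx_mul => /andP[].
  move=> E; exact: unit_factor E (frame_unit ac cx0) Tu.
have j0 : 0 < jac x0 by rewrite normr_gt0 -unitfE -unitmxE.
have r0 : 0 < chart_density gM c x0 by exact: chart_density_gt0.
have r0' : 0 < chart_density gN c' (phi x0) by exact: chart_density_gt0.
pose theta := Num.sqrt (Num.sqrt (1 + e)).
have th4 : theta ^+ 4 = 1 + e.
  by rewrite (exprM _ 2 2) !sqr_sqrtr ?sqrtr_ge0 // addr_ge0 // ltW.
have th0 : 0 < theta by rewrite !sqrtr_gt0 addr_gt0.
have th1 : 1 < theta.
  by rewrite -(ltr_pXn2r (_ : 0 < 4)%N) ?nnegrE ?ltW // expr1n th4 ltrDl.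
have jt : jac x0 < theta * jac x0 by rewrite ltr_pMl.
have [V1 [oV1 V1a V1U distV1]] :=
  local_volume_distortion oU oU' cF1 FK HK cH (imageP (cmap c) domx0) Ju jt.
have cjac : {for x0, continuous jac}.
  have h1 := cvg_comp _ _ (cmap_continuous hc cx0) (jacobian_continuous oU cF1 (imageP (cmap c) domx0)).
  have h2 := cvg_comp _ _ h1 (@continuous_det R n _).
  exact: (cvg_comp _ _ h2 (@norm_continuous R R _)).
have cdM := @continuous_chart_density M gM c x0 ac cx0.
have cdN : {for x0, continuous (fun x => chart_density gN c' (phi x))}.
  exact: (cvg_comp _ _ (cphi x0) (@continuous_chart_density N gN c' (phi x0) ac' c'x0)).
have nd := near_density_estimates th1 j0 r0 r0' cjac cdM cdN.
have n1 : \forall x \near x0, V1 (cmap c x).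
  by apply: (cmap_continuous hc cx0); exact: open_nbhs_nbhs.
have n2 : nbhs x0 dom by exact: open_nbhs_nbhs.
pose W : set M := [set x | [/\ V1 (cmap c x), dom x &
  [/\ chart_density gM c x0 / theta < chart_density gM c x,
   chart_density gN c' (phi x) < theta * chart_density gN c' (phi x0) &
   jac x0 * chart_density gN c' (phi x0) / chart_density gM c x0 / theta <
     jac x * chart_density gN c' (phi x) / chart_density gM c x]]].
have nW : nbhs x0 W by apply: filterS3 n1 n2 nd => x ? ? ?; split.
have WV x : interior W x -> W x by move=> /interior_subset.
exists (interior W); split; [exact: open_interior|exact: nW|].
exists (theta ^+ 3 * (jac x0 * chart_density gN c' (phi x0) / chart_density gM c x0)).
have th30 : 0 <= theta ^+ 3 := exprn_ge0 3 (ltW th0).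
split.
- exact: mulr_ge0 th30 (ltW (divr_gt0 (mulr_gt0 j0 r0') r0)).
- move=> A mA AW.
  have Ac : A `<=` cdom c by move=> x /AW/WV[_ []].
  have Ac' : phi @` A `<=` cdom c' by move=> _ [x /AW/WV[_ [_ c'x] _] <-].
  have AE : phi @` A = psi @^-1` A.
    apply/seteqP; split => [_ [x Ax <-]|y Ay]; first by rewrite /= phiK.
    by exists (psi y).
  have mphiA : measurable (phi @` A : set (borel N)).
    rewrite AE; have := @continuous_on_borel N M setT psi openT (fun y _ => cpsi y).
    by move=> /(_ measurableT _ mA); rewrite setTI.
  have imE : cmap c' @` (phi @` A) = F @` (cmap c @` A).
    apply/seteqP; split => [_ [_ [x Ax <-] <-]|_ [_ [x Ax <-] <-]].
      by exists (cmap c x); [exists x|rewrite /F /= (cmapK hc (Ac _ Ax))].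
    by exists (phi x); [exists x|rewrite /F /= (cmapK hc (Ac _ Ax))].
  apply: (distortion_chain th0 j0 r0 r0' (l := L (cmap c @` A))
    (l' := L (cmap c' @` (phi @` A)))).
  + apply: (volume_upper_bound hN ac' mphiA Ac').
    by move=> _ [x /AW/WV[_ _ [_ h _]] <-]; exact: ltW h.
  + rewrite imE; apply: distV1; first exact: measurable_chart_image ac Ac mA.
    by move=> _ [x /AW/WV[h _ _] <-]; exact: h.
  + apply: (volume_lower_bound hM ac mA Ac); first exact: divr_ge0 (ltW r0) (ltW th0).
    by move=> x /AW/WV[_ _ [h _ _]]; exact: ltW h.
- move=> x /WV[_ domx [_ _ h]]; rewrite (JE x domx) -th4.
  exact: distortion_slack th0 h.
Qed.

End riemannian_volume.

(** * Volume distortion by a diffeomorphism *)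

Section global_distortion.
Variables (R : realType) (n : nat) (M N : manifold R n).
Variables (gM : riemannian_metric M) (gN : riemannian_metric N).
Variables (muM : {measure set (borel M) -> \bar R}).
Variables (muN : {measure set (borel N) -> \bar R}).
Hypotheses (hmuM : riemannian_volume gM muM) (hmuN : riemannian_volume gN muN).
Variable phi : diffeo M N.

Lemma measurable_diffeo : measurable_fun setT (phi : borel M -> borel N).
Proof.
have [cphi _] := @dfun_smooth _ _ _ _ phi.
exact: (@continuous_on_borel M N setT phi openT (fun x _ => cphi x)).
Qed.

Lemma image_diffeo (A : set M) : phi @` A = Defs.dinv phi @^-1` A.
Proof.
apply/seteqP; split => [_ [x Ax <-]|y Ay]; first by rewrite /= dfunK.
by exists (Defs.dinv phi y) => //; exact: dinvK.
Qed.

Lemma measurable_image_diffeo (A : set (borel M)) : measurable A ->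
  measurable (phi @` A : set (borel N)).
Proof.
move=> mA; rewrite image_diffeo.
have [cpsi _] := @dinv_smooth _ _ _ _ phi.
have := @continuous_on_borel N M setT (Defs.dinv phi) openT (fun y _ => cpsi y).
by move=> /(_ measurableT _ mA); rewrite setTI.
Qed.

Definition distortion_on (e : R) (V : set M) (t : R) := [/\ 0 <= t,
    forall A : set (borel M), measurable A -> A `<=` V ->
      (muN (phi @` A) <= t%:E * muM A)%E &
    forall x, V x -> t <= (1 + e) * volume_ratio gM gN phi x].

Lemma distortion_on_sub e V V' t : V' `<=` V -> distortion_on e V t ->
  distortion_on e V' t.
Proof.
move=> V'V [t0 Vt tJ]; split => //; last by move=> x /V'V/tJ.
by move=> A mA AV'; apply: Vt => //; exact: subset_trans AV' V'V.
Qed.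

(** The Lindelof argument: those members of a countable basis on which the
    estimate holds with some constant already cover, as the estimate passes to
    subsets. *)
Lemma countable_distortion_cover (e : R) : 0 < e ->
  exists (U : (set M)^nat) (t : nat -> R),
    [/\ forall i, open (U i), forall i, distortion_on e (U i) (t i) &
        \bigcup_i U i = setT].
Proof.
move=> e0; have [B cB [Bo bB]] := @manifold_second_countable R n M.
have /countable_injP[f finj] := cB.
pose good V := exists t, distortion_on e V t.
have good0 : good set0.
  exists 0; split => // A mA; rewrite subset0 => ->.
  by rewrite image_set0 !measure0 mule0.
pose P i V := [/\ B V, good V & f V = i].
pose U i : set M := if pselect (exists V, P i V) is left h then projT1 (cid h) else set0.
have gU i : good (U i).
  by rewrite /U; case: pselect => // h; have [] := projT2 (cid h).
have oU i : open (U i).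
  rewrite /U; case: pselect => [h|_]; last exact: open0.
  by have [BV _ _] := projT2 (cid h); exact: Bo.
have /choice[t tP] := gU.
exists U, t; split => //; rewrite -subTset => x _.
have [V [oV Vx [s sP]]] := volume_distortion_local phi x hmuM hmuN e0.
have [W [BW Wx] WV] := bB x V (open_nbhs_nbhs (conj oV Vx)).
have gW : good W by exists s; exact: distortion_on_sub WV sP.
exists (f W) => //; rewrite /U; case: pselect => [h|[]]; last by exists W.
have [BV' _ fE] := projT2 (cid h).
by rewrite (finj (projT1 (cid h)) W) ?inE.
Qed.

(** Gluing the local estimates along a countable Borel partition; the constants of
    the pieces form a measurable density that is almost the Jacobian. *)
Lemma distortion_density (e : R) : 0 < e ->
  exists tau : borel M -> \bar R, [/\ measurable_fun setT tau,
    forall x, (0 <= tau x)%E,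
    forall x, (tau x <= ((1 + e) * volume_ratio gM gN phi x)%:E)%E &
    forall B : set (borel N), measurable B ->
      (muN B <= \int[muM]_(x in phi @^-1` B) tau x)%E].
Proof.
move=> e0; have [U [t [oU Ut covU]]] := countable_distortion_cover e0.
pose A : (set (borel M))^nat := seqDU U.
have mU i : measurable (U i : set (borel M)) by apply: sub_sigma_algebra; exact: oU.
have mA i : measurable (A i).
  by apply: measurableD => //; apply: bigsetU_measurable => j _; exact: mU.
have covA : \bigcup_i A i = setT by rewrite -seqDU_bigcup_eq.
have triv : trivIset setT A by exact: trivIset_seqDU.
have AU i : A i `<=` U i by move=> x [].
have exA x : exists i, A i x.
  have [i _ Ai] : (\bigcup_i A i) x by rewrite covA.
  by exists i.
pose idx x := projT1 (cid (exA x)).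
have Aidx x : A (idx x) x by exact: projT2 (cid (exA x)).
have idxE i x : A i x -> idx x = i.
  by move=> Ax; apply: (triv (idx x) i I I); exists x; split.
pose tau (x : borel M) : \bar R := (t (idx x))%:E.
have tau0 x : (0 <= tau x)%E by rewrite lee_fin; have [] := Ut (idx x).
have mtau : measurable_fun setT tau.
  rewrite -covA; apply/measurable_fun_bigcup => // i.
  apply: (@eq_measurable_fun _ _ _ _ _ (cst (t i)%:E)); last exact: measurable_cst.
  by move=> x /set_mem Ax; rewrite /tau (idxE i).
exists tau; split => //.
  by move=> x; rewrite lee_fin; have [_ _] := Ut (idx x); apply; exact: AU.
move=> B mB.
have mpB : measurable (phi @^-1` B : set (borel M)).
  by rewrite -[X in measurable X]setTI; exact: measurable_diffeo.
pose F i := A i `&` (phi @^-1` B).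
have mF i : measurable (F i) by exact: measurableI.
have FB : \bigcup_i F i = phi @^-1` B by rewrite -setI_bigcupl covA setTI.
have trivF : trivIset setT F.
  by move=> i j _ _ [x [[Ai _] [Aj _]]]; apply: (triv i j I I); exists x.
have mphiF i : measurable (phi @` F i : set (borel N)) by exact: measurable_image_diffeo.
apply: (@le_trans _ _ (\sum_(0 <= i <oo) muN (phi @` F i))%E).
  apply: measure_sigma_subadditive => // y By.
  have : (\bigcup_i F i) (Defs.dinv phi y) by rewrite FB /= dinvK.
  by move=> [i _ Fi]; exists i => //; exists (Defs.dinv phi y) => //; exact: dinvK.
rewrite -FB ge0_integral_bigcup //; last first.
  by apply: measurable_funS mtau => //; exact: bigcup_measurable.
apply: lee_nneseries => // i _.
rewrite (_ : (\int[muM]_(x in F i) tau x)%E = (\int[muM]_(x in F i) cst (t i)%:E x)%E).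
  rewrite integral_cst //; have [_ + _] := Ut i; apply => //.
  exact: subset_trans (@subIsetl _ _ _) (AU i).
by apply: eq_integral => x /set_mem[Ax _]; rewrite /tau (idxE i).
Qed.

Lemma diffeo_null_image (Z : set (borel M)) : measurable Z -> muM Z = 0%E ->
  muN (phi @` Z) = 0%E.
Proof.
move=> mZ Z0; have [tau [mtau tau0 _ tauP]] := distortion_density ltr01.
apply/eqP; rewrite eq_le measure_ge0 andbT.
apply: le_trans (tauP _ (measurable_image_diffeo mZ)) _.
rewrite (_ : phi @^-1` (phi @` Z) = Z); last first.
  apply/seteqP; split => [x [x' Zx' /(can_inj (@dfunK _ _ _ _ phi)) <-//]|x Zx].
  by exists x.
by rewrite (null_set_integral mZ) //; apply: measurable_funS mtau.
Qed.

End global_distortion.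

(** * Comparison of norms of functions *)

Section norm_transfer.
Variables (R : realType) (n : nat) (M N : manifold R n).
Variables (gM : riemannian_metric M) (gN : riemannian_metric N).
Variables (muM : {measure set (borel M) -> \bar R}).
Variables (muN : {measure set (borel N) -> \bar R}).
Hypotheses (hmuM : riemannian_volume gM muM) (hmuN : riemannian_volume gN muN).
Variable phi : diffeo M N.
Local Notation J := (volume_ratio gM gN phi).

Lemma volume_ratio_ge0 x : 0 <= J x.
Proof. by rewrite /volume_ratio divr_ge0 ?sqrtr_ge0 // mulr_ge0 ?sqrtr_ge0. Qed.

Lemma lee_mul1D_all (a b : \bar R) : (0 <= b)%E ->
  (forall e : R, 0 < e -> (a <= (1 + e)%:E * b)%E) -> (a <= b)%E.
Proof.
move=> b0 h; move: b b0 h => [b||] b0 h //; last by rewrite leey.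
apply/lee_addgt0Pr => e e0.
have b1 : 0 < b + 1 by rewrite ltr_wpDl.
apply: le_trans (h (e / (b + 1)) _) _; first by rewrite divr_gt0.
rewrite -EFinM -EFinD lee_fin mulrDl mul1r lerD2l mulrAC ler_pdivrMr //.
by rewrite ler_pM2l // lerDl.
Qed.

(** The density of the glued estimate exceeds the Jacobian by a factor [1 + e] only,
    and [e] is arbitrary. *)
Lemma diffeo_lower_integral_le (F : N -> R) (G : M -> R) :
  (forall y, 0 <= F y) -> (forall x, 0 <= G x) ->
  {ae muM, forall x : borel M, J x * F (phi x) <= G x} ->
  ((\int[muN]_y (F y)%:E) <= (\int[muM]_x (G x)%:E))%E.
Proof.
move=> F0 G0 FG; apply: lee_mul1D_all.
  by apply: integral_ge0 => x _; rewrite lee_fin.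
move=> e e0; have [tau [mtau tau0 tauJ tauP]] := distortion_density hmuM hmuN phi e0.
have e1 : 0 < 1 + e by rewrite addr_gt0.
apply: (le_trans _ (lower_integral_scale _ e1 _)); last by move=> x; rewrite lee_fin.
apply: (lower_integral_transfer (measurable_diffeo phi) mtau tau0 tauP).
- by move=> y; rewrite lee_fin.
- by move=> x; rewrite -EFinM lee_fin mulr_ge0 // ltW.
- apply: filterS FG => x FGx.
  apply: (@le_trans _ _ (((1 + e) * J x)%:E * (F (phi x))%:E)%E).
    by apply: lee_wpmul2r; rewrite ?lee_fin //; exact: tauJ.
  by rewrite -!EFinM lee_fin -mulrA ler_wpM2l // ltW.
Qed.

Lemma diffeo_ae (P : M -> Prop) : {ae muM, forall x : borel M, P x} ->
  {ae muN, forall y : borel N, P (Defs.dinv phi y)}.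
Proof.
move=> [Z [mZ Z0 PZ]]; exists (phi @` Z); split.
- exact: measurable_image_diffeo.
- exact: (diffeo_null_image hmuM hmuN phi mZ Z0).
- move=> y /= nP; exists (Defs.dinv phi y); last exact: dinvK.
  by apply: PZ.
Qed.

(** A pointwise inequality weighted by the [p]-th root of the Jacobian becomes an
    inequality of [L^p] norms; for infinite [p] the weight is [1] and it is
    enough that null sets go to null sets. *)
Lemma diffeo_Lnorm_le (p : \bar R) (u : N -> R) (v : M -> R) (C : R) :
  (1 <= p)%E -> 0 < C -> (forall y, 0 <= u y) -> (forall x, 0 <= v x) ->
  {ae muM, forall x : borel M, J x `^ inv_exp p * u (phi x) <= C * v x} ->
  (Lnorm muN p (fun y : borel N => (u y)%:E) <=
   C%:E * Lnorm muM p (fun x : borel M => (v x)%:E))%E.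
Proof.
move=> p1 C0 u0 v0 h; rewrite unlock; case: p p1 h => [r r1 h|_ h|//].
  rewrite lee_fin in r1.
  have r0 : 0 < r by apply: lt_le_trans r1.
  have rn0 : r != 0 by rewrite gt_eqF.
  have pinv : inv_exp r%:E = r^-1 by rewrite /inv_exp inver (negbTE rn0).
  have normE (T : Type) (f : T -> R) : (forall x, 0 <= f x) ->
      (fun x => `|(f x)%:E| `^ r)%E = (fun x => (f x `^ r)%:E).
    by move=> f0; apply/funext => x; rewrite /= ger0_norm.
  rewrite !normE //.
  have le_int : ((\int[muN]_y (u y `^ r)%:E) <= (C `^ r)%:E * (\int[muM]_x (v x `^ r)%:E))%E.
    apply: (le_trans _ (lower_integral_scale _ (powR_gt0 r C0) _)); last first.
      by move=> x; rewrite lee_fin powR_ge0.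
    under [X in (_ <= X)%E]eq_integral do rewrite -EFinM.
    apply: diffeo_lower_integral_le => [y|x|]; rewrite ?mulr_ge0 ?powR_ge0 //.
    apply: filterS h => x; rewrite pinv => h.
    have : (J x `^ r^-1 * u (phi x)) `^ r <= (C * v x) `^ r.
      by rewrite ge0_ler_powR ?nnegrE ?mulr_ge0 ?powR_ge0 ?(ltW r0) // ltW.
    have JE : (J x `^ r^-1) `^ r = J x.
      by rewrite -powRrM mulVf // powRr1 //; exact: volume_ratio_ge0.
    rewrite [in X in X <= _]powRM ?powR_ge0 // [in X in _ <= X]powRM ?(ltW C0) //.
    by rewrite JE.
  have ri0 : 0 <= r^-1 by rewrite invr_ge0 ltW.
  apply: le_trans (gt0_ler_poweR ri0 _ _ le_int) _.
  - by rewrite in_itv /= leey andbT; apply: integral_ge0 => y _; rewrite lee_fin powR_ge0.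
  - rewrite in_itv /= leey andbT mule_ge0 ?lee_fin ?powR_ge0 //.
    by apply: integral_ge0 => y _; rewrite lee_fin powR_ge0.
  rewrite poweRM ?lee_fin ?powR_ge0 //; last first.
    by apply: integral_ge0 => y _; rewrite lee_fin powR_ge0.
  by rewrite poweR_EFin -powRrM mulfV // powRr1 // ltW.
have pinv : inv_exp (+oo%E : \bar R) = 0 by rewrite /inv_exp invey.
case: ifPn => [muN0|_]; last first.
  case: ifPn => [muM0|]; last by rewrite mule0.
  rewrite mule_ge0 ?lee_fin ?(ltW C0) //.
  by apply: ess_sup_gee => //; apply: nearW => x /=; rewrite lee_fin.
have muM0 : (0 < muM setT)%E.
  rewrite lt_def measure_ge0 andbT; apply/eqP => muM0.
  have := diffeo_null_image hmuM hmuN phi measurableT muM0.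
  rewrite (_ : phi @` setT = setT) => [muN0'|]; first by rewrite muN0' ltxx in muN0.
  by rewrite image_diffeo.
rewrite muM0; apply/ess_supP.
have := ess_sup_ge muM (fun x : borel M => `|(v x)%:E|%E).
set b := ess_sup _ _ => vb.
have : {ae muM, forall x : borel M, ((u (phi x))%:E <= C%:E * b)%E}.
  apply: filterS2 h vb => x; rewrite pinv powRr0 mul1r => h.
  rewrite /= ger0_norm // => vxb.
  apply: (@le_trans _ _ (C * v x)%:E); first by rewrite lee_fin.
  by rewrite EFinM lee_wpmul2l // lee_fin ltW.
move=> /(@diffeo_ae (fun x => ((u (phi x))%:E <= C%:E * b)%E)).
by apply: filterS => y; rewrite dinvK /= ger0_norm.
Qed.

End norm_transfer.

(** * Forms and singular values at a point *)

Section singular_values_of_diffeomorphisms.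
Variables (R : realType) (n : nat).
Implicit Types M N : manifold R n.

Lemma kform_alternating M k (w : M -> 'M[R]_(k, n) -> R) x :
  kform w -> alternating_form (w x).
Proof.
move=> /(_ x)[wL wA]; split=> [X Y Z i a b XYZ YX ZX|X i j ij Xij].
  apply: (wL X Y Z i).
  - by apply/rowP => j; rewrite !mxE.
  - by apply/matrixP => i' j; rewrite !mxE YX // eq_sym neq_lift.
  - by apply/matrixP => i' j; rewrite !mxE ZX // eq_sym neq_lift.
by apply: (wA X i j ij); apply/rowP => l; rewrite !mxE.
Qed.

Lemma alternating_form_mulmxr k (u : 'M[R]_(k, n) -> R) (S : 'M[R]_n) :
  alternating_form u -> alternating_form (fun X => u (X *m S)).
Proof.
move=> [uL uA]; split=> [X Y Z i a b XYZ YX ZX|X i j ij Xij].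
  apply: (uL _ _ _ i) => [j|i' j ii|i' j ii].
  - rewrite !mxE !mulr_sumr -big_split /=; apply: eq_bigr => l _.
    by rewrite XYZ; ring.
  - by rewrite !mxE; apply: eq_bigr => l _; rewrite YX.
  - by rewrite !mxE; apply: eq_bigr => l _; rewrite ZX.
by apply: (uA _ i j ij) => l; rewrite !mxE; apply: eq_bigr => l' _; rewrite Xij.
Qed.

Lemma spectral_normE M k (g : riemannian_metric M) (w : M -> 'M[R]_(k, n) -> R) x :
  spectral_norm g w x = form_norm (gram g x) (w x).
Proof. by []. Qed.

(** If an orthonormal basis is negatively oriented, the sign of its first
    vector is changed. *)
Lemma positive_orthonormal_basis M (o : orientation M) (g : riemannian_metric M)
    (x : M) : (0 < n)%N ->
  exists B, positive_basis o x B /\ orthonormal_basis g x B.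
Proof.
case: n M o g x => // m M o g x _.
have [B BG] := posdef_orthonormal (gram_posdef g x).
have Bu : B \in unitmx by have /mulmx1_unit[] : B *m (gram g x *m B^T) = 1%:M by rewrite mulmxA.
have dB : (-1) ^+ Defs.oneg o x * \det B != 0.
  by rewrite mulf_neq0 ?signr_eq0 // -unitfE -unitmxE.
have [Bp|Bn] := boolP (positive_basis o x B); first by exists B.
pose D : 'M[R]_m.+1 := diag_mx (\row_i (if i == 0 then -1 else 1)).
have dD : \det D = -1.
  rewrite det_diag big_ord_recl mxE eqxx big1 ?mulr1 // => i _.
  by rewrite mxE.
have DD : D *m D^T = 1%:M.
  rewrite tr_diag_mx mulmx_diag -diag_const_mx; congr diag_mx; apply/rowP => i.
  by rewrite !mxE; case: ifP => _; rewrite ?mulrNN mulr1.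
exists (D *m B); split.
  rewrite /positive_basis /positive_for det_mulmx dD mulN1r mulrN oppr_gt0.
  by rewrite lt_def eq_sym dB /= leNgt.
rewrite /orthonormal_basis trmx_mul !mulmxA -(mulmxA D B) -(mulmxA D (B *m _)) BG.
by rewrite mulmx1.
Qed.

Variables (M N : manifold R n).
Variables (gM : riemannian_metric M) (gN : riemannian_metric N).
Variables (oM : orientation M) (oN : orientation N) (phi : diffeo M N).
Variable (alpha : M -> 'I_n -> R).
Hypothesis halpha : singular_values gM gN oM oN phi alpha.
Local Notation psi := (Defs.dinv phi).

(** In dimension 0 a point may have no positively oriented basis, but then
    every matrix is empty and there is nothing to prove. *)
Lemma singular_values_frames x : exists B C Phi : 'M[R]_n,
  [/\ B *m gram gM x *m B^T = 1%:M, C *m gram gN (phi x) *m C^T = 1%:M,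
      B *m tangent_map phi x = Phi^T *m C & matrix_singular_values Phi (alpha x)].
Proof.
have [n0|n0] := posnP n.
  have [B BG] := posdef_orthonormal (gram_posdef gM x).
  have [C CG] := posdef_orthonormal (gram_posdef gN (phi x)).
  have Cu : C \in unitmx.
    by have /mulmx1_unit[] : C *m (gram gN (phi x) *m C^T) = 1%:M by rewrite mulmxA.
  exists B, C, (B *m tangent_map phi x *m invmx C)^T; split => //.
    by rewrite trmxK mulmxKV.
  have no (i : 'I_n) : False by case: i => i; rewrite n0.
  split; [by move=> i; case: (no i)|by move=> i; case: (no i)|].
  move: (_^T *m _) => A; rewrite [RHS]big1 => [|i]; last by case: (no i).
  by rewrite /char_poly; move: (char_poly_mx A); rewrite n0 => A'; rewrite det_mx00.
have [B [Bp BG]] := positive_orthonormal_basis oM gM x n0.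
have [C [Cp CG]] := positive_orthonormal_basis oN gN (phi x) n0.
have Cu : C \in unitmx.
  by have /mulmx1_unit[] : C *m (gram gN (phi x) *m C^T) = 1%:M by rewrite mulmxA; exact: CG.
have E : B *m tangent_map phi x = ((B *m tangent_map phi x *m invmx C)^T)^T *m C.
  by rewrite trmxK mulmxKV.
exists B, C, (B *m tangent_map phi x *m invmx C)^T; split; [exact: BG|exact: CG|exact: E|].
exact: halpha Bp BG Cp CG E.
Qed.

Lemma tangent_map_dinv x :
  tangent_map phi x \in unitmx /\ tangent_map psi (phi x) = invmx (tangent_map phi x).
Proof.
have h := @tangent_map_comp_id R n M N phi psi x (@dfun_smooth _ _ _ _ phi)
  (@dinv_smooth _ _ _ _ phi) (@dfunK _ _ _ _ phi).
have inv_unique (A B : 'M[R]_n) : A *m B = 1%:M -> A \in unitmx /\ B = invmx A.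
  by move=> AB; have [Au _] := mulmx1_unit AB; split; rewrite // -[B](mulKmx Au) AB mulmx1.
exact: inv_unique h.
Qed.

Lemma volume_ratio_dinv y :
  volume_ratio gN gM psi y = (volume_ratio gM gN phi (psi y))^-1.
Proof.
rewrite -[y in LHS](dinvK phi y) /volume_ratio; have [_ ->] := tangent_map_dinv (psi y).
have -> : psi (phi (psi y)) = psi y by rewrite dfunK.
rewrite det_inv normfV.
have alg (a b c : R) : a^-1 * b / c = (a * c / b)^-1.
  by rewrite !invfM invrK mulrAC.
exact: alg.
Qed.

Variables (k : nat) (hk : (k <= n)%N) (w : M -> 'M[R]_(k, n) -> R).
Hypothesis wform : kform w.

(** At [phi x] the form [phi_* w] is the pullback of [w x] by the inverse of the
    tangent map, and [w x] is the pullback of [phi_* w] by the tangent map. *)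
Lemma pushforward_singular_bounds x :
  [/\ forall i, 0 < alpha x i,
      volume_ratio gM gN phi x = \prod_i alpha x i,
      spectral_norm gM w x <= (\prod_(i < n | (i < k)%N) alpha x i) *
         spectral_norm gN (pushforward_form phi w) (phi x) &
      spectral_norm gN (pushforward_form phi w) (phi x) <=
         (\prod_(i < n | (n - k <= i)%N) alpha x i)^-1 * spectral_norm gM w x].
Proof.
have [B [C [Phi [BG CG BT sv]]]] := singular_values_frames x.
have [Tu TE] := tangent_map_dinv x.
have [s0 dets le1 le2] := singular_value_gram_bounds hk BG CG BT Tu sv.
have pM := gram_posdef gM x; have pN := gram_posdef gN (phi x).
have wA := kform_alternating x wform.
have pE X : pushforward_form phi w (phi x) X = w x (X *m invmx (tangent_map phi x)).
  by rewrite /pushforward_form /pullback TE dfunK.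
have pA : alternating_form (pushforward_form phi w (phi x)).
  have -> : pushforward_form phi w (phi x) =
      (fun X => w x (X *m invmx (tangent_map phi x))) by apply/funext.
  exact: alternating_form_mulmxr.
have wE X : w x X = pushforward_form phi w (phi x) (X *m tangent_map phi x).
  by rewrite pE mulmxK.
have P0 (P : pred 'I_n) : 0 < \prod_(i < n | P i) alpha x i by apply: prodr_gt0.
split=> //.
- have sq_eq (a g g' t : R) : 0 <= a -> 0 < g -> 0 < g' -> a ^+ 2 * g = t ^+ 2 * g' ->
      `|t| * Num.sqrt g' / Num.sqrt g = a.
    move=> a0 g0 g'0 E; have sg : Num.sqrt g != 0 by rewrite gt_eqF ?sqrtr_gt0.
    apply: (canLR (mulfK sg)); rewrite -[RHS](ger0_norm (mulr_ge0 a0 (sqrtr_ge0 g))).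
    rewrite -[LHS]ger0_norm ?mulr_ge0 ?sqrtr_ge0 // -!sqrtr_sqr; congr Num.sqrt.
    by rewrite !exprMn !sqr_sqrtr ?(ltW g0) ?(ltW g'0) ?sqr_ge0 // E.
  have a0 : 0 <= \prod_i alpha x i by apply: prodr_ge0 => i _; exact: ltW (s0 i).
  exact: sq_eq a0 (posdef_det_gt0 pM) (posdef_det_gt0 pN) dets.
- rewrite !spectral_normE.
  exact: form_norm_comparison pN pM pA wA wE (ltW (P0 _)) le1.
- rewrite !spectral_normE.
  apply: (form_norm_comparison pM pN wA pA pE) => [|X].
    by rewrite invr_ge0 ltW.
  by rewrite exprVn; exact: le2.
Qed.

Lemma prod_split_ord (m : nat) (s : 'I_n -> R) :
  \prod_i s i = (\prod_(i < n | (i < m)%N) s i) * (\prod_(i < n | (m <= i)%N) s i).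
Proof.
rewrite (bigID (fun i : 'I_n => (i < m)%N)) /=; congr (_ * _).
by apply: eq_bigl => i; rewrite -leqNgt.
Qed.

Lemma sv_weight_gt0 m a b x : 0 < sv_weight m a b (alpha x).
Proof.
have [s0 _ _ _] := pushforward_singular_bounds x.
by rewrite /sv_weight mulr_gt0 // powR_gt0 // prodr_gt0.
Qed.

(** The Jacobian is the product of all the singular values; splitting it at index
    [n - k], respectively [k], its power [a] combines with the bound on the norm
    to an exponent [a - 1 = - b], respectively [1 - a = b], on one of the two factors. *)
Lemma pushforward_weighted_bounds (a b : R) x : a + b = 1 ->
  volume_ratio gM gN phi x `^ a * spectral_norm gN (pushforward_form phi w) (phi x)
    <= sv_weight (n - k) a b (alpha x) * spectral_norm gM w x /\
  (volume_ratio gM gN phi x)^-1 `^ a * spectral_norm gM w x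
    <= sv_weight k b a (alpha x) * spectral_norm gN (pushforward_form phi w) (phi x).
Proof.
move=> ab; have ab1 : a - 1 = - b by lra.
have ab2 : - a + 1 = b by lra.
have [s0 -> le1 le2] := pushforward_singular_bounds x.
have P0 (P : pred 'I_n) : 0 < \prod_(i < n | P i) alpha x i by apply: prodr_gt0.
have pow_mul (p : R) c : 0 < p -> p `^ c * p^-1 = p `^ (c - 1).
  move=> p0; rewrite powRB; first by rewrite powRr1 // ltW.
  by rewrite (gt_eqF p0) implybT.
split.
- rewrite (prod_split_ord (n - k)) /sv_weight.
  have p0 := P0 (fun i => (i < n - k)%N); have q0 := P0 (fun i => (n - k <= i)%N).
  move: p0 q0 le2; set p := (\prod_(i < n | (i < n - k)%N) alpha x i).
  set q := (\prod_(i < n | (n - k <= i)%N) alpha x i) => p0 q0 le2.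
  have pq0 : 0 <= (p * q) `^ a by exact: powR_ge0.
  apply: le_trans (ler_wpM2l pq0 le2) _.
  by rewrite (powRM a (ltW p0) (ltW q0)) mulrA -[_ * _ / q]mulrA pow_mul // ab1.
- rewrite (prod_split_ord k) /sv_weight.
  have p0 := P0 (fun i => (i < k)%N); have q0 := P0 (fun i => (k <= i)%N).
  move: p0 q0 le1; set p := (\prod_(i < n | (i < k)%N) alpha x i).
  set q := (\prod_(i < n | (k <= i)%N) alpha x i) => p0 q0 le1.
  have -> : (p * q)^-1 `^ a = p `^ (- a) * q `^ (- a).
    rewrite -powR_inv1; last by rewrite mulr_ge0 // ltW.
    by rewrite -powRrM mulN1r (powRM (- a) (ltW p0) (ltW q0)).
  have pq0 : 0 <= p `^ (- a) * q `^ (- a) by rewrite mulr_ge0 ?powR_ge0.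
  apply: le_trans (ler_wpM2l pq0 le1) _.
  rewrite mulrA; apply: ler_wpM2r.
    rewrite spectral_normE; apply: form_norm_ge0; first exact: gram_posdef.
    apply: alternating_form_mulmxr; exact: kform_alternating.
  rewrite mulrAC ler_wpM2r ?powR_ge0 //.
  rewrite -{2}[p]powRr1; last exact: ltW.
  rewrite -powRD; last by rewrite (gt_eqF p0) implybT.
  by rewrite ab2.
Qed.

End singular_values_of_diffeomorphisms.

(** * Comparison of norms of forms *)

Section weighted_comparison.
Variables (R : realType) (n : nat).
Implicit Types M N : manifold R n.

Lemma fun_Linfty_ge0 M (mu : {measure set (borel M) -> \bar R}) (f : M -> R) :
  (0 <= fun_Linfty mu f)%E.
Proof. exact: Lnorm_ge0. Qed.

Lemma fun_Linfty_ae M (mu : {measure set (borel M) -> \bar R}) (f : M -> R) (C : R) :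
  (fun_Linfty mu f <= C%:E)%E -> {ae mu, forall x : borel M, f x <= C}.
Proof.
rewrite /fun_Linfty unlock; case: ifPn => [_ /ess_supP|].
  by apply: filterS => x /=; rewrite lee_fin; apply: le_trans; exact: ler_norm.
rewrite lt_def measure_ge0 andbT negbK => /eqP mu0 _.
by exists setT; split.
Qed.

(** The infimum over the constants [C].  Finiteness of [B] excludes the product
    of an arbitrarily small [C] with an infinite norm. *)
Lemma le_mul_fun_Linfty M (mu : {measure set (borel M) -> \bar R}) (f : M -> R)
    (A B : \bar R) :
  (0 <= B < +oo)%E -> (fun_Linfty mu f < +oo)%E ->
  (forall C : R, 0 < C -> {ae mu, forall x : borel M, f x <= C} -> (A <= C%:E * B)%E) ->
  (A <= fun_Linfty mu f * B)%E.
Proof.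
have := fun_Linfty_ge0 mu f; have := @fun_Linfty_ae M mu f.
case: (fun_Linfty mu f) => [L||//]; last by rewrite ltxx.
move: B => [B||//]; rewrite ?ltxx ?andbF // => ae; rewrite !lee_fin => L0 /andP[B0 _] _ h.
apply/lee_addgt0Pr => e e0.
have B1 : 0 < B + 1 by rewrite ltr_wpDl.
have d0 : 0 < e / (B + 1) by rewrite divr_gt0.
apply: le_trans (h (L + e / (B + 1)) _ _) _.
- by rewrite ltr_wpDl.
- by apply: ae; rewrite lee_fin lerDl ltW.
- rewrite -!EFinM -EFinD lee_fin mulrDl lerD2l mulrAC ler_pdivrMr //.
  by rewrite ler_pM2l // lerDl.
Qed.

Lemma spectral_norm_ge0 M (g : riemannian_metric M) k (w : M -> 'M[R]_(k, n) -> R) x :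
  alternating_form (w x) -> 0 <= spectral_norm g w x.
Proof.
by move=> wA; rewrite spectral_normE; exact: form_norm_ge0 (gram_posdef g x) wA.
Qed.

Lemma pushforward_alternating M N (phi : diffeo M N) k (w : M -> 'M[R]_(k, n) -> R) y :
  kform w -> alternating_form (pushforward_form phi w y).
Proof. by move=> wform; apply: alternating_form_mulmxr; exact: kform_alternating. Qed.

Lemma inv_exp_add (p q : \bar R) : (1 <= p)%E -> (1 <= q)%E ->
  (p^-1 + q^-1 = 1)%E -> inv_exp p + inv_exp q = 1.
Proof.
have fin (r : \bar R) : (1 <= r)%E -> (r^-1)%E \is a fin_num.
  case: r => [r|_|//]; last by rewrite invey.
  by rewrite lee_fin inver => r1; rewrite gt_eqF // (lt_le_trans ltr01).
by move=> p1 q1 pq; rewrite /inv_exp -fineD ?fin // pq.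
Qed.

Definition inverse_diffeo M N (phi : diffeo M N) : diffeo N M :=
  Diffeo (@dinvK _ _ _ _ phi) (@dfunK _ _ _ _ phi)
    (@dinv_smooth _ _ _ _ phi) (@dfun_smooth _ _ _ _ phi).

Variables (M N : manifold R n).
Variables (gM : riemannian_metric M) (gN : riemannian_metric N).
Variables (oM : orientation M) (oN : orientation N).
Variables (muM : {measure set (borel M) -> \bar R}).
Variables (muN : {measure set (borel N) -> \bar R}).
Hypotheses (hmuM : riemannian_volume gM muM) (hmuN : riemannian_volume gN muN).
Variables (phi : diffeo M N) (alpha : M -> 'I_n -> R).
Hypothesis halpha : singular_values gM gN oM oN phi alpha.
Variables (k : nat) (hk : (k <= n)%N) (w : M -> 'M[R]_(k, n) -> R).
Hypothesis wform : kform w.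
Variables (p q : \bar R) (hp : (1 <= p)%E) (hq : (1 <= q)%E).
Hypothesis hpq : (p^-1 + q^-1 = 1)%E.
Local Notation W := (fun x => sv_weight (n - k) (inv_exp p) (inv_exp q) (alpha x)).
Local Notation W' := (fun x => sv_weight k (inv_exp q) (inv_exp p) (alpha x)).

Lemma pushforward_Lnorm_le (C : R) : 0 < C ->
  {ae muM, forall x : borel M, W x <= C} ->
  (form_Lnorm gN muN p (pushforward_form phi w) <= C%:E * form_Lnorm gM muM p w)%E.
Proof.
move=> C0 WC; apply: (diffeo_Lnorm_le hmuM hmuN (phi := phi)) => //.
- by move=> y; apply: spectral_norm_ge0; exact: pushforward_alternating.
- by move=> x; apply: spectral_norm_ge0; exact: kform_alternating.
apply: filterS WC => x WC.
have [h _] := pushforward_weighted_bounds halpha hk wform x (inv_exp_add hp hq hpq).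
apply: le_trans h _; apply: ler_wpM2r WC.
by apply: spectral_norm_ge0; exact: kform_alternating.
Qed.

(** The transfer of norms along [phi^-1], whose Jacobian is the inverse of that
    of [phi]; the almost everywhere bound on [M] becomes one on [N]. *)
Lemma pushforward_Lnorm_ge (C : R) : 0 < C ->
  {ae muM, forall x : borel M, W' x <= C} ->
  (form_Lnorm gM muM p w <= C%:E * form_Lnorm gN muN p (pushforward_form phi w))%E.
Proof.
move=> C0 WC; apply: (diffeo_Lnorm_le hmuN hmuM (phi := inverse_diffeo phi)) => //.
- by move=> x; apply: spectral_norm_ge0; exact: kform_alternating.
- by move=> y; apply: spectral_norm_ge0; exact: pushforward_alternating.
have := diffeo_ae hmuM hmuN phi WC; apply: filterS => y {}WC.
have [_] := pushforward_weighted_bounds halpha hk wform (Defs.dinv phi y)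
  (inv_exp_add hp hq hpq).
rewrite dinvK -volume_ratio_dinv => h.
apply: le_trans h _; apply: ler_wpM2r WC.
by apply: spectral_norm_ge0; exact: pushforward_alternating.
Qed.

End weighted_comparison.

Theorem corollary6 (R : realType) (n : nat) (M N : manifold R n)
    (gM : riemannian_metric M) (gN : riemannian_metric N)
    (oM : orientation M) (oN : orientation N)
    (muM : {measure set (borel M) -> \bar R})
    (muN : {measure set (borel N) -> \bar R})
    (hmuM : riemannian_volume gM muM) (hmuN : riemannian_volume gN muN)
    (phi : diffeo M N) (hphi : orientation_preserving oM oN phi)
    (alpha : M -> 'I_n -> R) (halpha : singular_values gM gN oM oN phi alpha)
    (p q : \bar R) (hp : (1 <= p)%E) (hq : (1 <= q)%E)
    (hpq : (p^-1 + q^-1 = 1)%E)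
    (k : nat) (hk : (k <= n)%N)
    (hbound : exists B : R, forall x : M,
       sv_weight (n - k) (inv_exp p) (inv_exp q) (alpha x) <= B)
    (w : M -> 'M[R]_(k, n) -> R) (hw : Lp_form gM muM p w) :
  ((fun_Linfty muM (fun x => sv_weight k (inv_exp q) (inv_exp p) (alpha x)))^-1
     * form_Lnorm gM muM p w
   <= form_Lnorm gN muN p (pushforward_form phi w))%E /\
  (form_Lnorm gN muN p (pushforward_form phi w)
   <= fun_Linfty muM
        (fun x => sv_weight (n - k) (inv_exp p) (inv_exp q) (alpha x))
      * form_Lnorm gM muM p w)%E.
Proof.
have [[wform _] woo] := hw.
have normM0 : (0 <= form_Lnorm gM muM p w)%E by exact: Lnorm_ge0.
have normN0 : (0 <= form_Lnorm gN muN p (pushforward_form phi w))%E by exact: Lnorm_ge0.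
split; last first.
  apply: le_mul_fun_Linfty; first by rewrite normM0.
    have [B WB] := hbound.
    apply: (@le_lt_trans _ _ (Num.max B 0)%:E); last exact: ltry.
    rewrite /fun_Linfty unlock; case: ifPn => _; last by rewrite lee_fin le_max lexx orbT.
    apply/ess_supP; apply: nearW => x /=.
    rewrite lee_fin ger0_norm; last exact: ltW (sv_weight_gt0 halpha hk wform _ _ _ x).
    by rewrite le_max WB.
  move=> C C0; exact: (pushforward_Lnorm_le hmuM hmuN halpha hk wform hp hq hpq C0).
have [->|noo] := eqVneq (form_Lnorm gN muN p (pushforward_form phi w)) +oo%E.
  exact: leey.
have := fun_Linfty_ge0 muM (fun x => sv_weight k (inv_exp q) (inv_exp p) (alpha x)).
have : (fun_Linfty muM (fun x => sv_weight k (inv_exp q) (inv_exp p) (alpha x)) < +oo ->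
    form_Lnorm gM muM p w <=
    fun_Linfty muM (fun x => sv_weight k (inv_exp q) (inv_exp p) (alpha x)) *
    form_Lnorm gN muN p (pushforward_form phi w))%E.
  move=> Loo; apply: le_mul_fun_Linfty => //; first by rewrite normN0 ltey.
  move=> C C0; exact: (pushforward_Lnorm_ge hmuM hmuN halpha hk wform hp hq hpq C0).
move: normM0 normN0; move: (form_Lnorm gM _ _ _) (form_Lnorm gN _ _ _) => A B.
case: (fun_Linfty _ _) => [L||//] A0 B0 AB L0; last by rewrite invey mul0e.
have {}AB : (A <= L%:E * B)%E by apply: AB; exact: ltry.
(* for L = 0 the inverse is infinite, but A vanishes *)
have [L_eq0|Ln0] := eqVneq L 0.
  suff -> : A = 0%E by rewrite mule0.
  by apply/le_anti; rewrite A0 andbT; move: AB; rewrite L_eq0 mul0e.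
rewrite inver (negbTE Ln0) lee_pdivrMl //.
by rewrite lt_def Ln0 -lee_fin.
Qed.
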